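(* Let $\lambda\in\Gamma$ be a tame composition of $r$. Let $K_{-1}^\lambda=\{0\}\subseteq C_{-1}^\lambda$; let $K_0^\lambda\subseteq C_0^\lambda=\mathrm{Hom}_R(M^\lambda,R)$ be the $R$-span of the elements $\varepsilon_t$ with $t\in\mathcal{T}^{\mathrm{st}}(\lambda)$; and for $n\ge1$ let $K_n^\lambda\subseteq C_n^\lambda$ be the $R$-span of all elements $$\varphi_{e_1}^{\lambda^{(1)},\lambda^{(0)}}\otimes\cdots\otimes\varphi_{e_n}^{\lambda^{(n)},\lambda^{(n-1)}}\otimes\varepsilon_t\in M_\gamma\subseteq C_n^\lambda$$ with $\gamma=(\lambda=\lambda^{(0)}\triangleleft\lambda^{(1)}\triangleleft\cdots\triangleleft\lambda^{(n)})\in\Delta_n^\lambda$, $e_i\in\mathcal{D}^\wedge_{\lambda^{(i)},\lambda^{(i-1)}}$ for $i=1,\ldots,n$, and $t\in\mathcal{T}^{\mathrm{st}}(\lambda^{(n)})$. Then, for all $n\ge-1$, $$\mathrm{im}(d_{n+1}^\lambda)+K_n^\lambda=C_n^\lambda\qquad\text{and}\qquad\ker(d_n^\lambda)\cap K_n^\lambda=\{0\}.$$ In particular, the chain complex $\widetilde{C}_*^\lambda$ is exact.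
   Context: Hecke algebra. $R$ is an integral domain, $q\in R$ a unit, $r$ a positive integer. $W$ is the symmetric group on $\{1,\ldots,r\}$, acting from the right (so $i(vw)=(iv)w$), $S=\{(i,i+1)\mid 1\le i\le r-1\}$, and $l$ is the length function with respect to $S$. $\mathcal{H}$ is the $R$-algebra with $R$-basis $T_w$ ($w\in W$), identity $T_1$, and multiplication determined, for $w\in W$, $s\in S$, by $T_wT_s=T_{ws}$ if $l(ws)=l(w)+1$ and $T_wT_s=qT_{ws}+(q-1)T_w$ if $l(ws)=l(w)-1$. Unadorned $\otimes$ is over $R$. Compositions. $\Gamma$ is the set of compositions $\lambda=(\lambda_1,\lambda_2,\ldots)$ of $r$ (sequences of non-negative integers with sum $r$), $\Lambda\subseteq\Gamma$ the set of partitions (weakly decreasing compositions). For $\lambda,\mu\in\Gamma$, $\lambda\trianglelefteq\mu$ means $\sum_{i=1}^e\lambda_i\le\sum_{i=1}^e\mu_i$ for all $e\ge1$; $\lambda\triangleleft\mu$ means $\lambda\trianglelefteq\mu$ and $\lambda\ne\mu$. For $\lambda\in\Lambda$, $\lambda'$ is the conjugate partition. For $\mu\in\Gamma$, $\bar\mu\in\Lambda$ denotes the unique smallest partition (with respect to $\trianglelefteq$) which dominates $\mu$, i.e. with $\mu\trianglelefteq\bar\mu$ (it exists), and $\mu^*\in\Lambda$ denotes the partition obtained by reordering the parts of $\mu$ in weakly descending order. $\mu$ is called a quasi-partition if $\mu^*=\bar\mu$. A composition $\lambda\in\Gamma$ is called tame if every $\mu\in\Gamma$ with $\lambda\trianglelefteq\mu$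 is a quasi-partition. Permutation modules. For $\lambda\in\Gamma$ let $P_i=P_i^\lambda=\{\lambda_1+\cdots+\lambda_{i-1}+1,\ldots,\lambda_1+\cdots+\lambda_i\}$ and let $W_\lambda$ be the subgroup of all $w\in W$ with $P_iw=P_i$ for all $i$. Put $x_\lambda=\sum_{w\in W_\lambda}T_w$ and $M^\lambda=x_\lambda\mathcal{H}$ (a right $\mathcal{H}$-module). $\mathcal{D}_\lambda$ is the set of the unique shortest elements of the cosets $W_\lambda w$; the elements $x_\lambda T_d$ ($d\in\mathcal{D}_\lambda$) form an $R$-basis of $M^\lambda$. Tableaux. A $\lambda$-tableau is a bijective filling of the Young diagram of $\lambda$ ($\lambda_i$ boxes in row $i$) with $1,\ldots,r$; $W$ acts on tableaux from the right by acting on the entries. $t^\lambda$ is the $\lambda$-tableau with entries $1,\ldots,r$ in order along the rows, from the first row downwards. A tableau is row-standard if its entries increase along each row from left to right; $\mathcal{T}^{\mathrm{rs}}(\lambda)$ is the set of row-standard $\lambda$-tableaux. The map $\mathcal{D}_\lambda\to\mathcal{T}^{\mathrm{rs}}(\lambda)$, $d\mapsto t^\lambda d$, is a bijection. If $\lambda\in\Lambda$, $\mathcal{T}^{\mathrm{st}}(\lambda)$ is the set of standard $\lambda$-tableaux (entries increasing along rows and down columns); if $\lambda$ is not a partition, $\mathcal{T}^{\mathrm{st}}(\lambda)=\emptyset$. For $t=t^\lambda d\in\mathcal{T}^{\mathrm{rs}}(\lambda)$ with $d\in\mathcal{D}_\lambda$, $\varepsilon_t=\varepsilon_d\in\mathrm{Hom}_R(M^\lambda,R)$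 is the dual basis element, $\varepsilon_d(x_\lambda T_e)=\delta_{d,e}$ for $e\in\mathcal{D}_\lambda$. Specht modules. For $\lambda\in\Lambda$, $w_\lambda\in W$ is defined by the property that the transpose of $t^\lambda w_\lambda$ is $t^{\lambda'}$; $y_\lambda=\sum_{w\in W_\lambda}(-q)^{-l(w)}T_w$, $z_\lambda=x_\lambda T_{w_\lambda}y_{\lambda'}$, and $S^\lambda=z_\lambda\mathcal{H}\subseteq M^\lambda$. If $\lambda\in\Gamma$ is not a partition, $S^\lambda:=0$. Homomorphisms. For $\lambda,\mu\in\Gamma$ let $\mathcal{D}_{\lambda,\mu}=\mathcal{D}_\lambda\cap\mathcal{D}_\mu^{-1}$, a set of representatives of $W_\lambda\backslash W/W_\mu$. $\mathrm{Hom}_{\mathcal{H}}(M^\mu,M^\lambda)$ has $R$-basis $\varphi_d^{\lambda,\mu}$ ($d\in\mathcal{D}_{\lambda,\mu}$), where $\varphi_d^{\lambda,\mu}(x_\mu)=\sum_{w\in W_\lambda dW_\mu}T_w$. Let $\mathcal{D}^\wedge_{\lambda,\mu}$ be the set of $d\in\mathcal{D}_{\lambda,\mu}$ with $P^\lambda_i d\subseteq\bigcup_{j\ge i}P^\mu_j$ for all $i\ge1$ (equivalently, the corresponding row-semistandard generalized tableau of shape $\lambda$ and content $\mu$ has only entries $\ge i$ in its $i$-th row, for every $i$). Put $\mathrm{Hom}^\wedge_{\mathcal{H}}(M^\mu,M^\lambda)=\bigoplus_{d\in\mathcal{D}^\wedge_{\lambda,\mu}}R\varphi_d^{\lambda,\mu}$.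 Composites of such homomorphisms again lie in the corresponding module $\mathrm{Hom}^\wedge_{\mathcal{H}}$. Chain complex. For $n\ge0$ let $\Delta_n^\lambda$ be the set of chains $\gamma=(\lambda^{(0)}\triangleleft\cdots\triangleleft\lambda^{(n)})$ in $\Gamma$ with $\lambda^{(0)}=\lambda$, let $M_\gamma=\mathrm{Hom}^\wedge_{\mathcal{H}}(M^{\lambda^{(0)}},M^{\lambda^{(1)}})\otimes\cdots\otimes\mathrm{Hom}^\wedge_{\mathcal{H}}(M^{\lambda^{(n-1)}},M^{\lambda^{(n)}})\otimes\mathrm{Hom}_R(M^{\lambda^{(n)}},R)$, and $C_n^\lambda=\bigoplus_{\gamma\in\Delta_n^\lambda}M_\gamma$. $C_n^\lambda$ is a left $\mathcal{H}$-module via the action $(h\varepsilon)(m)=\varepsilon(mh)$ on the last tensor factor. For $n\ge1$, $d_n^\lambda=\sum_{i=1}^n(-1)^{i-1}d_{n,i}^\lambda\colon C_n^\lambda\to C_{n-1}^\lambda$, where $d_{n,i}^\lambda$ maps $M_\gamma$ to $M_{\gamma_i}$ ($\gamma_i$ is $\gamma$ with $\lambda^{(i)}$ omitted) by $\varphi_1\otimes\cdots\otimes\varphi_n\otimes\varepsilon\mapsto\varphi_1\otimes\cdots\otimes(\varphi_{i+1}\circ\varphi_i)\otimes\cdots\otimes\varphi_n\otimes\varepsilon$, with $\varphi_{n+1}$ read as $\varepsilon$ when $i=n$. Finally $C_{-1}^\lambda=\mathrm{Hom}_R(S^\lambda,R)$, $d_0^\lambda\colon C_0^\lambda=\mathrm{Hom}_R(M^\lambda,R)\to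 C_{-1}^\lambda$ is restriction $\varepsilon\mapsto\varepsilon|_{S^\lambda}$, and $d_{-1}^\lambda\colon C_{-1}^\lambda\to0$ is the zero map. $\widetilde{C}_*^\lambda$ is the resulting chain complex $0\to C^\lambda_{a(\lambda)}\to\cdots\to C_1^\lambda\to C_0^\lambda\to C_{-1}^\lambda\to0$, where $a(\lambda)$ is the largest $n$ with $\Delta_n^\lambda\neq\emptyset$ (and $C_n^\lambda=0$ for $n>a(\lambda)$). *)

(* Defs.v *)
From HB Require Import structures.
From mathcomp Require Import all_boot all_order all_algebra all_fingroup generic_quotient.
From mathcomp Require Import boolp classical_sets functions.

Set Implicit Arguments.
Unset Strict Implicit.
Unset Printing Implicit Defensive.

Import GRing.Theory.

(* A composition, i.e. a sequence of natural numbers (indexed from 0 here) with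
   sum r, is encoded by the list of its entries up to the last non-zero one. *)
Record composition (r : nat) := Composition {
  cseq :> seq nat;
  compP : (sumn cseq == r) && (last 1%N cseq != 0%N)
}.

HB.instance Definition _ r := [isSub for @cseq r].
HB.instance Definition _ r := [Countable of composition r by <:].

Section Compositions.
Variable r : nat.
Implicit Types lam mu nu : composition r.
Local Open Scope nat_scope.

Definition part lam (i : nat) : nat := nth 0 lam i.
Definition psum lam (e : nat) : nat := \sum_(i < e) part lam i.

Definition dom lam mu : bool := `[< forall e, psum lam e <= psum mu e >].
Definition sdom lam mu : bool := dom lam mu && (lam != mu).

Definition is_part lam : bool := sorted geq lam.

Lemma sumn_comp lam : sumn lam = r.
Proof. by case: lam => s /= /andP[/eqP]. Qed.

Lemma comp_last lam : last 1 lam != 0.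
Proof. by case: lam => s /= /andP[]. Qed.

Lemma psumE lam e : psum lam e = sumn (take e lam).
Proof.
rewrite /psum /part; elim: e (cseq lam) => [|e IH] [|x s] /=.
- by rewrite big_ord0.
- by rewrite big_ord0.
- by rewrite big1 // => i _; rewrite nth_nil.
- by rewrite big_ord_recl /= -IH.
Qed.

Lemma psum_leq lam e : psum lam e <= r.
Proof. by rewrite psumE -[X in _ <= X](sumn_comp lam) -{2}(cat_take_drop e lam) sumn_cat leq_addr. Qed.

Lemma psum_mono lam e f : e <= f -> psum lam e <= psum lam f.
Proof.
move=> /subnKC <-; rewrite !psumE takeD sumn_cat; exact: leq_addr.
Qed.

Lemma psumS lam e : psum lam e.+1 = psum lam e + part lam e.
Proof. by rewrite /psum big_ord_recr. Qed.

Lemma psum_size lam e : size lam <= e -> psum lam e = r.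
Proof. by move=> le; rewrite psumE take_oversize // sumn_comp. Qed.

Lemma part_leq lam i : part lam i <= r.
Proof. by apply: leq_trans (psum_leq lam i.+1); rewrite psumS leq_addl. Qed.

Lemma dom_size lam mu : dom lam mu -> size mu <= size lam.
Proof.
move=> /asboolP h; rewrite leqNgt; apply/negP => lt.
have := h (size mu).-1; rewrite psum_size; last by rewrite -ltnS prednK //; apply: leq_ltn_trans lt.
have mu0 : 0 < size mu by apply: leq_ltn_trans lt.
have e : psum mu (size mu).-1 + part mu (size mu).-1 = r.
  by rewrite -psumS prednK // psum_size.
have := comp_last mu; rewrite -[X in last X _]/(1) (last_nth 0).
case E: (cseq mu) mu0 => [|x s] // _.
rewrite -[nth 0 _ _]/(nth 0 (x :: s) (size (x :: s)).-1) -E -/(part mu _) => p0 h'.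
by move: h'; rewrite -{1}e -{2}[psum _ _]addn0 leq_add2l leqn0 (negPf p0).
Qed.

Lemma comp_ext lam mu : (forall i, part lam i = part mu i) -> lam = mu.
Proof.
have le l m : (forall i, part l i = part m i) -> size l <= size m.
  move=> h; apply: dom_size; apply/asboolP => e.
  by rewrite /psum; apply: leq_sum => i _; rewrite h.
move=> h; apply: val_inj => /=; apply: (@eq_from_nth _ 0).
  by apply/eqP; rewrite eqn_leq !le.
by move=> i _; exact: h.
Qed.

Lemma dom_refl lam : dom lam lam.
Proof. by apply/asboolP. Qed.

Lemma dom_trans : transitive dom.
Proof.
move=> b a c /asboolP h /asboolP h'; apply/asboolP => e.
exact: leq_trans (h e) (h' e).
Qed.

Lemma dom_anti lam mu : dom lam mu -> dom mu lam -> lam = mu.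
Proof.
move=> /asboolP h /asboolP h'; apply: comp_ext => i.
have e j : psum lam j = psum mu j by apply/eqP; rewrite eqn_leq h h'.
by have := e i.+1; rewrite !psumS e => /addnI.
Qed.

Lemma sdom_trans : transitive sdom.
Proof.
move=> b a c /andP[ab nab] /andP[bc nbc]; rewrite /sdom (dom_trans ab bc) /=.
by apply: contraNneq nbc => e; rewrite e in ab; apply/eqP/dom_anti.
Qed.

Lemma star_subproof lam :
  let s := sort geq (filter (ltn 0) lam) in
  (sumn s == r) && (last 1 s != 0).
Proof.
set s := sort _ _; have ps : perm_eq s (filter (ltn 0) lam) by rewrite /s perm_sort.
rewrite /= (perm_sumn ps); apply/andP; split.
  apply/eqP/(etrans _ (sumn_comp lam)).
  by elim: (cseq lam) => //= -[|x] t IH //=; rewrite IH.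
have: all (ltn 0) (1 :: s) by rewrite /= (perm_all _ ps) filter_all.
by move/allP/(_ _ (mem_last _ _)); case: (last _ _).
Qed.

Definition star lam : composition r := Composition (star_subproof lam).

Lemma sum_count_ltn (s : seq nat) n : (forall x, x \in s -> x <= n) ->
  sumn (mkseq (fun j => count (ltn j) s) n) = sumn s.
Proof.
elim: s => [|x s IH] le /=.
  rewrite /mkseq; elim: (iota _ _) => //= _ t ->; exact: addn0.
rewrite -IH; last by move=> y ys; apply: le; rewrite inE ys orbT.
have xE : sumn (mkseq (fun j => (j < x) : nat) n) = x.
  rewrite /mkseq (sumn_count (fun j => j < x)).
  have lx : x <= n by apply: le; rewrite mem_head.
  rewrite -size_filter -(subnKC lx) iotaD filter_cat size_cat.
  rewrite (@eq_in_filter _ _ predT); last by move=> j; rewrite mem_iota.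
  rewrite filter_predT size_iota (@eq_in_filter _ _ pred0) ?filter_pred0 ?addn0 //.
  by move=> j; rewrite mem_iota add0n => /andP[]; rewrite leqNgt => /negPf.
rewrite -[X in X + _]xE !sumnE !big_map -big_split.
by apply: eq_bigr.
Qed.

Lemma conj_comp_subproof lam :
  let s := mkseq (fun j => count (ltn j) lam) (foldr maxn 0 lam) in
  (sumn s == r) && (last 1 s != 0).
Proof.
have le x : x \in cseq lam -> x <= foldr maxn 0 lam.
  elim: (cseq lam) => //= y t IH; rewrite inE leq_max => /orP[/eqP->|/IH ->].
    by rewrite leqnn.
  by rewrite orbT.
rewrite /= sum_count_ltn // sumn_comp eqxx /=.
case E: (foldr maxn 0 lam) => [//|m].
rewrite /mkseq -[m.+1]addn1 iotaD map_cat last_cat /= add0n -lt0n -has_count.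
rewrite -[has _ _]negbK -all_predC; apply/negP => a.
suff : foldr maxn 0 lam <= m by rewrite E ltnn.
elim: (cseq lam) a => //= y t IH /andP[ym /IH tm].
by rewrite geq_max tm andbT leqNgt.
Qed.

(* The conjugate: its j-th part is the number of i such that j < lam_i (j >= 0).
   It is used for partitions only. *)
Definition conj_comp lam : composition r := Composition (conj_comp_subproof lam).

(* nu is the smallest partition dominating mu; antisymmetry of dom makes such
   a nu unique. *)
Definition is_bar mu nu : Prop :=
  [/\ is_part nu, dom mu nu &
      forall rho, is_part rho -> dom mu rho -> dom nu rho].

Definition quasi_partition mu : Prop := is_bar mu (star mu).

Definition tame lam : Prop := forall mu, dom lam mu -> quasi_partition mu.

(* The block P_i of {0, ..., r-1}; it is empty for i >= size lam. *)
Definition block lam (i : nat) : {set 'I_r} :=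
  [set k : 'I_r | psum lam i <= k < psum lam i.+1].

End Compositions.


Section Chains.
Variable r : nat.
Implicit Types lam mu : composition r.

Fixpoint del (X : Type) (i : nat) (s : seq X) {struct s} : seq X :=
  match s, i with
  | [::], _ => [::]
  | _ :: s', 0%N => s'
  | x :: s', i'.+1 => x :: del i' s'
  end.

Lemma size_del (X : Type) (i : nat) (s : seq X) :
  (i < size s)%N -> size (del i s) = (size s).-1.
Proof.
elim: s i => [|x s IH] [|i] //= lt.
by rewrite IH // prednK //; apply: (@leq_ltn_trans i).
Qed.

Lemma path_del (X : Type) (e : rel X) x (s : seq X) i :
  transitive e -> path e x s -> path e x (del i s).
Proof.
move=> tr; elim: s x i => [|y s IH] x [|i] //= /andP[xy ys].
  by case: s ys {IH} => //= z s /andP[/(tr _ _ _ xy) -> ->].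
by rewrite xy IH.
Qed.

(* The chain lam < s_1 < ... < s_n, given by the list of the s_i. *)
Record chain lam (n : nat) := Chain {
  cseqs :> seq (composition r);
  chainP : (size cseqs == n) && path (@sdom r) lam cseqs
}.
HB.instance Definition _ lam n := [isSub for @cseqs lam n].
HB.instance Definition _ lam n := [Countable of chain lam n by <:].

Lemma chain_dom lam n (g : chain lam n) mu : mu \in cseqs g -> dom lam mu.
Proof.
case: g => s /= /andP[_ p] ms.
have := order_path_min (@sdom_trans r) p.
by move=> /allP/(_ _ ms)/andP[].
Qed.

Definition chain_code lam n (g : chain lam n) :
    {ffun 'I_n * 'I_(size lam) -> 'I_r.+1} :=
  [ffun p : 'I_n * 'I_(size lam) => inord (part (nth lam g p.1) p.2)].

Lemma chain_code_inj lam n : injective (@chain_code lam n).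
Proof.
move=> g h E; apply: val_inj => /=.
have sz (k : chain lam n) : size k = n by case: k => s /= /andP[/eqP].
apply: (@eq_from_nth _ lam) => [|i]; rewrite !sz // => lt.
have small (k : chain lam n) j : (size lam <= j)%N -> part (nth lam k i) j = 0%N.
  move=> le; rewrite /part nth_default //; apply: leq_trans le.
  by apply/dom_size/(chain_dom (g := k)); rewrite mem_nth // sz.
apply: comp_ext => j; have [le|ltj] := leqP (size lam) j; first by rewrite !small.
move/ffunP/(_ (Ordinal lt, Ordinal ltj)): E; rewrite !ffunE /= => /(congr1 val).
by rewrite /= !inordK // ltnS part_leq.
Qed.

Definition chain_decode lam n
    (c : {ffun 'I_n * 'I_(size lam) -> 'I_r.+1}) : option (chain lam n) :=
  xget None [set o | exists2 g, o = Some g & chain_code g = c].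

Lemma chain_codeK lam n : pcancel (@chain_code lam n) (@chain_decode lam n).
Proof.
move=> g; rewrite /chain_decode; case: xgetP => [o _ [h -> /chain_code_inj ->]|] //.
by move/(_ (Some g)) => []; exists g.
Qed.

HB.instance Definition _ lam n := isFinite.Build (chain lam n)
  (@pcan_enumP (chain lam n) _ _ _ (@chain_codeK lam n)).

Lemma chain0_subproof lam :
  (size ([::] : seq (composition r)) == 0)%N && path (@sdom r) lam [::].
Proof. by []. Qed.

Definition chain0 lam : chain lam 0 := Chain (chain0_subproof lam).

Lemma chain_del_subproof lam n (g : chain lam n.+1) (i : 'I_n.+1) :
  (size (del i g) == n) && path (@sdom r) lam (del i g).
Proof.
case: g => s /= /andP[/eqP sz p].
by rewrite size_del ?sz // eqxx path_del //; apply: sdom_trans.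
Qed.

Definition chain_del lam n (g : chain lam n.+1) (i : 'I_n.+1) : chain lam n :=
  Chain (chain_del_subproof g i).

End Chains.

(* Products in 'S_r are composed from left to right: (v * w) i = w (v i). *)
Section SymmetricGroup.
Variable r : nat.
Implicit Types (lam mu : composition r) (w d : 'S_r).
Local Open Scope group_scope.

Definition simple_refls : {set 'S_r} :=
  [set w | [exists i : 'I_r, exists j : 'I_r,
              (nat_of_ord j == i.+1) && (w == tperm i j)]].

Lemma simple_reflsP (i j : 'I_r) : nat_of_ord j = i.+1 ->
  tperm i j \in simple_refls.
Proof.
by move=> h; rewrite inE; apply/existsP; exists i; apply/existsP; exists j; rewrite h !eqxx.
Qed.

Lemma gen_simple_refls : <<simple_refls>> = [set: 'S_r].
Proof.
apply/eqP; rewrite finset.eqEsubset finset.subsetT /=; apply/fintype.subsetP => w _.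
have tp n : forall i j : 'I_r, j = i + n.+1 :> nat ->
    tperm i j \in <<simple_refls>>.
  elim: n => [|n IH] i j ij.
    by apply/mem_gen/simple_reflsP; rewrite ij addn1.
  have lt : i + n.+1 < r by apply: ltn_trans (ltn_ord j); rewrite ij ltn_add2l.
  pose k := Ordinal lt.
  have ik : i != k by rewrite -val_eqE /= -[X in X == _]addn0 eqn_add2l.
  have jk : j != k by rewrite -val_eqE /= ij eqn_add2l -addn1 -[X in _ == X]addn0 eqn_add2l.
  have ijn : i != j by rewrite -val_eqE /= ij -[X in X == _]addn0 eqn_add2l.
  have -> : tperm i j = tperm i k ^ tperm k j.
    by rewrite tpermJ tpermL tpermD // eq_sym.
  apply: groupJ; first exact: IH.
  by apply/mem_gen/simple_reflsP; rewrite ij addnS.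
have [ts -> _] := prod_tpermP w.
apply: group_prod => -[i j] _ /=; case: (ltngtP i j) => [ij|ij|/val_inj ->].
- by apply: (tp (j - i).-1); rewrite prednK ?subn_gt0 // subnKC // ltnW.
- by rewrite tpermC; apply: (tp (i - j).-1); rewrite prednK ?subn_gt0 // subnKC // ltnW.
- by rewrite tperm1 group1.
Qed.

Definition has_word w (n : nat) : bool :=
  [exists c : {ffun 'I_n -> 'S_r},
     [forall i, c i \in simple_refls] && (w == \prod_(i < n) c i)].

Lemma has_word_ex w : exists n, has_word w n.
Proof.
have : w \in <<simple_refls>> by rewrite gen_simple_refls inE.
case/gen_prodgP => n [c cS ->]; exists n; apply/existsP; exists [ffun i => c i].
apply/andP; split; first by apply/forallP => i; rewrite ffunE.
by apply/eqP/eq_bigr => i _; rewrite ffunE.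
Qed.

Definition len w : nat := ex_minn (has_word_ex w).

Definition young lam : {set 'S_r} :=
  [set w : 'S_r | `[< forall i, w @: block lam i = block lam i >]].

Definition dist lam : {set 'S_r} :=
  [set d | [forall w in young lam :* d, (w != d) ==> (len d < len w)%N]].

Definition dist2 lam mu : {set 'S_r} := dist lam :&: (dist mu)^-1.

Definition dist2w lam mu : {set 'S_r} :=
  [set d in dist2 lam mu |
     `[< forall (i : nat) (k : 'I_r), k \in block lam i ->
          exists2 j, (i <= j)%N & d k \in block mu j >] ].

End SymmetricGroup.

Section Tableaux.
Variable r : nat.
Implicit Types (lam mu : composition r).
Local Open Scope nat_scope.

(* The boxes (row, column) of the Young diagram, indexed from 0. *)
Definition box lam := {p : nat * nat | p.2 < part lam p.1}.
Definition brow lam (b : box lam) : nat := (val b).1.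
Definition bcol lam (b : box lam) : nat := (val b).2.

(* Fillings of the diagram, with entries 0, ..., r-1; tableaux are the
   bijective ones. *)
Definition filling lam := box lam -> 'I_r.

Definition tact lam (t : filling lam) (w : 'S_r) : filling lam :=
  fun b => w (t b).

Lemma top_subproof lam (b : box lam) : psum lam (brow b) + bcol b < r.
Proof.
apply: leq_trans (psum_leq lam (brow b).+1).
by rewrite psumS ltn_add2l; case: b.
Qed.

(* t^lam *)
Definition ttop lam : filling lam := fun b => Ordinal (top_subproof b).

Arguments ttop lam _ : clear implicits.

Definition row_increasing lam (t : filling lam) : Prop :=
  forall b c, brow b = brow c -> bcol b < bcol c -> t b < t c.

Definition col_increasing lam (t : filling lam) : Prop :=
  forall b c, bcol b = bcol c -> brow b < brow c -> t b < t c.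

Definition standard lam (t : filling lam) : Prop :=
  [/\ is_part lam, bijective t, row_increasing t & col_increasing t].

Definition transposed lam mu (t : filling lam) (u : filling mu) : Prop :=
  forall b c, brow c = bcol b -> bcol c = brow b -> t b = u c.

(* w_lam, for a partition lam *)
Definition wperm lam : 'S_r :=
  xget 1%g [set w | transposed (tact (ttop lam) w) (ttop (conj_comp lam))]%classic.

End Tableaux.

Arguments ttop {r} lam _.

Section Modules.
Local Open Scope ring_scope.
Local Open Scope classical_set_scope.
Variable R : comNzRingType.

Record submod (V : lmodType R) := Submod {
  submod_set :> V -> Prop;
  submodP : submod_set 0 /\
    forall (a : R) u v, submod_set u -> submod_set v -> submod_set (a *: u + v)
}.

Section SubType.
Variables (V : lmodType R) (A : submod V).

Definition in_submod : {pred V} := fun v => `[< A v >].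

Lemma in_submod_closed : subsemimod_closed in_submod.
Proof.
have [A0 AL] := submodP A; split=> [|a u /asboolP Au]; last first.
  by apply/asboolP; rewrite -[a *: u]addr0; apply: AL.
split=> [|u v /asboolP Au /asboolP Av]; first exact/asboolP.
by apply/asboolP; rewrite -[u]scale1r; apply: AL.
Qed.

HB.instance Definition _ := GRing.isSubmodClosed.Build R V in_submod in_submod_closed.

Record mod_of := ModOf { mval : V; mvalP : mval \in in_submod }.
HB.instance Definition _ := [isSub for mval].
HB.instance Definition _ := [Choice of mod_of by <:].
HB.instance Definition _ := [SubChoice_isSubLmodule of mod_of by <:].

End SubType.

Definition span_set (V : lmodType R) (A : set V) : set V :=
  [set v | exists n (a : 'I_n -> R) (g : 'I_n -> V),
             (forall i, A (g i)) /\ v = \sum_(i < n) a i *: g i].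

Lemma span_closed (V : lmodType R) (A : set V) : span_set A 0 /\
  forall (a : R) u v, span_set A u -> span_set A v -> span_set A (a *: u + v).
Proof.
split=> [|a u v [m [b [g [Ag ->]]]] [n [c [h [Ah ->]]]]].
  by exists 0%N, (fun=> 0), (fun=> 0); split; [case | rewrite big_ord0].
exists (m + n)%N, (fun i => match fintype.split i with inl j => a * b j | inr j => c j end),
  (fun i => match fintype.split i with inl j => g j | inr j => h j end); split.
  by move=> i; case: (fintype.split i).
rewrite big_split_ord /= scaler_sumr; congr (_ + _); apply: eq_bigr => i _.
  by rewrite (unsplitK (inl i)) scalerA.
by rewrite (unsplitK (inr i)).
Qed.

Definition span (V : lmodType R) (A : set V) : submod V := Submod (span_closed A).

(* Hom_R(V, R) *)
Lemma dual_closed (V : lmodType R) :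
  [set f : V -> R^o | linear f] 0 /\
  forall (a : R) u v, [set f : V -> R^o | linear f] u ->
    [set f : V -> R^o | linear f] v ->
    [set f : V -> R^o | linear f] (a *: u + v).
Proof.
split=> [b x y|a u v lu lv b x y] /=; first by rewrite scaler0 addr0.
rewrite !fctE lu lv !scalerDr !scalerA mulrC -!addrA; congr (_ + _).
by rewrite addrCA.
Qed.

Definition dual (V : lmodType R) := mod_of (Submod (dual_closed V)).

Section Tensor.
Variables U V : lmodType R.

(* The tensor product: formal sums of pairs (the list [:: (u1, v1); ...]
   standing for u1 (x) v1 + ...) modulo the congruence generated by
   commutativity and bilinearity. Scalars and signs are absorbed in the first
   component. *)
Inductive tensor_rel : seq (U * V) -> seq (U * V) -> Prop :=
| tensor_refl s : tensor_rel s s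
| tensor_sym s t : tensor_rel s t -> tensor_rel t s
| tensor_trans s t t' : tensor_rel s t -> tensor_rel t t' -> tensor_rel s t'
| tensor_cat s s' t t' :
    tensor_rel s s' -> tensor_rel t t' -> tensor_rel (s ++ t) (s' ++ t')
| tensor_comm s t : tensor_rel (s ++ t) (t ++ s)
| tensor_zerol v : tensor_rel [:: (0, v)] [::]
| tensor_addl u u' v : tensor_rel [:: (u + u', v)] [:: (u, v); (u', v)]
| tensor_addr u v v' : tensor_rel [:: (u, v + v')] [:: (u, v); (u, v')]
| tensor_scale a u v : tensor_rel [:: (a *: u, v)] [:: (u, a *: v)].

Definition tensor_relb (s t : seq (U * V)) : bool := `[< tensor_rel s t >].

Lemma tensor_relb_equiv : equiv_class_of tensor_relb.
Proof.
split=> [s|s t|t s s'].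
- exact/asboolP/tensor_refl.
- by apply/asboolP/asboolP => /tensor_sym.
- by move=> /asboolP st /asboolP ts'; apply/asboolP/(tensor_trans st ts').
Qed.

Canonical tensor_equiv := EquivRelPack tensor_relb_equiv.

Definition tensor := {eq_quot tensor_relb}%qT.
HB.instance Definition _ := Choice.on tensor.
HB.instance Definition _ := EqQuotient.on tensor.

Definition tclass (s : seq (U * V)) : tensor := (\pi_tensor s)%qT.
Definition trepr (x : tensor) : seq (U * V) := repr x.

Lemma tclassK x : tclass (trepr x) = x.
Proof. exact: reprK. Qed.

Lemma tclass_eq s t : tclass s = tclass t <-> tensor_rel s t.
Proof. by split=> [/eqquotP/asboolP|h]; last exact/eqquotP/asboolP. Qed.

Lemma trepr_class s : tensor_rel (trepr (tclass s)) s.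
Proof. by apply/tclass_eq; rewrite tclassK. Qed.

Definition tmap (a : R) (s : seq (U * V)) := [seq (a *: p.1, p.2) | p <- s].

Lemma tmap_rel a s t : tensor_rel s t -> tensor_rel (tmap a s) (tmap a t).
Proof.
elim=> {s t} /=.
- by move=> s; apply: tensor_refl.
- by move=> s t _; apply: tensor_sym.
- by move=> s t t' _ h _; apply: tensor_trans.
- by move=> s s' t t' _ h _ h'; rewrite /tmap !map_cat; apply: tensor_cat.
- by move=> s t; rewrite /tmap !map_cat; apply: tensor_comm.
- by move=> v; rewrite scaler0; apply: tensor_zerol.
- by move=> u u' v; rewrite scalerDr; apply: tensor_addl.
- by move=> u v v'; apply: tensor_addr.
- by move=> b u v; rewrite scalerA mulrC -scalerA; apply: tensor_scale.
Qed.

Lemma tmapDl a b s : tensor_rel (tmap (a + b) s) (tmap a s ++ tmap b s).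
Proof.
elim: s => [|[u v] s IH] /=; first exact: tensor_refl.
apply: (@tensor_trans _ (([:: (a *: u, v)] ++ [:: (b *: u, v)]) ++
                         (tmap a s ++ tmap b s))).
  rewrite -[X in tensor_rel X]cat1s; apply: tensor_cat IH.
  by rewrite scalerDl; apply: tensor_addl.
rewrite -[X in tensor_rel _ X]/([:: (a *: u, v)] ++
  (tmap a s ++ ([:: (b *: u, v)] ++ tmap b s))) -catA.
apply: tensor_cat; first exact: tensor_refl.
rewrite !catA; apply: tensor_cat; last exact: tensor_refl.
exact: tensor_comm.
Qed.

Lemma tmap0 s : tensor_rel (tmap 0 s) [::].
Proof.
elim: s => [|[u v] s IH] /=; first exact: tensor_refl.
rewrite -cat1s -[X in tensor_rel _ X]/([::] ++ [::]); apply: tensor_cat => //.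
by rewrite scale0r; apply: tensor_zerol.
Qed.

Definition tadd (x y : tensor) : tensor := tclass (trepr x ++ trepr y).
Definition tzero : tensor := tclass [::].
Definition tscale (a : R) (x : tensor) : tensor := tclass (tmap a (trepr x)).
Definition topp (x : tensor) : tensor := tscale (-1) x.

Lemma taddE s t : tadd (tclass s) (tclass t) = tclass (s ++ t).
Proof. by apply/tclass_eq/tensor_cat; apply: trepr_class. Qed.

Lemma tscaleE a s : tscale a (tclass s) = tclass (tmap a s).
Proof. exact/tclass_eq/tmap_rel/trepr_class. Qed.

Lemma taddA : associative tadd.
Proof.
move=> x y z; rewrite -[x]tclassK -[y]tclassK -[z]tclassK !taddE.
by rewrite catA.
Qed.

Lemma taddC : commutative tadd.
Proof. by move=> x y; apply/tclass_eq/tensor_comm. Qed.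

Lemma tadd0 : left_id tzero tadd.
Proof. by move=> x; rewrite -[x]tclassK taddE. Qed.

Lemma tscale1 : left_id 1 tscale.
Proof.
move=> x; rewrite -[x]tclassK tscaleE; congr tclass.
by rewrite /tmap -[RHS]map_id; apply: eq_map => -[u v] /=; rewrite scale1r.
Qed.

Lemma taddN : left_inverse tzero topp tadd.
Proof.
move=> x; rewrite -{2}[x]tscale1 -[x]tclassK /topp !tscaleE taddE.
apply/tclass_eq; apply: tensor_trans (tensor_sym (tmapDl _ _ _)) _.
by rewrite addNr; apply: tmap0.
Qed.

HB.instance Definition _ := GRing.isZmodule.Build tensor taddA taddC tadd0 taddN.

Lemma tclassD s t : tclass s + tclass t = tclass (s ++ t).
Proof. exact: taddE. Qed.

Lemma tscaleA a b x : tscale a (tscale b x) = tscale (a * b) x.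
Proof.
rewrite -[x]tclassK !tscaleE /tmap -map_comp; congr tclass.
by apply: eq_map => -[u v] /=; rewrite scalerA.
Qed.

Lemma tscaleDr : right_distributive tscale +%R.
Proof.
move=> a x y; rewrite -[x]tclassK -[y]tclassK tclassD !tscaleE.
by rewrite tclassD /tmap map_cat.
Qed.

Lemma tscaleDl x : {morph tscale^~ x : a b / a + b}.
Proof.
move=> a b; rewrite -[x]tclassK !tscaleE tclassD.
exact/tclass_eq/tmapDl.
Qed.

HB.instance Definition _ :=
  GRing.Zmodule_isLmodule.Build R tensor tscaleA tscale1 tscaleDr tscaleDl.

Lemma tclassZ a s : a *: tclass s = tclass (tmap a s).
Proof. exact: tscaleE. Qed.

Definition pure (u : U) (v : V) : tensor := tclass [:: (u, v)].

Lemma tclassE s : tclass s = \sum_(p <- s) pure p.1 p.2.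
Proof.
elim: s => [|[u v] s IH]; first by rewrite big_nil.
by rewrite big_cons -IH tclassD.
Qed.

(* The linear map sending u (x) v to f u v; it is meaningful for bilinear f
   (tlift_pure). *)
Definition tlift (Z : lmodType R) (f : U -> V -> Z) (x : tensor) : Z :=
  \sum_(p <- trepr x) f p.1 p.2.

Definition bilinear_map (Z : lmodType R) (f : U -> V -> Z) : Prop :=
  (forall u, linear (f u)) /\ (forall v, linear (f ^~ v)).

Lemma linear_fun0 (X Y : lmodType R) (g : X -> Y) : linear g -> g 0 = 0.
Proof.
move=> lg; have := lg (-1) 0 0.
by rewrite scaleN1r oppr0 addr0 scaleN1r addNr.
Qed.

Lemma tlift_class (Z : lmodType R) (f : U -> V -> Z) s : bilinear_map f ->
  tlift f (tclass s) = \sum_(p <- s) f p.1 p.2.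
Proof.
move=> [fr fl]; rewrite /tlift; move: (trepr _) (trepr_class s) => t h.
elim: h => {t s} //=.
- by move=> s t t' _ -> _ ->.
- by move=> s s' t t' _ h _ h'; rewrite !big_cat /= h h'.
- by move=> s t; rewrite !big_cat /= addrC.
- by move=> v; rewrite big_seq1 big_nil (linear_fun0 (fl v)).
- move=> u u' v; rewrite !big_cons !big_nil !addr0 /=.
  by have := fl v 1 u u'; rewrite !scale1r.
- move=> u v v'; rewrite !big_cons !big_nil !addr0 /=.
  by have := fr u 1 v v'; rewrite !scale1r.
- move=> a u v; rewrite !big_seq1 /=.
  have := fl v a u 0; have := fr u a v 0.
  by rewrite (linear_fun0 (fl v)) (linear_fun0 (fr u)) !addr0 => -> ->.
Qed.

Lemma tlift_pure (Z : lmodType R) (f : U -> V -> Z) u v : bilinear_map f ->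
  tlift f (pure u v) = f u v.
Proof. by move=> bf; rewrite tlift_class // big_seq1. Qed.

Lemma tlift_linear (Z : lmodType R) (f : U -> V -> Z) : bilinear_map f ->
  linear (tlift f).
Proof.
move=> bf a x y; rewrite -[x]tclassK -[y]tclassK tclassZ tclassD.
rewrite !tlift_class // big_cat /= big_map scaler_sumr; congr (_ + _).
apply: eq_bigr => p _ /=.
by have := bf.2 p.2 a p.1 0; rewrite (linear_fun0 (bf.2 _)) !addr0.
Qed.

Lemma pure_bilinear : bilinear_map pure.
Proof.
split=> [u a v v'|v a u u'] /=; apply/esym.
  rewrite tclassZ tclassD; apply/tclass_eq.
  apply: tensor_trans (tensor_sym (tensor_addr _ _ _)).
  apply: (@tensor_cat [:: _] [:: _] [:: _] [:: _]); last exact: tensor_refl.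
  exact: tensor_scale.
rewrite tclassZ tclassD; apply/tclass_eq.
exact/tensor_sym/tensor_addl.
Qed.

End Tensor.

Section DirectSum.
(* The index type is finite, so that all functions have finite support. *)
Variables (I : finType) (V : I -> lmodType R).

Definition dsum := forall i, V i.
HB.instance Definition _ := Choice.on dsum.

Definition dsum_add (x y : dsum) : dsum := fun i => x i + y i.
Definition dsum_zero : dsum := fun i => 0.
Definition dsum_opp (x : dsum) : dsum := fun i => - x i.
Definition dsum_scale (a : R) (x : dsum) : dsum := fun i => a *: x i.

Lemma dsum_addA : associative dsum_add.
Proof. by move=> x y z; apply: functional_extensionality_dep => i; apply: addrA. Qed.
Lemma dsum_addC : commutative dsum_add.
Proof. by move=> x y; apply: functional_extensionality_dep => i; apply: addrC. Qed.
Lemma dsum_add0 : left_id dsum_zero dsum_add.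
Proof. by move=> x; apply: functional_extensionality_dep => i; apply: add0r. Qed.
Lemma dsum_addN : left_inverse dsum_zero dsum_opp dsum_add.
Proof. by move=> x; apply: functional_extensionality_dep => i; apply: addNr. Qed.
HB.instance Definition _ :=
  GRing.isZmodule.Build dsum dsum_addA dsum_addC dsum_add0 dsum_addN.

Lemma dsum_scaleA a b x : dsum_scale a (dsum_scale b x) = dsum_scale (a * b) x.
Proof. by apply: functional_extensionality_dep => i; apply: scalerA. Qed.
Lemma dsum_scale1 : left_id 1 dsum_scale.
Proof. by move=> x; apply: functional_extensionality_dep => i; apply: scale1r. Qed.
Lemma dsum_scaleDr : right_distributive dsum_scale +%R.
Proof. by move=> a x y; apply: functional_extensionality_dep => i; apply: scalerDr. Qed.
Lemma dsum_scaleDl x : {morph dsum_scale^~ x : a b / a + b}.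
Proof. by move=> a b; apply: functional_extensionality_dep => i; apply: scalerDl. Qed.
HB.instance Definition _ := GRing.Zmodule_isLmodule.Build R dsum
  dsum_scaleA dsum_scale1 dsum_scaleDr dsum_scaleDl.

Definition dinj (i : I) (v : V i) : dsum :=
  @dfwith I (fun j => V j) (fun j => 0) i v.

End DirectSum.

End Modules.

(* The relations determine the multiplication on the basis T_w, so a Hecke
   algebra in this sense is unique up to a unique isomorphism preserving the
   T_w. *)
Record heckeAlg (R : idomainType) (q : R) (r : nat) := HeckeAlg {
  halg :> algType R;
  hT : 'S_r -> halg;
  hT_basis : bijective (fun a : {ffun 'S_r -> R} => (\sum_w a w *: hT w)%R);
  hT1 : hT 1%g = 1%R;
  hT_up : forall w s, s \in simple_refls r -> len (w * s)%g = (len w).+1 ->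
    (hT w * hT s)%R = hT (w * s)%g;
  hT_down : forall w s, s \in simple_refls r -> len w = (len (w * s)%g).+1 ->
    (hT w * hT s = q *: hT (w * s)%g + (q - 1) *: hT w)%R
}.

Section Hecke.
Local Open Scope ring_scope.
Local Open Scope classical_set_scope.
Variables (R : idomainType) (q : R) (r : nat) (H : heckeAlg q r).
Implicit Types lam mu nu : composition r.

Local Notation T := (@hT R q r H).

Definition xelt lam : H := \sum_(w in young lam) T w.

Lemma permM_closed lam : [set m : H | exists h, m = xelt lam * h] 0 /\
  forall (a : R) u v, [set m : H | exists h, m = xelt lam * h] u ->
    [set m : H | exists h, m = xelt lam * h] v ->
    [set m : H | exists h, m = xelt lam * h] (a *: u + v).
Proof.
split=> [|a u v [h ->] [h' ->]]; first by exists 0; rewrite mulr0.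
by exists (a *: h + h'); rewrite mulrDr scalerAr.
Qed.

(* M^lam = x_lam H *)
Definition permM lam := mod_of (Submod (permM_closed lam)).

Lemma ract_subproof lam (m : permM lam) (h : H) :
  mval m * h \in in_submod (Submod (permM_closed lam)).
Proof.
case: m => m /= /asboolP[h' ->].
by apply/asboolP; exists (h' * h); rewrite mulrA.
Qed.

Definition ract lam (m : permM lam) (h : H) : permM lam :=
  ModOf (ract_subproof m h).

Lemma gen_subproof lam : xelt lam \in in_submod (Submod (permM_closed lam)).
Proof. by apply/asboolP; exists 1; rewrite mulr1. Qed.

Definition gen lam : permM lam := ModOf (gen_subproof lam).

(* eps_d is the dual basis element of x_lam T_d, for d in D_lam. *)
Definition eps lam (d : 'S_r) : dual (permM lam) :=
  xget 0 [set e | forall d', d' \in dist lam ->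
                    mval e (ract (gen lam) (T d')) = (d' == d)%:R].

(* eps_t = eps_d for t = t^lam d with d in D_lam. *)
Definition eps_tab lam (t : filling lam) : dual (permM lam) :=
  xget 0 [set e | exists d, [/\ d \in dist lam, t = tact (ttop lam) d &
                               e = eps lam d]].

Definition yelt lam : H := \sum_(w in young lam) (- q) ^- len w *: T w.

Definition zelt lam : H := xelt lam * T (wperm lam) * yelt (conj_comp lam).

Definition specht_set lam : set (permM lam) :=
  if is_part lam then [set m | exists h, mval m = zelt lam * h] else [set 0].

Arguments specht_set lam _ : clear implicits.

Lemma specht_closed lam : specht_set lam 0 /\
  forall (a : R) u v, specht_set lam u -> specht_set lam v ->
    specht_set lam (a *: u + v).
Proof.
rewrite /specht_set; case: ifP => _; last first.
  by split=> // a u v -> ->; rewrite scaler0 addr0.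
split=> [|a u v [h eu] [h' ev]]; first by exists 0; rewrite mulr0.
by exists (a *: h + h'); rewrite mulrDr -scalerAr -eu -ev.
Qed.

(* S^lam as a submodule of M^lam *)
Definition specht lam := mod_of (Submod (specht_closed lam)).

Definition equivariant mu lam (f : permM mu -> permM lam) : Prop :=
  linear f /\ forall m h, f (ract m h) = ract (f m) h.

Lemma homH_closed mu lam : @equivariant mu lam 0 /\
  forall (a : R) (f g : permM mu -> permM lam),
    equivariant f -> equivariant g -> equivariant (a *: f + g).
Proof.
split.
  split=> [b x y|m h] /=; first by rewrite scaler0 addr0.
  by apply: val_inj; rewrite /= mul0r.
move=> a f g [lf ef] [lg eg]; split=> [b x y|m h].
  rewrite !fctE lf lg !scalerDr !scalerA mulrC -!addrA; congr (_ + _).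
  by rewrite addrCA.
rewrite !fctE ef eg; apply: val_inj.
by rewrite /= mulrDl scalerAl.
Qed.

(* Hom_H(M^mu, M^lam) *)
Definition homH mu lam := mod_of (Submod (homH_closed mu lam)).

(* phi_d^(lam, mu) *)
Definition phi lam mu (d : 'S_r) : homH mu lam :=
  xget 0 [set f | mval (mval f (gen mu)) =
                  \sum_(w in (young lam :* d * young mu)%g) T w].

(* Hom^wedge_H(M^mu, M^lam) *)
Definition homW mu lam :=
  mod_of (span [set f : homH mu lam |
                 exists2 d, d \in dist2w lam mu & f = phi lam mu d]).

Lemma homH_comp_subproof nu mu lam (g : homH mu lam) (f : homH nu mu) :
  (mval g \o mval f) \in in_submod (Submod (homH_closed nu lam)).
Proof.
case: g f => g /= /asboolP[lg eg] [f /= /asboolP[lf ef]]; apply/asboolP.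
by split=> [b x y|m h] /=; [rewrite lf lg | rewrite ef eg].
Qed.

Definition homH_comp nu mu lam (g : homH mu lam) (f : homH nu mu) : homH nu lam :=
  ModOf (homH_comp_subproof g f).

(* Composition in Hom^wedge. The composite always lies in Hom^wedge, so the
   default value of insubd plays no role. *)
Definition homW_comp nu mu lam (g : homW mu lam) (f : homW nu mu) : homW nu lam :=
  insubd 0 (homH_comp (mval g) (mval f)).

Lemma dual_comp_subproof nu mu (e : dual (permM mu)) (f : homW nu mu) :
  (mval e \o mval (mval f)) \in in_submod (Submod (dual_closed (permM nu))).
Proof.
case: e f => e /= /asboolP le [[f /= /asboolP[lf _]] _]; apply/asboolP.
by move=> b x y /=; rewrite lf le.
Qed.

Definition dual_comp nu mu (e : dual (permM mu)) (f : homW nu mu) :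
  dual (permM nu) := ModOf (dual_comp_subproof e f).

Lemma dual_restr_subproof lam (e : dual (permM lam)) :
  (fun m : specht lam => mval e (mval m))
    \in in_submod (Submod (dual_closed (specht lam))).
Proof. by case: e => e /= /asboolP le; apply/asboolP => b x y /=; rewrite le. Qed.

Definition dual_restr lam (e : dual (permM lam)) : dual (specht lam) :=
  ModOf (dual_restr_subproof e).

(* M_gamma for the chain gamma = (lam, s_1, ..., s_n); tensor products are
   associated to the right. *)
Fixpoint Mchain lam (s : seq (composition r)) {struct s} : lmodType R :=
  match s with
  | [::] => dual (permM lam)
  | mu :: s' => tensor (homW lam mu) (Mchain mu s')
  end.

(* The map M_gamma -> M_(gamma_(i+1)) (for i < n), which removes s_(i+1) and
   composes the two tensor factors involved. *)
Fixpoint face lam (s : seq (composition r)) (i : nat) {struct s} :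
    Mchain lam s -> Mchain lam (del i s) :=
  match s return Mchain lam s -> Mchain lam (del i s) with
  | [::] => fun x => x
  | mu :: s' =>
      match i return Mchain lam (mu :: s') -> Mchain lam (del i (mu :: s')) with
      | 0%N =>
          match s' return Mchain lam (mu :: s') -> Mchain lam s' with
          | [::] => tlift (fun (f : homW lam mu) (e : dual (permM mu)) =>
                             dual_comp e f : Mchain lam [::])
          | nu :: s'' =>
              tlift (fun (f : homW lam mu) (x : Mchain mu (nu :: s'')) =>
                tlift (fun (g : homW mu nu) (z : Mchain nu s'') =>
                  pure (homW_comp g f) z : Mchain lam (nu :: s'')) x)
          end
      | i'.+1 => tlift (fun (f : homW lam mu) (x : Mchain mu s') =>
                          pure f (face i' x) : Mchain lam (mu :: del i' s'))
      end
  end.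

Definition Cmod lam n := dsum (fun g : chain lam n => Mchain lam g).

Definition Cdiff lam n (x : Cmod lam n.+1) : Cmod lam n :=
  \sum_(g : chain lam n.+1) \sum_(i < n.+1)
    (-1) ^+ i *: dinj (V := fun h : chain lam n => Mchain lam h)
                   (i := chain_del g i) (face i (x g)).

(* The map C_0 -> C_(-1); C_0 has the single summand Hom_R(M^lam, R). *)
Definition Caug lam (x : Cmod lam 0) : dual (specht lam) :=
  dual_restr (x (chain0 lam) : dual (permM lam)).

(* The augmented complex: Ct lam k is the module in degree k - 2, so that
   Ct lam 0 = 0 (degree -2) and Ct lam 1 = Hom_R(S^lam, R) (degree -1), and
   dt lam k is the differential d_(k-1) from degree k - 1 to degree k - 2. *)
Definition Ct lam (k : nat) : lmodType R :=
  match k with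
  | 0 => 'rV[R]_0
  | 1 => dual (specht lam)
  | n.+2 => Cmod lam n
  end.

Definition dt lam (k : nat) : Ct lam k.+1 -> Ct lam k :=
  match k return Ct lam k.+1 -> Ct lam k with
  | 0 => fun=> 0
  | 1 => @Caug lam
  | n.+2 => @Cdiff lam n
  end.

(* The generators phi_(e_1) (x) ... (x) phi_(e_n) (x) eps_t in M_gamma. *)
Fixpoint Kgen lam (s : seq (composition r)) {struct s} : set (Mchain lam s) :=
  match s return set (Mchain lam s) with
  | [::] => [set x | exists2 t : filling lam, standard t & x = eps_tab t]
  | mu :: s' =>
      [set x | exists d (f : homW lam mu) z,
         [/\ d \in dist2w mu lam, mval f = phi mu lam d, @Kgen mu s' z &
             x = pure f z]]
  end.

Definition Kmod lam n : set (Cmod lam n) :=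
  span_set [set x | exists (g : chain lam n) z, @Kgen lam g z /\
                      x = dinj (V := fun h : chain lam n => Mchain lam h) z].

(* The submodule K_(k-1) of C_(k-1) = Ct lam k.+1. *)
Definition Kt lam (k : nat) : set (Ct lam k.+1) :=
  match k return set (Ct lam k.+1) with
  | 0 => [set 0]
  | n.+1 => @Kmod lam n
  end.

End Hecke.

Arguments Ct {R q r} H lam k.
Arguments dt {R q r} H lam k _.
Arguments Kt {R q r} H lam k _.

(* Main.v *)
Require Import Defs.
From mathcomp Require Import all_boot all_order all_algebra all_fingroup.
From mathcomp Require Import boolp classical_sets functions zify.

Import GRing.Theory.
Set Implicit Arguments.
Unset Strict Implicit.
Unset Printing Implicit Defensive.

(** The complex is controlled by the first step of a chain. For n > 0 the module
    C_n^lam is the direct sum, over all mu strictly above lam, of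
    Hom^wedge(M^lam, M^mu) (x) C_(n-1)^mu, and K_n^lam is the sum of the
    submodules Hom^wedge(M^lam, M^mu) (x) K_(n-1)^mu. The differential sends
    phi (x) y to the composite of y with phi, whose first steps lie strictly
    above mu, minus phi (x) d y. So the two claims in degree n for lam follow
    from those in degree n - 1 for the mu above lam, by an induction along
    dominance on the first step: downwards for the sum ([Cdiff_span]), upwards
    for the kernel ([ker_CdiffS]). Compositions above a tame one are tame, and
    what is left are the degrees -1 and 0 and the injectivity of d_1 on K_1.

    These are statements on permutation modules. An element of M^lam is a
    function on the words of content lam, a word recording the row of each entry
    of a tableau, and T_s exchanges neighbouring letters up to powers of q and a
    correction term when the letters decrease.

    - [straightening]: C_0 = im d_1 + K_0. A word that is not the word of a
      standard tableau has an initial segment with fewer letters i than letters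
      i+1. Lowering some of these letters i+1 to i is a homomorphism in Hom^wedge
      ([lowering_ex]); an alternating sum over the sets of lowered letters writes
      the dual basis element of the word, modulo im d_1, through words that are
      lexicographically larger from the right.
    - [std_span_specht_inj] and [specht_dual_surj]: the standard dual basis
      elements restrict to a basis of the dual of S^lam, because suitable
      elements of S^lam = z_lam H are unitriangular with respect to them for the
      Bruhat order on words ([specht_elt]).
    - [via_larger_specht]: d_0 d_1 = 0. Elements of Hom^wedge only lower letters,
      and y_(lam') kills words with two equal letters in a column; a word
      without such letters that is letterwise below the column reading of t^lam
      is that reading itself, so nothing can survive in M^mu for mu above lam.
    - [standard_phi_inj]: d_1 is injective on K_1 when lam is tame. Tameness
      forces the tableaux of partition shape mu indexing Hom^wedge(M^lam, M^mu)
      to have entry i wherever row i is continued below ([tame_wedge]). Reading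
      such a tableau along columns gives a word f_d for which
      phi_e (f_d) y_(mu') is a multiple of z_mu, with coefficients triangular in
      d and e, and is zero for targets not dominated by mu. This reduces the
      claim to the independence of the standard functionals on S^mu. *)

(** * Rows and columns of compositions *)

Section RowsColumns.
Variable r : nat.
Implicit Types (lam mu nu : composition r) (p : 'I_r).
Local Open Scope nat_scope.

Lemma row_ex lam p : exists i, p < psum lam i.+1.
Proof. by exists (size lam); rewrite psum_size. Qed.

(** With [colof] this gives the box of an entry of [t^lam]; it replaces
    the sets [block lam i] by a function. *)
Definition rowof lam p : nat := ex_minn (row_ex lam p).
Definition colof lam p : nat := p - psum lam (rowof lam p).

Lemma rowof_lt lam p e : (rowof lam p < e) = (p < psum lam e).
Proof.
rewrite /rowof; case: ex_minnP => i lt min.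
apply/idP/idP => [ie|]; first exact: leq_trans lt (psum_mono lam ie).
case: e => [|e]; first by rewrite /psum big_ord0.
exact: min.
Qed.

Lemma rowof_le lam p e : (e <= rowof lam p) = (psum lam e <= p).
Proof. by rewrite leqNgt rowof_lt -leqNgt. Qed.

Lemma rowof_bounds lam p :
  psum lam (rowof lam p) <= p < psum lam (rowof lam p).+1.
Proof. by rewrite -rowof_le -rowof_lt !leqnn. Qed.

Lemma rowof_eq lam p i :
  (rowof lam p == i) = (psum lam i <= p < psum lam i.+1).
Proof. by rewrite -rowof_le -rowof_lt ltnS eqn_leq andbC. Qed.

Lemma block_row lam p i : (p \in block lam i) = (rowof lam p == i).
Proof. by rewrite inE rowof_eq. Qed.

Lemma rowof_mono lam p p' : p <= p' -> rowof lam p <= rowof lam p'.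
Proof.
by move=> le; rewrite rowof_le (leq_trans _ le) //; case/andP: (rowof_bounds lam p).
Qed.

Lemma rowcol lam p : psum lam (rowof lam p) + colof lam p = p.
Proof. by rewrite subnKC //; case/andP: (rowof_bounds lam p). Qed.

Lemma colof_lt lam p : colof lam p < part lam (rowof lam p).
Proof.
have /andP[_] := rowof_bounds lam p.
by rewrite psumS -{1}(rowcol lam p) ltn_add2l.
Qed.

Lemma rowcol_inj lam p p' :
  rowof lam p = rowof lam p' -> colof lam p = colof lam p' -> p = p'.
Proof. by move=> er ec; apply: val_inj; rewrite /= -(rowcol lam p) er ec rowcol. Qed.

Lemma box_lt lam i j : j < part lam i -> psum lam i + j < r.
Proof. by move=> lt; apply: leq_trans (psum_leq lam i.+1); rewrite psumS ltn_add2l. Qed.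

Lemma box_row lam i j (lt : j < part lam i) : rowof lam (Ordinal (box_lt lt)) = i.
Proof. by apply/eqP; rewrite rowof_eq /= leq_addr psumS ltn_add2l. Qed.

Lemma box_col lam i j (lt : j < part lam i) : colof lam (Ordinal (box_lt lt)) = j.
Proof. by rewrite /colof box_row /= addKn. Qed.

Lemma col_ltn lam p p' : rowof lam p = rowof lam p' ->
  (colof lam p < colof lam p') = (p < p').
Proof. by move=> e; rewrite -[in RHS](rowcol lam p) -[in RHS](rowcol lam p') e ltn_add2l. Qed.

Lemma card_ltn n : n <= r -> #|[set p : 'I_r | p < n]| = n.
Proof.
move=> le; have inj : injective (widen_ord le) by move=> x y /(congr1 val) /= /val_inj.
rewrite -[RHS]card_ord -cardsT -(card_imset [set: 'I_n]%SET inj).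
congr #|pred_of_set _|; apply/setP => p; rewrite inE.
apply/idP/imsetP => [lt|[x _ ->] //=].
by exists (Ordinal lt); rewrite ?inE //; apply: val_inj.
Qed.

Lemma card_rowof_lt lam e : #|[set p | rowof lam p < e]| = psum lam e.
Proof. by under eq_finset do rewrite rowof_lt; rewrite card_ltn // psum_leq. Qed.

Lemma card_ltS (G : 'I_r -> nat) e :
  #|[set p | G p < e.+1]| = #|[set p | G p < e]| + #|[set p | G p == e]|.
Proof.
rewrite -cardsUI; have -> : [set p | G p < e]%SET :&: [set p | G p == e]%SET = finset.set0.
  by apply/setP => p; rewrite !inE; case: ltngtP.
rewrite cards0 addn0; congr #|pred_of_set _|; apply/setP => p.
by rewrite !inE ltnS leq_eqVlt orbC.
Qed.

Lemma card_rowof lam i : #|[set p | rowof lam p == i]| = part lam i.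
Proof.
apply/eqP; rewrite -(eqn_add2l (psum lam i)) -psumS -!card_rowof_lt; apply/eqP.
exact/esym/card_ltS.
Qed.

Lemma content_ex (G : 'I_r -> nat) : 0 < r ->
  exists nu : composition r, forall e, part nu e = #|[set p | G p == e]|.
Proof.
move=> r0; pose N := \max_p G p.
pose s := mkseq (fun e => #|[set p | G p == e]|) N.+1.
have leN p : G p <= N by apply: leq_bigmax.
have [p0 p0N] : exists p, G p = N.
  have [|p pN] := @eq_bigmax _ G; first by rewrite card_ord.
  by exists p.
have sE e : nth 0 s e = #|[set p | G p == e]|.
  have [lt|le] := ltnP e N.+1; first by rewrite nth_mkseq.
  rewrite nth_default ?size_mkseq //; apply/esym/eqP; rewrite cards_eq0.
  apply/eqP/setP => p; rewrite !inE; apply/negbTE.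
  by apply: contraTneq le => <-; rewrite -leqNgt; exact: leN.
have sP : (sumn s == r) && (last 1 s != 0).
  apply/andP; split; last first.
    rewrite /s /mkseq -[N.+1]addn1 iotaD map_cat last_cat /= add0n cards_eq0.
    by apply/set0Pn; exists p0; rewrite inE p0N.
  rewrite sumnE big_map -{1}[N.+1]subn0 -[iota 0 _]/(index_iota 0 N.+1) big_mkord.
  rewrite -[X in _ == X]card_ord -sum1_card.
  rewrite (partition_big (fun p => inord (G p) : 'I_N.+1) predT) //=.
  apply/eqP/eq_bigr => i _; rewrite -sum1_card; apply: eq_bigl => p.
  by rewrite inE -val_eqE /= inordK // ltnS.
by exists (Composition sP).
Qed.

Lemma psum_content (G : 'I_r -> nat) nu :
  (forall e, part nu e = #|[set p | G p == e]|) ->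
  forall e, psum nu e = #|[set p | G p < e]|.
Proof.
move=> h; elim=> [|e IH].
  rewrite /psum big_ord0; apply/esym/eqP; rewrite cards_eq0.
  by apply/eqP/setP => p; rewrite !inE.
by rewrite psumS IH h card_ltS.
Qed.

Lemma rowof_size lam p : rowof lam p < size lam.
Proof. by rewrite rowof_lt psum_size. Qed.

End RowsColumns.

(** * Length and inversions *)

Section Length.
Variable r : nat.
Implicit Types (w u v : 'S_r) (a b p k : 'I_r).
Local Open Scope nat_scope.
Local Open Scope group_scope.

Definition invset w : {set 'I_r * 'I_r} :=
  [set x : 'I_r * 'I_r | (x.1 < x.2)%N && (w x.2 < w x.1)%N].

Lemma adj_neq a b : b = a.+1 :> nat -> a != b.
Proof. by move=> e; rewrite -val_eqE /= e neq_ltn ltnSn. Qed.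

(** Exchanging two neighbouring values preserves the order of all other pairs,
    so right multiplication by a simple reflection changes one inversion. *)
Lemma tperm_ltn a b x y : b = a.+1 :> nat ->
  (x, y) != (a, b) -> (x, y) != (b, a) ->
  (tperm a b x < tperm a b y)%N = (x < y)%N.
Proof.
move=> e; rewrite !xpair_eqE; have nab := adj_neq e.
have ltab : (a < b)%N by rewrite e.
have ba : (b < a)%N = false by rewrite ltnNge ltnW.
case: tpermP => [->|->|/eqP/negPf xa /eqP/negPf xb];
case: tpermP => [->|->|/eqP/negPf ya /eqP/negPf yb]; rewrite ?eqxx ?ltnn //= => _ _.
- rewrite ltn_neqAle (_ : (b == y :> nat) = false) /=; last by rewrite eq_sym val_eqE.
  by rewrite e.
- rewrite [RHS]ltn_neqAle (_ : (b == y :> nat) = false) /=; last by rewrite eq_sym val_eqE.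
  by rewrite e.
- rewrite [RHS]ltn_neqAle (_ : (x == a :> nat) = false) /=; last by rewrite val_eqE.
  by rewrite e ltnS.
- rewrite [LHS]ltn_neqAle (_ : (x == a :> nat) = false) /=; last by rewrite val_eqE.
  by rewrite e ltnS.
Qed.

Lemma invset_up w a b : b = a.+1 :> nat -> (w^-1 a < w^-1 b)%N ->
  invset (w * tperm a b) = (w^-1 a, w^-1 b) |: invset w.
Proof.
move=> e lt; apply/setP => -[x y]; rewrite !inE /= !permM xpair_eqE.
have ltab : (a < b)%N by rewrite e.
case: (eqVneq (w x, w y) (a, b)) => [[wx wy]|n1].
  by rewrite -wx -wy !permK !eqxx /= -[X in X && _]/(_ < _)%N wx wy tpermL tpermR ltab
             -[x](permK w) -[y](permK w) wx wy lt.
case: (eqVneq (w x, w y) (b, a)) => [[wx wy]|n2].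
  rewrite wx wy tpermL tpermR ltab (ltnNge b a) (ltnW ltab) /= andbF andbT.
  have -> : x = w^-1 b by rewrite -wx permK.
  have -> : y = w^-1 a by rewrite -wy permK.
  by rewrite ltnNge (ltnW lt) /= (inj_eq perm_inj) eq_sym (negPf (adj_neq e)).
have sw c d : ((w y, w x) == (c, d)) = ((w x, w y) == (d, c)).
  by rewrite !xpair_eqE andbC.
rewrite tperm_ltn // ?sw //; case: (eqVneq x (w^-1 a)) => [ex|] //=.
case: (eqVneq y (w^-1 b)) => [ey|] //=.
by move: n1; rewrite ex ey !permKV eqxx.
Qed.

Definition ninv w := #|invset w|.

Lemma ninv_up w a b : b = a.+1 :> nat -> (w^-1 a < w^-1 b)%N ->
  ninv (w * tperm a b) = (ninv w).+1.
Proof.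
move=> e lt; rewrite /ninv (invset_up e lt) cardsU1 inE /= !permKV e.
by rewrite [X in _ && X](_ : _ = false) ?andbF //; apply/negbTE; rewrite -leqNgt.
Qed.

Lemma mulK_tperm w a b : w * tperm a b * tperm a b = w.
Proof. by rewrite -mulgA tperm2 mulg1. Qed.

Lemma invM_tpermL w a b : (w * tperm a b)^-1 a = w^-1 b.
Proof. by rewrite invMg tpermV permM tpermL. Qed.

Lemma invM_tpermR w a b : (w * tperm a b)^-1 b = w^-1 a.
Proof. by rewrite invMg tpermV permM tpermR. Qed.

Lemma ninv_down w a b : b = a.+1 :> nat -> (w^-1 b < w^-1 a)%N ->
  ninv w = (ninv (w * tperm a b)).+1.
Proof.
move=> e lt; rewrite -{1}(mulK_tperm w a b) ninv_up //.
by rewrite invM_tpermL invM_tpermR.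
Qed.

Lemma perm_incr1 w : (forall p k, (p < k)%N -> (w p < w k)%N) -> w = 1.
Proof.
move=> h; have le p : (p <= w p)%N.
  case: p => n; elim: n => [|n IH] lt //=.
  have lt' : (n < r)%N by apply: ltnW.
  apply: leq_ltn_trans (IH lt') _; exact: h.
have sumE : (\sum_p (w p - p) = 0)%N.
  apply/eqP; rewrite -(eqn_add2r (\sum_(p : 'I_r) p)) -big_split /= add0n.
  rewrite [X in _ == X](reindex_inj (@perm_inj _ w)) /=.
  by apply/eqP/eq_bigr => p _; rewrite subnK.
apply/permP => p; rewrite perm1; apply: val_inj => /=.
apply/eqP; rewrite eqn_leq le andbT -subn_eq0.
by move/eqP: sumE; rewrite sum_nat_eq0 => /forallP/(_ p).
Qed.

Lemma mono_adj (f : 'I_r -> nat) :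
  (forall a b, b = a.+1 :> nat -> (f a <= f b)%N) ->
  forall p k, (p <= k)%N -> (f p <= f k)%N.
Proof.
move=> h p k; move En : (k - p)%N => n; elim: n k En => [|n IH] k En le.
  have -> : p = k by apply/val_inj/eqP; rewrite /= eqn_leq le -subn_eq0 En.
  by [].
have k0 : (0 < k)%N by apply: leq_ltn_trans (leq0n p) _; rewrite -subn_gt0 En.
have lt : (k.-1 < r)%N by rewrite prednK // ltnW.
apply: leq_trans (IH (Ordinal lt) _ _) (h _ _ _) => /=; last by rewrite prednK.
  by rewrite -subn1 subnAC En subn1.
by rewrite -ltnS prednK // ltn_neqAle le andbT; apply: contra_eq_neq En => ->; rewrite subnn.
Qed.

Lemma descent_ex w : w != 1 ->
  exists a b, b = a.+1 :> nat /\ (w^-1 b < w^-1 a)%N.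
Proof.
move=> n1; case: (pselect (exists a b, b = a.+1 :> nat /\ (w^-1 b < w^-1 a)%N)) => // h.
case/eqP: n1; apply: invg_inj; rewrite invg1; apply: perm_incr1 => p k pk.
rewrite ltn_neqAle val_eqE (inj_eq perm_inj) -val_eqE (ltn_eqF pk) /=.
apply: (mono_adj (f := fun x => w^-1 x)) (ltnW pk) => a b e; rewrite leqNgt.
by apply/negP => lt; apply: h; exists a, b.
Qed.

Lemma ninv1 : ninv 1 = 0.
Proof.
apply/eqP; rewrite cards_eq0; apply/eqP/setP => -[x y]; rewrite !inE /= !perm1.
by rewrite ltnNge; case: ltngtP.
Qed.

Lemma ninv_adj w a b : b = a.+1 :> nat -> (ninv (w * tperm a b) <= (ninv w).+1)%N.
Proof.
move=> e; case: (ltngtP (w^-1 a) (w^-1 b)) => [lt|lt|/val_inj/perm_inj eq].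
- by rewrite ninv_up.
- by rewrite (ninv_down e lt) (leq_trans (leqnSn _)) // leqnSn.
- by move: (adj_neq e); rewrite eq eqxx.
Qed.

Lemma simple_ex (s : 'S_r) : s \in simple_refls r ->
  exists a b, b = a.+1 :> nat /\ s = tperm a b.
Proof. by rewrite inE => /existsP[a /existsP[b /andP[/eqP e /eqP ->]]]; exists a, b. Qed.

Lemma ninv_word n (c : 'I_n -> 'S_r) : (forall i, c i \in simple_refls r) ->
  (ninv (\prod_(i < n) c i) <= n)%N.
Proof.
elim: n c => [|n IH] c h; first by rewrite big_ord0 ninv1.
rewrite big_ord_recr /=; case: (simple_ex (h ord_max)) => a [b [e ->]].
by apply: leq_trans (ninv_adj _ e) _; rewrite ltnS IH.
Qed.

Lemma has_word_ninv w : has_word w (ninv w).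
Proof.
move En : (ninv w) => n; elim: n w En => [|n IH] w En.
  apply/existsP; exists [ffun=> 1]; apply/andP; split; first by apply/forallP; case.
  rewrite big_ord0; case: (eqVneq w 1) => // /descent_ex[a [b [e lt]]].
  by move: En; rewrite (ninv_down e lt).
have n1 : w != 1 by apply: contra_eq_neq En => ->; rewrite ninv1.
have [a [b [e lt]]] := descent_ex n1.
have := En; rewrite (ninv_down e lt) => -[/IH/existsP[c /andP[/forallP cS /eqP cE]]].
apply/existsP; exists [ffun i => if unlift ord_max i is Some j then c j else tperm a b].
apply/andP; split.
  apply/forallP => i; rewrite ffunE; case: unliftP => [j _|_] //.
  exact: simple_reflsP.
rewrite big_ord_recr /= ffunE unlift_none -{1}(mulK_tperm w a b) cE.
apply/eqP; congr (_ * _); apply: eq_bigr => i _; rewrite ffunE.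
by rewrite (_ : widen_ord _ i = lift ord_max i) ?liftK //; apply/val_inj; rewrite /= /bump leqNgt ltn_ord.
Qed.

Lemma len_ninv w : len w = ninv w.
Proof.
rewrite /len; case: ex_minnP => n /existsP[c /andP[/forallP cS /eqP ->]] min.
apply/eqP; rewrite eqn_leq ninv_word // andbT.
by rewrite min // has_word_ninv.
Qed.

Lemma len_up w a b : b = a.+1 :> nat -> (w^-1 a < w^-1 b)%N ->
  len (w * tperm a b) = (len w).+1.
Proof. by rewrite !len_ninv; apply: ninv_up. Qed.

Lemma len_down w a b : b = a.+1 :> nat -> (w^-1 b < w^-1 a)%N ->
  len w = (len (w * tperm a b)).+1.
Proof. by rewrite !len_ninv; apply: ninv_down. Qed.

Lemma len1 : len (1 : 'S_r) = 0%N.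
Proof. by rewrite len_ninv ninv1. Qed.

Lemma len_eq0 w : len w = 0%N -> w = 1.
Proof.
move=> l0; case: (eqVneq w 1) => // /descent_ex[a [b [e lt]]].
by move: l0; rewrite (len_down e lt).
Qed.

Lemma lenV w : len w^-1 = len w.
Proof.
rewrite !len_ninv /ninv.
rewrite -(card_imset (invset w) (f := fun x => (w x.2, w x.1))); last first.
  by move=> [x y] [x' y'] [/perm_inj -> /perm_inj ->].
congr #|pred_of_set _|; apply/setP => -[x y]; rewrite inE /=.
apply/idP/imsetP => [/andP[lt lt']|[[x' y'] + [-> ->]]].
  by exists (w^-1 y, w^-1 x); rewrite ?inE /= ?permKV // lt lt'.
by rewrite inE /= !permK andbC.
Qed.

Lemma len_left_up w a b : b = a.+1 :> nat -> (w a < w b)%N ->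
  len (tperm a b * w) = (len w).+1.
Proof.
move=> e lt; rewrite -lenV invMg tpermV len_up ?invgK // lenV //.
Qed.

Lemma len_left_down w a b : b = a.+1 :> nat -> (w b < w a)%N ->
  len w = (len (tperm a b * w)).+1.
Proof.
move=> e lt; rewrite -lenV (len_down e) ?invgK //; congr _.+1.
by rewrite -lenV invMg tpermV invgK.
Qed.

(** Induction along reduced words. *)
Lemma len_ind (P : 'S_r -> Prop) : P 1 ->
  (forall w a b, b = a.+1 :> nat -> (w^-1 a < w^-1 b)%N -> P w ->
     P (w * tperm a b)) ->
  forall w, P w.
Proof.
move=> P1 PS w; move En : (len w) => n; elim: n w En => [|n IH] w En.
  by rewrite (len_eq0 En).
have n1 : w != 1 by apply: contra_eq_neq En => ->; rewrite len1.
have [a [b [e lt]]] := descent_ex n1.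
rewrite -(mulK_tperm w a b); apply: PS => //; first by rewrite invM_tpermL invM_tpermR.
by apply: IH; have := En; rewrite (len_down e lt) => -[].
Qed.

End Length.

(** * Words and coset representatives *)

Section Words.
Variable r : nat.
Implicit Types (lam mu nu : composition r) (w u v d : 'S_r) (a b p k : 'I_r).
Local Open Scope nat_scope.
Local Open Scope group_scope.

(** The letter of [k] is the row of [k] in the tableau [t^lam w], so words are
    cosets of [young lam]. *)
Definition word lam w k : nat := rowof lam (w^-1 k).

Lemma word1 lam k : word lam 1 k = rowof lam k.
Proof. by rewrite /word invg1 perm1. Qed.

Lemma wordM lam w v k : word lam (w * v) k = word lam w (v^-1 k).
Proof. by rewrite /word invMg permM. Qed.

Lemma word_tperm lam w a b k :
  word lam (w * tperm a b) k = word lam w (tperm a b k).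
Proof. by rewrite wordM tpermV. Qed.

Lemma youngP lam u :
  reflect (forall p, rowof lam (u p) = rowof lam p) (u \in young lam).
Proof.
rewrite inE; apply: (iffP (asboolP _)) => [h p|h i].
  apply/eqP; rewrite -block_row -(h (rowof lam p)); apply: imset_f.
  by rewrite block_row.
apply/eqP; rewrite eqEcard card_imset ?leqnn ?andbT; last exact: perm_inj.
by apply/fintype.subsetP => _ /imsetP[p + ->]; rewrite !block_row h.
Qed.

Lemma young1 lam : 1 \in young lam.
Proof. by apply/youngP => p; rewrite perm1. Qed.

Lemma youngM lam u v : u \in young lam -> v \in young lam -> u * v \in young lam.
Proof. by move=> /youngP hu /youngP hv; apply/youngP => p; rewrite permM hv hu. Qed.

Lemma youngV lam u : u \in young lam -> u^-1 \in young lam.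
Proof. by move=> /youngP hu; apply/youngP => p; rewrite -hu permKV. Qed.

Lemma young_tperm lam a b : rowof lam a = rowof lam b -> tperm a b \in young lam.
Proof. by move=> e; apply/youngP => p; case: tpermP => // ->. Qed.

Lemma word_young lam u w : u \in young lam -> word lam (u * w) =1 word lam w.
Proof. by move=> /youngV/youngP hu k; rewrite /word invMg permM hu. Qed.

Lemma word_eqP lam w w' :
  word lam w =1 word lam w' <-> w' * w^-1 \in young lam.
Proof.
split=> [h|hu k].
  apply/youngP => p; rewrite permM -[p in RHS](permK w').
  by rewrite -[LHS]/(word lam w (w' p)) h.
by rewrite -[in RHS](mulgKV w w') word_young.
Qed.

Lemma mem_rcoset_word lam w d :
  (w \in young lam :* d) <-> (word lam w =1 word lam d).
Proof.
split=> [/rcosetP[u hu ->]|h]; first exact: word_young.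
apply/rcosetP; exists (w * d^-1); last by rewrite mulgKV.
by apply/word_eqP => k; rewrite h.
Qed.

(** The permutations [d] for which [t^lam d] is row-standard; they turn out to be
    the distinguished coset representatives ([dist_incr]). *)
Definition incr lam d : Prop :=
  forall p k, rowof lam p = rowof lam k -> p < k -> d p < d k.

Lemma word_asc lam d a b : word lam d a < word lam d b -> d^-1 a < d^-1 b.
Proof. by move=> lt; rewrite ltnNge; apply/negP => /(rowof_mono lam); rewrite leqNgt lt. Qed.

Lemma incr_tperm lam d a b : b = a.+1 :> nat -> incr lam d ->
  word lam d a != word lam d b -> incr lam (d * tperm a b).
Proof.
move=> e hd ne p k er lt; rewrite !permM tperm_ltn ?hd //.
  apply: contra_neqN ne => /eqP[<- <-].
  by rewrite /word !permK.
apply: contra_neqN ne => /eqP[<- <-].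
by rewrite /word !permK.
Qed.

Lemma incr_desc lam d : incr lam d -> d != 1 ->
  exists a b, b = a.+1 :> nat /\ word lam d b < word lam d a.
Proof.
move=> hd /descent_ex[a [b [e lt]]]; exists a, b; split=> //.
rewrite ltn_neqAle rowof_mono ?(ltnW lt) // andbT.
apply/eqP => er; have := hd _ _ er lt; rewrite !permKV e.
by rewrite ltnNge leqnSn.
Qed.

(** Induction along the weak order on the row-standard tableaux: each one is
    reached from [t^lam] by swapping neighbouring letters in increasing order. *)
Lemma incr_ind lam (P : 'S_r -> Prop) : P 1 ->
  (forall d a b, b = a.+1 :> nat -> incr lam d -> word lam d a < word lam d b ->
     P d -> P (d * tperm a b)) ->
  forall d, incr lam d -> P d.
Proof.
move=> P1 PS d; move En : (len d) => n; elim: n d En => [|n IH] d En hd.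
  by rewrite (len_eq0 En).
have n1 : d != 1 by apply: contra_eq_neq En => ->; rewrite len1.
have [a [b [e lt]]] := incr_desc hd n1.
have hd' : incr lam (d * tperm a b) by apply: incr_tperm => //; rewrite neq_ltn lt orbT.
rewrite -(mulK_tperm d a b); apply: PS => //.
  by rewrite !word_tperm tpermL tpermR.
apply: IH => //; have := En; rewrite (@len_down _ d a b) //; last exact: word_asc lt.
by case.
Qed.

(** Along the weak order each swap lengthens [d] and [u * d] simultaneously,
    since it depends only on the letters. *)
Lemma len_young_incr lam u d : u \in young lam -> incr lam d ->
  len (u * d) = (len u + len d)%N.
Proof.
move=> hu hd; move: d hd; apply: incr_ind => [|d a b e hd lt IH].
  by rewrite mulg1 len1 addn0.
have lt' : word lam (u * d) a < word lam (u * d) b by rewrite !(word_young _ hu).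
rewrite mulgA (len_up e (word_asc lt')).
by rewrite IH (len_up e) ?addnS //; apply: word_asc lt.
Qed.

Lemma incr_adj lam d :
  (forall a b, b = a.+1 :> nat -> rowof lam a = rowof lam b -> d a < d b) ->
  incr lam d.
Proof.
move=> adj p k er lt; move En : (k - p)%N => n; elim: n k En er lt => [|n IH] k En er lt.
  by move: lt; rewrite -subn_gt0 En.
have k0 : 0 < k by apply: leq_ltn_trans lt.
have ltk : k.-1 < r by rewrite prednK // ltnW.
pose k' := Ordinal ltk; have ek : k = k'.+1 :> nat by rewrite /= prednK.
have le : (p <= k')%N by rewrite -ltnS -ek.
have er' : rowof lam p = rowof lam k'.
  apply/eqP; rewrite eqn_leq rowof_mono //= er rowof_mono //.
  by rewrite [X in (_ <= X)%N]ek leqnSn.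
have step : d k' < d k by apply: adj => //; rewrite -er'.
case: (eqVneq p k') => [->//|ne].
apply: ltn_trans step; apply: IH => //.
  by move: En; rewrite ek subSn // => -[].
by rewrite ltn_neqAle le andbT; move: ne; rewrite -val_eqE.
Qed.

Lemma incr_min lam d :
  (forall u, u \in young lam -> len d <= len (u * d)) -> incr lam d.
Proof.
move=> h; apply: incr_adj => a b e er.
rewrite ltnNge leq_eqVlt negb_or val_eqE (inj_eq perm_inj) eq_sym adj_neq //=.
apply/negP => lt; have := h _ (young_tperm er).
by rewrite (len_left_down e lt) ltnn.
Qed.

Lemma dist_incr lam d : d \in dist lam <-> incr lam d.
Proof.
split=> [|hd]; last first.
  rewrite inE; apply/forall_inP => _ /rcosetP[u hu ->]; apply/implyP => ne.
  rewrite (len_young_incr hu hd) -[X in (X < _)%N]add0n ltn_add2r lt0n.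
  by apply: contra_neq ne => /len_eq0 ->; rewrite mul1g.
rewrite inE => /forall_inP h; apply: incr_min => u hu.
have := h (u * d); rewrite mem_rcoset mulgK => /(_ hu)/implyP.
by case: eqVneq => [-> //|_ /(_ isT)/ltnW].
Qed.

Lemma incr_ex lam w : exists2 d, incr lam d & word lam d =1 word lam w.
Proof.
have [u hu min] := @arg_minnP _ 1 (mem (young lam)) (fun u => len (u * w)) (young1 lam).
exists (u * w); last exact: word_young.
by apply: incr_min => v hv; rewrite mulgA min //; apply: youngM.
Qed.

Lemma incr_uniq lam d d' : incr lam d -> incr lam d' ->
  word lam d =1 word lam d' -> d = d'.
Proof.
move=> hd hd' /word_eqP hu; have := len_young_incr hu hd.
have := len_young_incr (youngV hu) hd'; rewrite mulgKV lenV => e e'.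
rewrite invMg invgK mulgKV in e.
move: (e'); rewrite e addnA -[X in X = _]add0n => /addIn/esym/eqP.
rewrite addn_eq0 => /andP[/eqP/len_eq0 u1 _].
by rewrite -[RHS](mulgKV d d') u1 mul1g.
Qed.

Lemma dist2P lam mu d :
  d \in dist2 lam mu <-> incr lam d /\ incr mu d^-1.
Proof.
rewrite finset.in_setI; split=> [/andP[/dist_incr h1]|[/dist_incr -> h2]].
  by rewrite mem_invg => /dist_incr.
by rewrite mem_invg; apply/dist_incr.
Qed.

Lemma mem_dcosetP lam mu d w :
  reflect (exists u v, [/\ u \in young lam, v \in young mu & w = u * d * v])
          (w \in young lam :* d * young mu).
Proof.
apply: (iffP mulsgP) => [[x v /rcosetP[u hu ->] hv ->]|[u [v [hu hv ->]]]].
  by exists u, v.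
by exists (u * d) v => //; apply/rcosetP; exists u.
Qed.

Lemma dist2_ex lam mu w : exists u v d,
  [/\ u \in young lam, v \in young mu, d \in dist2 lam mu & w = u * d * v].
Proof.
pose P (x : 'S_r * 'S_r) := (x.1 \in young lam) && (x.2 \in young mu).
have P1 : P (1, 1) by rewrite /P /= !young1.
have [[u v] /andP[/= hu hv] min] := @arg_minnP _ _ P (fun x => len (x.1 * w * x.2)) P1.
exists u^-1, v^-1, (u * w * v); split; rewrite ?youngV //; last first.
  by rewrite -!mulgA mulgV mulg1 mulKg.
apply/dist2P; split; apply: incr_min => x hx.
  by rewrite !mulgA; apply: (min (x * u, v)); rewrite /P /= hv youngM.
rewrite -(lenV (x * _)) [(x * _)^-1]invMg invgK lenV -[_ * x^-1]mulgA.
by apply: (min (u, v * x^-1)); rewrite /P /= hu youngM ?youngV.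
Qed.

(** A multiset has only one weakly increasing arrangement. *)
Lemma mono_rows_uniq mu u (F G : 'I_r -> nat) : u \in young mu ->
  (forall p k, rowof mu p = rowof mu k -> p <= k -> F p <= F k) ->
  (forall p k, rowof mu p = rowof mu k -> p <= k -> G p <= G k) ->
  (forall p, G p = F (u p)) -> forall p, F p = G p.
Proof.
suff le u' F' G' : u' \in young mu ->
  (forall p k, rowof mu p = rowof mu k -> p <= k -> F' p <= F' k) ->
  (forall p k, rowof mu p = rowof mu k -> p <= k -> G' p <= G' k) ->
  (forall p, G' p = F' (u' p)) -> forall p, F' p <= G' p.
  move=> hu hF hG e p; apply/eqP; rewrite eqn_leq (le u) //=.
  by apply: (le u^-1) => //; [apply: youngV | move=> x; rewrite e permKV].
move=> /youngP hu hF hG e p; rewrite leqNgt; apply/negP => lt.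
(* The entries of the row of p that u sends strictly to the left of p would
   contain all those up to p. *)
pose A := [set x | (rowof mu x == rowof mu p) && (x <= p)].
pose B := [set x | (rowof mu x == rowof mu p) && (x < p)].
have sub : u' @: A \subset B.
  apply/fintype.subsetP => _ /imsetP[x + ->]; rewrite !inE hu => /andP[/eqP ex xp].
  rewrite ex eqxx ltnNge; apply/negP => px.
  have := hF p (u' x); rewrite hu ex => /(_ erefl px); rewrite -e.
  have := hG x p ex xp => h1 h2.
  by move: lt; rewrite ltnNge (leq_trans h2 h1).
have := subset_leq_card sub; rewrite card_imset; last exact: perm_inj.
have -> : A = p |: B.
  by apply/setP => x; rewrite !inE leq_eqVlt val_eqE; case: (eqVneq x p) => [->|] //=; rewrite eqxx.
by rewrite cardsU1 inE ltnn andbF ltnn.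
Qed.

(** Two distinguished representatives of a double coset send the rows of [lam] to
    the same multisets of rows of [mu], in weakly increasing order in each row;
    hence they agree up to [young mu], and [incr_uniq] applies. *)
Lemma dist2_uniq lam mu d d' : d \in dist2 lam mu -> d' \in dist2 lam mu ->
  d' \in young lam :* d * young mu -> d = d'.
Proof.
move=> /dist2P[hd hd1] /dist2P[hd' hd1'] /mem_dcosetP[u [v [hu hv e]]].
have mono x : incr lam x -> forall p k, rowof lam p = rowof lam k -> (p <= k)%N ->
    (rowof mu (x p) <= rowof mu (x k))%N.
  move=> hx p k er; rewrite leq_eqVlt => /orP[/eqP/val_inj ->//|lt].
  exact/rowof_mono/ltnW/hx.
apply: invg_inj; apply: (incr_uniq (lam := mu)) => // k; rewrite /word !invgK.
apply: (mono_rows_uniq (mu := lam) (u := u)) (mono d hd) (mono d' hd') _ k => // p.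
by rewrite e !permM; move/youngP: hv => ->.
Qed.

End Words.

(** * Coefficients in the Hecke algebra *)

Section LinearMaps.
Local Open Scope ring_scope.
Variable R : comNzRingType.
Implicit Types U V : lmodType R.

Lemma linear_combine U V (F : U -> V) : linear F ->
  forall (I : Type) (s : seq I) (P : pred I) (a : I -> R) (x : I -> U),
  F (\sum_(i <- s | P i) a i *: x i) = \sum_(i <- s | P i) a i *: F (x i).
Proof.
move=> lF I s P a x; apply: (big_rec2 (fun y z => F y = z)); first exact: linear_fun0 lF.
by move=> i y z _ <-; rewrite lF.
Qed.

Lemma linear_sum_fun U V (F : U -> V) : linear F ->
  forall (I : Type) (s : seq I) (P : pred I) (x : I -> U),
  F (\sum_(i <- s | P i) x i) = \sum_(i <- s | P i) F (x i).
Proof.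
move=> lF I s P x; have := linear_combine lF s P (fun=> 1) x.
under eq_bigr do rewrite scale1r.
by under [in RHS]eq_bigr do rewrite scale1r.
Qed.

Lemma linear_scale U V (F : U -> V) : linear F -> forall a x, F (a *: x) = a *: F x.
Proof. by move=> lF a x; have := lF a x 0; rewrite (linear_fun0 lF) !addr0. Qed.

Lemma linear_add U V (F : U -> V) : linear F -> forall x y, F (x + y) = F x + F y.
Proof. by move=> lF x y; have := lF 1 x y; rewrite !scale1r. Qed.

Lemma linear_oppf U V (F : U -> V) : linear F -> forall x, F (- x) = - F x.
Proof. by move=> lF x; rewrite -scaleN1r (linear_scale lF) scaleN1r. Qed.

End LinearMaps.

Section Coefficients.
Local Open Scope ring_scope.
Variables (R : idomainType) (q : R) (r : nat) (H : heckeAlg q r).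
Implicit Types (lam mu nu : composition r) (w u v d : 'S_r) (a b p k : 'I_r).
Implicit Types h : H.

Local Notation T := (@hT R q r H).
Local Notation "u *g v" := (u * v)%g (at level 40, left associativity).

Lemma cf_ex : exists g : H -> {ffun 'S_r -> R},
  (forall c : {ffun 'S_r -> R}, g (\sum_w c w *: T w) = c) /\ (forall h, \sum_w g h w *: T w = h).
Proof. by have [g h1 h2] := hT_basis H; exists g. Qed.

Definition cf h w : R := sval (cid cf_ex) h w.

Lemma T_sum h : h = \sum_w cf h w *: T w.
Proof. by rewrite /cf; case: (cid cf_ex) => g /= [_ ->]. Qed.

Lemma cf_sum (c : 'S_r -> R) w : cf (\sum_v c v *: T v) w = c w.
Proof.
rewrite /cf; case: (cid cf_ex) => g /= [gK _].
have := congr1 (fun f : {ffun 'S_r -> R} => f w) (gK [ffun v => c v]).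
rewrite ffunE => <-; congr (g _ w); apply: eq_bigr => v _; by rewrite ffunE.
Qed.

Lemma cf_ext h h' : (forall w, cf h w = cf h' w) -> h = h'.
Proof. by move=> e; rewrite (T_sum h) (T_sum h'); apply: eq_bigr => w _; rewrite e. Qed.

Lemma cf_linear w : linear (fun h => cf h w : R^o).
Proof.
move=> c x y; rewrite {1}(T_sum x) {1}(T_sum y) scaler_sumr -big_split /=.
under eq_bigr do rewrite scalerA -scalerDl.
by rewrite cf_sum.
Qed.

Lemma cfD h h' w : cf (h + h') w = cf h w + cf h' w.
Proof. exact: (linear_add (V := R^o) (cf_linear w)). Qed.

Lemma cfZ c h w : cf (c *: h) w = c * cf h w.
Proof. exact: (linear_scale (V := R^o) (cf_linear w)). Qed.

Lemma cf0 w : cf 0 w = 0.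
Proof. exact: (linear_fun0 (cf_linear w)). Qed.

Lemma cf_bigsum (I : Type) (s : seq I) (P : pred I) (F : I -> H) w :
  cf (\sum_(i <- s | P i) F i) w = \sum_(i <- s | P i) cf (F i) w.
Proof. exact: (linear_sum_fun (V := R^o) (cf_linear w)). Qed.

Lemma cfT v w : cf (T v) w = (w == v)%:R.
Proof.
have -> : T v = \sum_u (u == v)%:R *: T u.
  rewrite (bigD1 v) //= eqxx scale1r big1 ?addr0 // => u /negPf ->.
  by rewrite scale0r.
by rewrite cf_sum.
Qed.

Lemma cf_indicator (A : pred 'S_r) w : cf (\sum_(v | A v) T v) w = (A w)%:R.
Proof.
rewrite cf_bigsum; under eq_bigr do rewrite cfT.
case: (boolP (A w)) => hw; last first.
  by rewrite big1 // => v hv; case: eqP hv hw => // -> ->.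
rewrite (bigD1 w) //= eqxx big1 ?addr0 // => v /andP[_ /negPf].
by rewrite eq_sym => ->.
Qed.

Lemma T_up w a b : b = a.+1 :> nat -> (w^-1%g a < w^-1%g b)%N ->
  T w * T (tperm a b) = T (w *g tperm a b).
Proof. by move=> e lt; apply: hT_up; [apply: simple_reflsP | apply: len_up]. Qed.

Lemma T_down w a b : b = a.+1 :> nat -> (w^-1%g b < w^-1%g a)%N ->
  T w * T (tperm a b) = q *: T (w *g tperm a b) + (q - 1) *: T w.
Proof. by move=> e lt; apply: hT_down; [apply: simple_reflsP | apply: len_down]. Qed.

Lemma inv_ltn_total w a b : b = a.+1 :> nat ->
  (w^-1%g b < w^-1%g a)%N = ~~ (w^-1%g a < w^-1%g b)%N.
Proof.
move=> e; rewrite -leqNgt [RHS]leq_eqVlt val_eqE (inj_eq perm_inj) eq_sym.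
by rewrite (negPf (adj_neq e)).
Qed.

Lemma cf_mulT h w a b : b = a.+1 :> nat ->
  cf (h * T (tperm a b)) w =
    if (w^-1%g a < w^-1%g b)%N then q * cf h (w *g tperm a b)
    else cf h (w *g tperm a b) + (q - 1) * cf h w.
Proof.
move=> e; set s := tperm a b.
have wsK x : (x *g s == w) = (x == w *g s).
  by rewrite -(inj_eq (mulIg s)) mulK_tperm.
rewrite [in LHS](T_sum h) mulr_suml cf_bigsum.
have -> : \sum_v cf (cf h v *: T v * T s) w =
  \sum_v cf h v * (if (v^-1%g a < v^-1%g b)%N then (w == v *g s)%:R
     else q * (w == v *g s)%:R + (q - 1) * (w == v)%:R).
  apply: eq_bigr => v _; rewrite -scalerAl cfZ; congr (_ * _).
  case: ifPn => [lt|]; first by rewrite T_up // cfT.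
  by rewrite -inv_ltn_total // => lt; rewrite T_down // cfD !cfZ !cfT.
have ne : w != w *g s.
  apply/eqP => /(congr1 (fun x => w^-1 *g x)); rewrite mulVg mulKg => /permP/(_ a).
  by rewrite tpermL perm1 => ba; have := adj_neq e; rewrite -ba eqxx.
rewrite (bigD1 w) // (bigD1 (w *g s)) /=; last by rewrite eq_sym.
rewrite big1 ?addr0; last first.
  move=> v /andP[/negPf n1 /negPf n2]; rewrite [w == v]eq_sym n1.
  by rewrite [w == v *g s]eq_sym wsK n2 /= !mulr0 addr0 if_same mulr0.
rewrite mulK_tperm !eqxx (negPf ne) invM_tpermL invM_tpermR.
rewrite (inv_ltn_total w e); case: (w^-1%g a < w^-1%g b)%N => /=;
  rewrite ?(mulr0n, mulr1n, mulr0, mulr1, add0r, addr0).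
  exact: mulrC.
by rewrite addrC mulrC; congr (_ + _); rewrite mulrC.
Qed.

Lemma len_mul_le u v : (len (u *g v) <= len u + len v)%N.
Proof.
move: v; apply: len_ind => [|v a b e lt IH]; first by rewrite mulg1 len1 addn0.
rewrite (len_up e lt) mulgA addnS !len_ninv.
apply: leq_trans (ninv_adj _ e) _; by rewrite ltnS -!len_ninv.
Qed.

(** A reduced word of [u * v] is obtained by continuing one of [u]. *)
Lemma T_mul u v : len (u *g v) = (len u + len v)%N -> T u * T v = T (u *g v).
Proof.
move: v; apply: len_ind => [|v a b e lt IH]; first by rewrite mulg1 hT1 mulr1.
rewrite (len_up e lt) mulgA addnS => E.
case: (ltnP ((u *g v)^-1%g a) ((u *g v)^-1%g b)) => [lt'|].
  rewrite -T_up // mulrA IH ?T_up //.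
  by move: E; rewrite (len_up e lt') => -[].
rewrite leq_eqVlt val_eqE (inj_eq perm_inj) eq_sym (negPf (adj_neq e)) /= => lt'.
have := len_mul_le u v; rewrite (len_down e lt') E.
by rewrite ltnNge leqnSn.
Qed.

(** The right ideal generated by [x] is reached from [x] by multiplying with the
    [T_s] and forming linear combinations. *)
Lemma mulr_ind (P : H -> Prop) x : P x ->
  (forall h a b, b = a.+1 :> nat -> P h -> P (h * T (tperm a b))) ->
  (forall c h h', P h -> P h' -> P (c *: h + h')) -> P 0 ->
  forall h, P (x * h).
Proof.
move=> Px PT PL P0 h; rewrite (T_sum h) mulr_sumr.
apply: (big_ind P) => // [y z Py Pz|w _].
  by rewrite -[y]scale1r; apply: PL.
rewrite -scalerAr -[X in P X]addr0; apply: PL => // {h}.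
move: w; apply: len_ind => [|w a b e lt IH]; first by rewrite hT1 mulr1.
by rewrite -T_up // mulrA; apply: PT.
Qed.

Definition same lam w d : bool := [forall k, word lam w k == word lam d k].

Lemma sameP lam w d : reflect (word lam w =1 word lam d) (same lam w d).
Proof. by apply: (iffP forallP) => h k; apply/eqP. Qed.

Lemma same_refl lam w : same lam w w.
Proof. exact/sameP. Qed.

(** This invariance of the coefficients characterizes the elements of [M^lam]
    ([permM_left_inv], [left_inv_permM]). *)
Definition left_inv lam h : Prop :=
  forall w w', word lam w =1 word lam w' -> cf h w = cf h w'.

Lemma xelt_cf lam w : cf (xelt H lam) w = (w \in young lam)%:R.
Proof. exact: cf_indicator. Qed.

Lemma left_inv_xelt lam : left_inv lam (xelt H lam).
Proof.
move=> w w' e; rewrite !xelt_cf; congr (nat_of_bool _)%:R.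
have [u hu ->] : exists2 u, u \in young lam & w' = u *g w.
  by exists (w' *g w^-1)%g; [apply/word_eqP | rewrite mulgKV].
by apply/idP/idP => [/(youngM hu)|/(youngM (youngV hu))]; rewrite ?mulKg.
Qed.

(** On word-invariant coefficients the action of [T_s] depends only on the order
    of the two letters that are exchanged. *)
Lemma cf_mulT_word lam h w a b : b = a.+1 :> nat -> left_inv lam h ->
  cf (h * T (tperm a b)) w =
    if (word lam w a < word lam w b)%N then q * cf h (w *g tperm a b)
    else if word lam w a == word lam w b then q * cf h w
    else cf h (w *g tperm a b) + (q - 1) * cf h w.
Proof.
move=> e hh; rewrite cf_mulT //.
case: (ltngtP (word lam w a) (word lam w b)) => [lt|lt|eq].
- by rewrite (word_asc lt).
- by have := word_asc lt; rewrite inv_ltn_total // => /negPf ->.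
- have -> : cf h (w *g tperm a b) = cf h w.
    by apply: hh => k; rewrite word_tperm; case: tpermP => // ->.
  by rewrite mulrBl mul1r addrC subrK if_same.
Qed.

Lemma left_inv_mulT lam h a b : b = a.+1 :> nat -> left_inv lam h ->
  left_inv lam (h * T (tperm a b)).
Proof.
move=> e hh w w' ew; rewrite !(cf_mulT_word _ e hh) !ew (hh _ _ ew).
have -> // : cf h (w *g tperm a b) = cf h (w' *g tperm a b).
by apply: hh => k; rewrite !word_tperm.
Qed.

Lemma left_inv_mul lam h h' : left_inv lam h -> left_inv lam (h * h').
Proof.
move=> hh; move: h'; apply: mulr_ind => //.
- by move=> h' a b e; apply: left_inv_mulT.
- by move=> c x y hx hy w w' e; rewrite !cfD !cfZ (hx _ _ e) (hy _ _ e).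
- by move=> w w' _; rewrite !cf0.
Qed.

Lemma permM_left_inv lam (m : Defs.permM H lam) : left_inv lam (mval m).
Proof.
case: m => m /= /asboolP[h ->]; apply: left_inv_mul; exact: left_inv_xelt.
Qed.

Lemma xelt_incr lam d : incr lam d ->
  xelt H lam * T d = \sum_(u in young lam) T (u *g d).
Proof.
move=> hd; rewrite mulr_suml; apply: eq_bigr => u hu.
by rewrite T_mul // (len_young_incr hu hd).
Qed.

Lemma cf_xelt_incr lam d w : incr lam d ->
  cf (xelt H lam * T d) w = (same lam w d)%:R.
Proof.
move=> hd; have inv := left_inv_mul (T d) (@left_inv_xelt lam).
rewrite xelt_incr // cf_bigsum; under eq_bigr do rewrite cfT.
case: sameP => [e|ne] /=; last first.
  rewrite big1 // => u hu; case: eqP => // ew; case: ne.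
  by rewrite ew; apply: word_young.
have hu : w *g d^-1 \in young lam by apply/word_eqP => k; rewrite e.
rewrite (bigD1 (w *g d^-1)%g) //= mulgKV eqxx big1 ?addr0 // => u /andP[_ ne].
by case: eqP => // ew; move: ne; rewrite ew mulgK eqxx.
Qed.

Lemma left_inv_sum lam h : left_inv lam h ->
  h = \sum_(d in dist lam) cf h d *: (xelt H lam * T d).
Proof.
move=> hh; apply: cf_ext => w; rewrite cf_bigsum.
have [d hd e] := incr_ex lam w.
rewrite (bigD1 d) /=; last exact/dist_incr.
rewrite cfZ cf_xelt_incr // (introT (sameP _ _ _)) => [|k]; last by rewrite e.
rewrite mulr1 big1 ?addr0 => [|d' /andP[/dist_incr hd' ne]].
  by apply: hh => k; rewrite e.
rewrite cfZ cf_xelt_incr //; case: sameP => [e'|]; last by rewrite mulr0.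
by case/eqP: ne; apply: incr_uniq hd' hd _ => k; rewrite e e'.
Qed.

Lemma left_inv_permM lam h : left_inv lam h ->
  exists m : Defs.permM H lam, mval m = h.
Proof.
move=> hh; suff mP : h \in in_submod (Submod (@permM_closed _ _ _ H lam)).
  by exists (ModOf mP).
apply/asboolP; exists (\sum_(d in dist lam) cf h d *: T d).
rewrite {1}(left_inv_sum hh) mulr_sumr; apply: eq_bigr => d _.
by rewrite -scalerAr.
Qed.

End Coefficients.

(** * Homomorphisms between permutation modules *)

Section SubmoduleValues.
Local Open Scope ring_scope.
Variable R : comNzRingType.

Lemma mval_linear (V : lmodType R) (A : submod V) : linear (@mval R V A).
Proof. by []. Qed.

Lemma mvalB (V : lmodType R) (A : submod V) (x y : mod_of A) :
  mval (x - y) = mval x - mval y.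
Proof. by []. Qed.

Lemma mval_inj (V : lmodType R) (A : submod V) : injective (@mval R V A).
Proof. exact: val_inj. Qed.

Lemma mval_insubd (V : lmodType R) (A : submod V) v :
  v \in in_submod A -> mval (insubd (0 : mod_of A) v) = v.
Proof. exact: insubdK. Qed.

Lemma span_closed_ind (V : lmodType R) (A : set V) (P : V -> Prop) :
  P 0 -> (forall a u v, P u -> P v -> P (a *: u + v)) ->
  (forall v, A v -> P v) -> forall v, span_set A v -> P v.
Proof.
move=> P0 PL PA _ [n [a [g [Ag ->]]]].
apply: (big_ind P) => // [x y Px Py|i _]; first by rewrite -[x]scale1r; apply: PL.
by rewrite -[X in P X]addr0; apply: PL => //; apply: PA.
Qed.

Lemma span_incl (V : lmodType R) (A : set V) v : A v -> span_set A v.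
Proof.
move=> Av; exists 1%N, (fun=> 1), (fun=> v); split=> //.
by rewrite big_ord1 scale1r.
Qed.

Lemma span_lin (V : lmodType R) (A : set V) a u v :
  span_set A u -> span_set A v -> span_set A (a *: u + v).
Proof. exact: (span_closed A).2. Qed.

Lemma span_0 (V : lmodType R) (A : set V) : span_set A 0.
Proof. exact: (span_closed A).1. Qed.

Lemma span_sum (V : lmodType R) (A : set V) (I : Type) (s : seq I) (P : pred I)
    (a : I -> R) (F : I -> V) : (forall i, P i -> span_set A (F i)) ->
  span_set A (\sum_(i <- s | P i) a i *: F i).
Proof.
move=> h; apply: (big_ind (span_set A)) => [|x y Ax Ay|i Pi]; first exact: span_0.
  by rewrite -[x]scale1r; apply: span_lin.
by rewrite -[X in span_set A X]addr0; apply: span_lin; [apply: h | apply: span_0].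
Qed.

End SubmoduleValues.

Section Homomorphisms.
Local Open Scope ring_scope.
Variables (R : idomainType) (q : R) (r : nat) (H : heckeAlg q r).
Implicit Types (lam mu nu : composition r) (w u v d : 'S_r) (a b p k : 'I_r).
Implicit Types h : H.

Local Notation T := (@hT R q r H).
Local Notation Mod := (Defs.permM H).
Local Notation ract := (@Defs.ract R q r H _).
Local Notation "u *g v" := (u * v)%g (at level 40, left associativity).

Lemma incr_xelt lam d : incr lam d ->
  T d^-1 * xelt H lam = \sum_(u in young lam) T (d^-1 *g u).
Proof.
move=> hd; rewrite mulr_sumr; apply: eq_bigr => u hu.
rewrite T_mul // -(lenV (d^-1%g *g u)) [((d^-1 * u)^-1)%g]invMg invgK.
by rewrite (len_young_incr (youngV hu) hd) !lenV addnC.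
Qed.

Lemma cf_incr_xelt lam d w : incr lam d ->
  cf (T d^-1 * xelt H lam) w = (same lam w^-1 d)%:R.
Proof.
move=> hd; rewrite incr_xelt // cf_bigsum; under eq_bigr do rewrite cfT.
case: sameP => [e|ne] /=; last first.
  rewrite big1 // => u hu; case: eqP => // ew; case: ne.
  by rewrite ew invMg invgK; apply/word_young/youngV.
have hu : d *g w \in young lam.
  by rewrite -[w]invgK; apply/word_eqP => k; rewrite e.
rewrite (bigD1 (d *g w)) //= mulKg eqxx big1 ?addr0 // => u /andP[_ ne].
by case: eqP => // ew; move: ne; rewrite ew mulKVg eqxx.
Qed.

Definition right_inv lam h : Prop :=
  forall w w', word lam w^-1 =1 word lam w'^-1 -> cf h w = cf h w'.

(** The mirror image of [left_inv_sum], giving a factor on the left of [x_lam]. *)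
Lemma right_inv_factor lam h : right_inv lam h -> exists h', h = h' * xelt H lam.
Proof.
move=> hh; exists (\sum_(d in dist lam) cf h d^-1 *: T d^-1).
rewrite mulr_suml; apply: cf_ext => w; rewrite cf_bigsum.
have [d hd e] := incr_ex lam w^-1.
rewrite (bigD1 d) /=; last exact/dist_incr.
rewrite -scalerAl cfZ cf_incr_xelt // (introT (sameP _ _ _)) => [|k]; last by rewrite e.
rewrite mulr1 big1 ?addr0 => [|d' /andP[/dist_incr hd' ne]].
  by apply: hh => k; rewrite invgK e.
rewrite -scalerAl cfZ cf_incr_xelt //; case: sameP => [e'|]; last by rewrite mulr0.
by case/eqP: ne; apply: incr_uniq hd' hd _ => k; rewrite e e'.
Qed.

Lemma in_permM lam h : left_inv lam h ->
  h \in in_submod (Submod (@permM_closed _ _ _ H lam)).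
Proof. by move/left_inv_permM => [m <-]; apply: mvalP. Qed.

Lemma permM_gen lam (m : Mod lam) : exists h, m = ract (gen H lam) h.
Proof.
case: m => m mP; have /asboolP[h e] := mP.
by exists h; apply: mval_inj.
Qed.

(** If [h = h' * x_lam], left multiplication by [h'] maps [M^lam] to [M^mu] and
    commutes with the right action. *)
Lemma hom_ex lam mu h : left_inv mu h -> right_inv lam h ->
  exists f : homH H lam mu, mval (mval f (gen H lam)) = h.
Proof.
move=> hl /right_inv_factor[h' eh].
have mP (m : Mod lam) : left_inv mu (h' * mval m).
  have [h1 ->] := permM_gen m; rewrite /= mulrA -eh.
  exact: left_inv_mul.
pose f (m : Mod lam) : Mod mu := ModOf (in_permM (mP m)).
suff fP : f \in in_submod (Submod (@homH_closed _ _ _ H lam mu)).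
  by exists (ModOf fP); rewrite eh.
apply/asboolP; split=> [a x y|m h1]; apply: mval_inj => /=.
  by rewrite mulrDr scalerAr.
by rewrite mulrA.
Qed.

Lemma homH_linear lam mu (f : homH H lam mu) : linear (mval f).
Proof. by case: f => f /= /asboolP[]. Qed.

Lemma homH_equiv lam mu (f : homH H lam mu) m h :
  mval f (ract m h) = ract (mval f m) h.
Proof. by case: f => f /= /asboolP[]. Qed.

Lemma homH_val_linear lam mu (m : Mod lam) :
  linear (fun g : homH H lam mu => mval (mval g m)).
Proof. by move=> c x y; rewrite mval_linear fctE mval_linear. Qed.

Lemma homH_uniq lam mu (f g : homH H lam mu) :
  mval (mval f (gen H lam)) = mval (mval g (gen H lam)) -> f = g.
Proof.
move=> e; apply: mval_inj; apply: functional_extensionality_dep => m.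
have [h ->] := permM_gen m; rewrite !homH_equiv.
by apply: mval_inj; rewrite /= e.
Qed.

Definition dcosetT mu lam d : H := \sum_(w in (young mu :* d * young lam)%g) T w.

Lemma cf_dcosetT mu lam d w :
  cf (dcosetT mu lam d) w = (w \in (young mu :* d * young lam)%g)%:R.
Proof. exact: cf_indicator. Qed.

Lemma phi_gen mu lam d : mval (mval (phi H mu lam d) (gen H lam)) = dcosetT mu lam d.
Proof.
rewrite /phi; case: xgetP => [f _ //|no].
have dl : left_inv mu (dcosetT mu lam d).
  move=> w w' /word_eqP hu; rewrite !cf_dcosetT; congr (nat_of_bool _)%:R.
  set x := w' *g w^-1 in hu; have -> : w' = x *g w by rewrite mulgKV.
  apply/mem_dcosetP/mem_dcosetP => -[u [v [h1 h2 e]]].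
    by exists (x *g u), v; rewrite youngM // e !mulgA.
  exists (x^-1 *g u), v; rewrite youngM ?youngV //; split=> //.
  by rewrite -!mulgA; apply: (canRL (mulKg x)); rewrite e !mulgA.
have dr : right_inv lam (dcosetT mu lam d).
  move=> w w' /word_eqP hu; rewrite !cf_dcosetT; congr (nat_of_bool _)%:R.
  rewrite invgK in hu; set x := w'^-1 *g w in hu.
  have -> : w = w' *g x by rewrite mulKVg.
  apply/mem_dcosetP/mem_dcosetP => -[u [v [h1 h2 e]]].
    by exists u, (v *g x^-1); rewrite youngM ?youngV // mulgA -e mulgK.
  by exists u, (v *g x); rewrite youngM // e !mulgA.
have [f ef] := hom_ex dl dr.
by case: (no f).
Qed.

Lemma dist2wP mu lam d : d \in dist2w mu lam <->
  d \in dist2 mu lam /\ forall k, (word mu d k <= rowof lam k)%N.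
Proof.
rewrite /dist2w inE; split=> [/andP[h1 /asboolP h2]|[-> h]].
  split=> // k; rewrite /word.
  have [|j le] := h2 (rowof mu (d^-1%g k)) (d^-1%g k); first by rewrite block_row.
  by rewrite permKV block_row => /eqP ->.
apply/asboolP => i k; rewrite block_row => /eqP <-.
exists (rowof lam (d k)); last by rewrite block_row.
by have := h (d k); rewrite /word permK.
Qed.

(** A Young subgroup is generated by the simple reflections it contains: a right
    descent of one of its elements exchanges two entries of the same row. *)
Lemma young_ind lam (P : 'S_r -> Prop) : P 1%g ->
  (forall v a b, b = a.+1 :> nat -> rowof lam a = rowof lam b ->
     v \in young lam -> P v -> P (v *g tperm a b)) ->
  forall v, v \in young lam -> P v.
Proof.
move=> P1 PS v; move En : (len v) => n; elim: n v En => [|n IH] v En hv.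
  by rewrite (len_eq0 En).
have n1 : v != 1%g by apply: contra_eq_neq En => ->; rewrite len1.
have [a [b [e lt]]] := descent_ex n1.
have er : rowof lam a = rowof lam b.
  apply/eqP; rewrite eqn_leq rowof_mono /=; last by rewrite e.
  have /youngP hV := youngV hv; rewrite -(hV a) -(hV b).
  exact/rowof_mono/ltnW.
have hv' : v *g tperm a b \in young lam by rewrite youngM ?young_tperm.
rewrite -(mulK_tperm v a b); apply: PS => //; apply: IH => //.
by have := En; rewrite (len_down e lt) => -[].
Qed.

Lemma xelt_mulT lam a b : b = a.+1 :> nat -> rowof lam a = rowof lam b ->
  xelt H lam * T (tperm a b) = q *: xelt H lam.
Proof.
move=> e er; apply: cf_ext => w; rewrite cf_mulT // cfZ.
have -> : cf (xelt H lam) (w *g tperm a b) = cf (xelt H lam) w.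
  have hs := young_tperm er.
  rewrite !xelt_cf; congr (nat_of_bool _)%:R; apply/idP/idP => h; last exact: youngM.
  by rewrite -(mulK_tperm w a b) youngM.
by rewrite mulrBl mul1r addrC subrK if_same.
Qed.

(** Since [x_lam T_s = q x_lam] for [s] in the Young subgroup, the image of the
    generator is multiplied by [q] as well, which equates its coefficients at [w]
    and [w s]. *)
Lemma homH_right_inv lam mu (f : homH H lam mu) :
  right_inv lam (mval (mval f (gen H lam))).
Proof.
set E := mval _; have step w a b : b = a.+1 :> nat -> rowof lam a = rowof lam b ->
    (w^-1%g b < w^-1%g a)%N -> cf E (w *g tperm a b) = cf E w.
  move=> e er lt; have : E * T (tperm a b) = q *: E.
    rewrite /E -[mval _ * _]/(mval (ract _ _)) -homH_equiv.
    have -> : ract (gen H lam) (T (tperm a b)) = q *: gen H lam.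
      by apply: mval_inj; rewrite /= xelt_mulT.
    by rewrite (linear_scale (homH_linear f)).
  move/(congr1 (fun x => cf x w)); rewrite cf_mulT // cfZ ltnNge (ltnW lt) /=.
  rewrite mulrBl mul1r => ew; apply: (@GRing.addIr _ (q * cf E w - cf E w)).
  by rewrite ew [RHS]addrC subrK.
have step2 w a b : b = a.+1 :> nat -> rowof lam a = rowof lam b ->
    cf E (w *g tperm a b) = cf E w.
  move=> e er; case: (boolP (w^-1%g a < w^-1%g b)%N) => [lt|].
    have := @step (w *g tperm a b) a b e er.
    by rewrite invM_tpermL invM_tpermR mulK_tperm => ->.
  by rewrite -inv_ltn_total // => lt; apply: step.
move=> w w' /word_eqP; rewrite invgK => hu.
rewrite -(mulKVg w' w); move: (_ *g w) hu; apply: young_ind => [|v a b e er _ IH].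
  by rewrite mulg1.
by rewrite mulgA step2.
Qed.

(** The image of the generator is constant on double cosets, so a homomorphism is
    read off from its coefficients at the distinguished representatives. *)
Lemma homH_sum lam mu (f : homH H lam mu) :
  f = \sum_(d in dist2 mu lam) cf (mval (mval f (gen H lam))) d *: phi H mu lam d.
Proof.
apply: homH_uniq; set E := mval (mval f _).
rewrite (linear_combine (homH_val_linear (gen H lam))); apply: cf_ext => w; rewrite cf_bigsum.
have [u [v [d [hu hv hd ew]]]] := dist2_ex mu lam w.
have wd : w \in (young mu :* d * young lam)%g by apply/mem_dcosetP; exists u, v.
rewrite (bigD1 d) //= cfZ phi_gen cf_dcosetT wd mulr1 big1 ?addr0.
  have -> : cf E w = cf E (d *g v).
    by apply: permM_left_inv => k; rewrite ew -mulgA; apply: word_young.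
  apply: homH_right_inv => k; rewrite invMg word_young ?youngV //.
move=> d' /andP[hd' ne]; rewrite cfZ phi_gen cf_dcosetT.
case: (boolP (w \in _)) => [/mem_dcosetP[u' [v' [hu' hv' ew']]]|]; last by rewrite mulr0.
case/eqP: ne; apply: dist2_uniq hd' hd _; apply/mem_dcosetP.
exists (u^-1 *g u'), (v' *g v^-1); rewrite !youngM ?youngV //; split=> //.
have -> : u^-1 *g u' *g d' *g (v' *g v^-1) = u^-1 *g (u' *g d' *g v') *g v^-1.
  by rewrite !mulgA.
by rewrite -ew' ew -!mulgA mulgV mulg1 mulKg.
Qed.

(** For [h] the image of the generator, this is membership in Hom^wedge
    ([homW_in], [wedge_at_homW]). *)
Definition wedge_at lam mu h : Prop :=
  forall w, cf h w != 0 -> forall k, (word mu w k <= rowof lam k)%N.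

Lemma homW_in lam mu (f : homH H lam mu) :
  wedge_at lam mu (mval (mval f (gen H lam))) ->
  span_set [set g : homH H lam mu |
    exists2 d, d \in dist2w mu lam & g = phi H mu lam d]%classic f.
Proof.
move=> h; rewrite (homH_sum f) (bigID (fun d => d \in dist2w mu lam)) /=.
rewrite [X in _ + X]big1 ?addr0; last first.
  move=> d /andP[hd nd]; case: (eqVneq (cf (mval (mval f (gen H lam))) d) 0) => [->|ne].
    by rewrite scale0r.
  by case/negP: nd; apply/dist2wP; split=> //; apply: h.
apply: span_sum => d /andP[_ hd]; apply: span_incl; exists d => //.
Qed.

Lemma wedge_at_homW lam mu (f : homW H lam mu) :
  wedge_at lam mu (mval (mval (mval f) (gen H lam))).
Proof.
have /asboolP := mvalP f; move: (mval f); apply: span_closed_ind.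
- by move=> w; rewrite (linear_fun0 (homH_val_linear _)) cf0 eqxx.
- move=> c x y hx hy w; rewrite homH_val_linear cfD cfZ.
  case: (eqVneq (cf (mval (mval x (gen H lam))) w) 0) => [->|/hx //].
  by rewrite mulr0 add0r => /hy.
- move=> _ [d hd ->] w; rewrite phi_gen cf_dcosetT; case: (boolP (w \in _)) => [/mem_dcosetP|]; last by rewrite eqxx.
  case=> u [v [hu hv ->]] _ k; case/dist2wP: hd => _ hd.
  rewrite -mulgA word_young // wordM.
  have /youngP hV := youngV hv; by rewrite -[leqRHS]hV.
Qed.

Definition hval lam mu (f : homW H lam mu) (m : Mod lam) : H :=
  mval (mval (mval f) m).

Definition basisM lam d : Mod lam := ract (gen H lam) (T d).

Lemma basisM1 lam : basisM lam 1%g = gen H lam.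
Proof. by apply: mval_inj; rewrite /= hT1 mulr1. Qed.

Lemma basisM_tperm lam d a b : b = a.+1 :> nat -> (word lam d a < word lam d b)%N ->
  basisM lam (d *g tperm a b) = ract (basisM lam d) (T (tperm a b)).
Proof. by move=> e lt; apply: mval_inj; rewrite /= -mulrA T_up //; apply: word_asc lt. Qed.

Lemma cf_basisM lam d w : incr lam d -> cf (mval (basisM lam d)) w = (same lam w d)%:R.
Proof. exact: cf_xelt_incr. Qed.

Lemma basisM_eq lam d a b : b = a.+1 :> nat -> incr lam d -> word lam d a = word lam d b ->
  mval (basisM lam d) * T (tperm a b) = q *: mval (basisM lam d).
Proof.
move=> e hd l; apply: cf_ext => w.
rewrite (cf_mulT_word _ e (permM_left_inv (basisM lam d))) cfZ !cf_basisM //.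
case: (boolP (same lam w d)) => [/sameP ew|ns]; first by rewrite !ew l ltnn eqxx.
rewrite (_ : same lam (w *g tperm a b) d = false) ?mulr0 ?addr0 ?if_same //.
apply/negbTE/negP => /sameP ew; case/negP: ns; apply/sameP => k.
have -> : word lam w k = word lam d (tperm a b k) by rewrite -ew word_tperm tpermK.
by case: tpermP => // ->.
Qed.

Lemma permM_sum lam (m : Mod lam) :
  m = \sum_(d in dist lam) cf (mval m) d *: basisM lam d.
Proof.
apply: mval_inj; rewrite (linear_combine (@mval_linear _ _ _)).
exact/left_inv_sum/permM_left_inv.
Qed.

Lemma hval_ract lam mu (f : homW H lam mu) m h : hval f (ract m h) = hval f m * h.
Proof. by rewrite /hval homH_equiv. Qed.

Lemma hval_linear lam mu (f : homW H lam mu) : linear (hval f).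
Proof. by move=> c x y; rewrite /hval (homH_linear (mval f)). Qed.

Lemma hval_linear_hom lam mu (m : Mod lam) :
  linear (fun f : homW H lam mu => hval f m).
Proof. by move=> c x y; rewrite /hval mval_linear homH_val_linear. Qed.

Lemma homW_app_linear lam mu (m : Mod lam) :
  linear (fun f : homW H lam mu => mval (mval f) m).
Proof. by move=> c x y; rewrite (mval_linear c x y) (mval_linear c (mval x) (mval y)) fctE. Qed.

Lemma homW_ext lam mu (f g : homW H lam mu) :
  (forall m, hval f m = hval g m) -> f = g.
Proof.
move=> e; apply/mval_inj/mval_inj/functional_extensionality_dep => m.
exact/mval_inj/e.
Qed.

Lemma hval_left_inv lam mu (f : homW H lam mu) m : left_inv mu (hval f m).
Proof. exact: permM_left_inv. Qed.

(** Letters can only go down: this holds for [t^lam] by definition of Hom^wedge,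
    and a term kept by [T_s] without exchanging its letters has its larger
    letter where the smaller letter of the argument was. *)
Lemma hval_basisM_le lam mu (f : homW H lam mu) d : incr lam d ->
  forall w, cf (hval f (basisM lam d)) w != 0 ->
  forall k, (word mu w k <= word lam d k)%N.
Proof.
move: d; apply: incr_ind => [w|d a b e hd lt IH w].
  by rewrite basisM1 => /wedge_at_homW h k; rewrite word1.
have from_ws : cf (hval f (basisM lam d)) (w *g tperm a b) != 0 ->
    forall k, (word mu w k <= word lam (d *g tperm a b) k)%N.
  move=> /IH h k; rewrite word_tperm; have := h (tperm a b k).
  by rewrite word_tperm tpermK.
have from_w : (word mu w b <= word mu w a)%N -> cf (hval f (basisM lam d)) w != 0 ->
    forall k, (word mu w k <= word lam (d *g tperm a b) k)%N.
  move=> le /IH h k; rewrite word_tperm; case: tpermP => [->|->|_ _]; last exact: h.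
    exact: leq_trans (h a) (ltnW lt).
  exact: leq_trans le (h a).
rewrite basisM_tperm // hval_ract (cf_mulT_word _ e (hval_left_inv f _)).
case: ifP => [_|/negbT].
  by case: (eqVneq (cf (hval f (basisM lam d)) (w *g tperm a b)) 0) => [->|/from_ws //];
    rewrite mulr0 eqxx.
rewrite -leqNgt => le; case: (eqVneq (cf (hval f (basisM lam d)) w) 0) => [->|/(from_w le) //].
rewrite !mulr0 addr0; case: ifP => _; first by rewrite eqxx.
exact: from_ws.
Qed.

Lemma hval_le lam mu (f : homW H lam mu) m w : cf (hval f m) w != 0 ->
  exists d, [/\ incr lam d, cf (mval m) d != 0 &
    forall k, (word mu w k <= word lam d k)%N].
Proof.
move=> ne; apply: contrapT => no; case/eqP: ne.
rewrite (permM_sum m) (linear_combine (hval_linear f)) cf_bigsum.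
rewrite big1 // => d /dist_incr hd; rewrite cfZ.
case: (eqVneq (cf (mval m) d) 0) => [->|n1]; first by rewrite mul0r.
case: (eqVneq (cf (hval f (basisM lam d)) w) 0) => [->|n2]; first by rewrite mulr0.
by case: no; exists d; split=> //; apply: hval_basisM_le n2.
Qed.

(** Hom^wedge is closed under composition because lowering letters twice lowers
    letters, so [homW_comp] is the composition of maps. *)
Lemma homW_compE lam mu nu (g : homW H mu nu) (f : homW H lam mu) :
  mval (homW_comp g f) = homH_comp (mval g) (mval f).
Proof.
rewrite /homW_comp mval_insubd //; apply/asboolP/homW_in => w /= ne k.
have [d [hd n1 le]] := hval_le (f := g) ne.
apply: leq_trans (le k) _; exact: (wedge_at_homW n1).
Qed.

Lemma hval_comp lam mu nu (g : homW H mu nu) (f : homW H lam mu) m :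
  hval (homW_comp g f) m = hval g (mval (mval f) m).
Proof. by rewrite /hval homW_compE. Qed.

Lemma homW_comp_bilinear lam mu nu : bilinear_map (fun (f : homW H lam mu) (g : homW H mu nu) =>
  homW_comp g f).
Proof.
split=> [f c x y|g c x y]; apply: homW_ext => m.
  by rewrite hval_comp !hval_linear_hom !hval_comp.
rewrite hval_comp hval_linear_hom !hval_comp -hval_linear.
by rewrite homW_app_linear.
Qed.

Lemma homW_comp_assoc lam mu nu rho (h : homW H nu rho) (g : homW H mu nu)
    (f : homW H lam mu) :
  homW_comp h (homW_comp g f) = homW_comp (homW_comp h g) f.
Proof.
by apply: homW_ext => m; rewrite !hval_comp !homW_compE.
Qed.

Lemma phiW_subproof mu lam d : d \in dist2w mu lam ->
  phi H mu lam d \in in_submod (Defs.span [set g : homH H lam mu |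
    exists2 d, d \in dist2w mu lam & g = phi H mu lam d]%classic).
Proof. by move=> hd; apply/asboolP/span_incl; exists d. Qed.

Definition phiW mu lam d : homW H lam mu := insubd 0 (phi H mu lam d).

Lemma phiWE mu lam d : d \in dist2w mu lam -> mval (phiW mu lam d) = phi H mu lam d.
Proof. by move=> hd; rewrite mval_insubd //; apply: phiW_subproof. Qed.

Definition coord lam mu d (f : homW H lam mu) : R := cf (hval f (gen H lam)) d.

Lemma coord_linear lam mu d : linear (coord d : homW H lam mu -> R^o).
Proof. by move=> c x y; rewrite /coord hval_linear_hom cfD cfZ. Qed.

Lemma homW_sum lam mu (f : homW H lam mu) :
  f = \sum_(d in dist2w mu lam) coord d f *: phiW mu lam d.
Proof.
apply: mval_inj; rewrite (linear_combine (@mval_linear _ _ _)).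
rewrite {1}(homH_sum (mval f)) (bigID (fun d => d \in dist2w mu lam)) /=.
rewrite [X in _ + X]big1 ?addr0; last first.
  move=> d /andP[hd nd]; case: (eqVneq (cf (mval (mval (mval f) (gen H lam))) d) 0) => [->|ne].
    by rewrite scale0r.
  by case/negP: nd; apply/dist2wP; split=> //; apply: (wedge_at_homW ne).
apply: eq_big => d; first by case: (boolP (d \in dist2w mu lam)) => [/dist2wP[->]|_]; rewrite ?andbF.
by case/andP => _ hd; rewrite phiWE.
Qed.

End Homomorphisms.

(** * Lowering operators *)

Section MoreWords.
Variable r : nat.
Implicit Types (lam mu nu : composition r) (w u v d : 'S_r) (a b p k : 'I_r).
Local Open Scope nat_scope.

Lemma fiber_perm (F G : 'I_r -> nat) :
  (forall e, #|[set p | F p == e]| = #|[set p | G p == e]|) ->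
  exists u : 'S_r, forall k, F (u k) = G k.
Proof.
move=> h.
have key (K : 'I_r -> nat) e :
    count (pred1 e) [tuple K i | i < r] = #|[set p | K p == e]|.
  have -> : tval [tuple K i | i < r] = map K (enum 'I_r).
    by rewrite -val_ord_tuple.
  by rewrite count_map -sum1_count big_enum_cond /= sum1dep_card.
have /tuple_permP[u e] : perm_eq [tuple G i | i < r] [tuple F i | i < r].
  by apply/allP => e _; rewrite /= !key h.
exists u => k; have := congr1 (fun s => nth 0 s k) e.
rewrite -![nth _ (val _) _]/(nth _ _ _).
by rewrite -!tnth_nth !tnth_mktuple => <-.
Qed.

Lemma word_ex mu (G : 'I_r -> nat) :
  (forall e, part mu e = #|[set p | G p == e]|) ->
  exists w, word mu w =1 G.
Proof.
move=> h; have [|u hu] := @fiber_perm (rowof mu) G.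
  by move=> e; rewrite card_rowof h.
by exists (u^-1)%g => k; rewrite /word invgK.
Qed.

Lemma card_word lam w e : #|[set p | word lam w p == e]| = part lam e.
Proof.
rewrite -card_rowof -(card_imset [set p | rowof lam p == e] (@perm_inj _ w)).
congr #|pred_of_set _|; apply/setP => k; rewrite inE.
apply/idP/imsetP => [h|[x + ->]]; last by rewrite inE /word permK.
by exists ((w^-1)%g k); rewrite ?permKV // inE.
Qed.

Lemma dom_word lam mu w w' :
  (forall k, word mu w' k <= word lam w k) -> Defs.dom lam mu.
Proof.
move=> le; apply/asboolP => e.
rewrite (psum_content (fun e => esym (card_word lam w e))).
rewrite (psum_content (fun e => esym (card_word mu w' e))).
apply/subset_leq_card/fintype.subsetP => k; rewrite !inE.
exact: leq_ltn_trans (le k).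
Qed.

(** Words of the same content have the same sum of letters. *)
Lemma word_le_eq lam w w' :
  (forall k, word lam w' k <= word lam w k) -> word lam w' =1 word lam w.
Proof.
move=> le k; apply/eqP; rewrite eqn_leq le /=.
have sumE v : \sum_p word lam v p = \sum_p rowof lam p.
  by rewrite [LHS](reindex_inj (@perm_inj _ v)); apply: eq_bigr => p _; rewrite /word permK.
have : \sum_p (word lam w p - word lam w' p) = 0.
  apply/eqP; rewrite -(eqn_add2r (\sum_p word lam w' p)) add0n -big_split /=.
  by rewrite !sumE -(sumE w); apply/eqP/eq_bigr => p _; rewrite subnK.
by move/eqP; rewrite sum_nat_eq0 => /forallP/(_ k); rewrite subn_eq0.
Qed.

End MoreWords.

Section LoweringOperators.
Local Open Scope ring_scope.
Variables (R : idomainType) (q : R) (r : nat) (H : heckeAlg q r).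
Implicit Types (lam mu nu : composition r) (w u v d : 'S_r) (a b p k : 'I_r).
Implicit Types (h : H) (f g : 'I_r -> nat).

Local Notation T := (@hT R q r H).
Local Notation Mod := (Defs.permM H).
Local Notation ract := (@Defs.ract R q r H _).
Local Notation "u *g v" := (u * v)%g (at level 40, left associativity).

Definition lowers (i : nat) g f : bool :=
  [forall k, (g k == f k) || ((f k == i.+1) && (g k == i))].

Lemma lowersP i g f :
  reflect (forall k, g k = f k \/ f k = i.+1 /\ g k = i) (lowers i g f).
Proof.
apply: (iffP forallP) => h k; have := h k.
  by case/orP => [/eqP|/andP[/eqP ? /eqP]]; [left | right].
by case=> [->|[-> ->]]; rewrite !eqxx ?orbT.
Qed.

Lemma lowers_le i g f : lowers i g f -> forall k, (g k <= f k)%N.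
Proof. by move=> /lowersP h k; case: (h k) => [->|[-> ->]]. Qed.

Lemma eq_lowers i g g' f f' : g =1 g' -> f =1 f' -> lowers i g f = lowers i g' f'.
Proof. by move=> e e'; apply: eq_forallb => k; rewrite e e'. Qed.

(** The exponent of [q] when the letters [i.+1] of [f] are lowered to those of [g]:
    the pairs formed by a lowered position and a letter [i] of [f] to its right. *)
Definition lstat (i : nat) g f : nat :=
  \sum_(x : 'I_r * 'I_r)
     [&& x.1 < x.2, g x.1 == i, f x.1 == i.+1 & f x.2 == i]%N.

Definition lcoef (i : nat) g f : R := if lowers i g f then q ^+ lstat i g f else 0.

Lemma eq_lcoef i g g' f f' : g =1 g' -> f =1 f' -> lcoef i g f = lcoef i g' f'.
Proof.
move=> e e'; rewrite /lcoef (eq_lowers i e e'); case: ifP => // _; congr (q ^+ _).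
by apply: eq_bigr => x _; rewrite e !e'.
Qed.

Lemma lstatE i g f : lstat i g f =
  (\sum_(p | (g p == i) && (f p == i.+1)) #|[set k : 'I_r | (p < k)%N && (f k == i)]|)%N.
Proof.
rewrite /lstat -(pair_bigA _ (fun x y : 'I_r =>
  nat_of_bool [&& x < y, g x == i, f x == i.+1 & f y == i]%N)) /= [RHS]big_mkcond /=.
apply: eq_bigr => p _; case: ifP => [/andP[-> ->]|gf] /=.
  by rewrite -sum1dep_card [RHS]big_mkcond; apply: eq_bigr => k _; case: (_ && _).
rewrite big1 // => k _; case: (p < k)%N => //=.
by rewrite andbA gf.
Qed.

Lemma lowers_tperm i g f a b :
  lowers i (g \o tperm a b) (f \o tperm a b) = lowers i g f.
Proof.
apply/lowersP/lowersP => h k /=; last exact: (h (tperm a b k)).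
by have := h (tperm a b k); rewrite /= tpermK.
Qed.

(** Swapping the letters [i] and [i.+1] of [f] creates exactly one pair, when the
    letter [i.+1] is lowered. *)
Lemma lstat_tperm i g f a b : b = a.+1 :> nat -> (f a < f b)%N ->
  lstat i (g \o tperm a b) (f \o tperm a b) =
    (lstat i g f + [&& g b == i, f b == i.+1 & f a == i])%N.
Proof.
move=> e lt; set s := tperm a b; have sI : injective s by apply: perm_inj.
have hb : {on predT, bijective (fun x : 'I_r * 'I_r => (s x.1, s x.2))}.
  apply: onW_bij; exists (fun x : 'I_r * 'I_r => (s x.1, s x.2)) => -[x y] /=;
  by rewrite !tpermK.
rewrite /lstat (reindex _ hb) /= (bigD1 (b, a)) //= [in RHS](bigD1 (b, a)) //=.
have ltab : (a < b)%N by rewrite e.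
have ltba : (b < a)%N = false by rewrite ltnNge ltnW.
rewrite !tpermK /s tpermR tpermL ltab ltba /= add0n addnC; congr (_ + _)%N.
apply: eq_bigr => -[x y] /= ne; rewrite !tpermK.
case: (eqVneq (x, y) (a, b)) => [[-> ->]|ne']; last by rewrite tperm_ltn.
rewrite tpermR tpermL ltba ltab /=; case: eqP => //= _.
case: eqP => [fa|] //=; case: eqP => [fb|] //=.
by move: lt; rewrite fa fb ltnNge leqnSn.
Qed.

Lemma lowers_ord i g f a b : lowers i g f -> (f a < f b)%N ->
  (g a <= g b)%N /\ (g a = g b -> [/\ f a = i, f b = i.+1 & g b = i]).
Proof.
move=> /lowersP h lt; case: (h a) => [ea|[fa ga]]; case: (h b) => [eb|[fb gb]].
- by rewrite ea eb; split=> [|e]; [exact: ltnW | move: lt; rewrite e ltnn].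
- rewrite ea gb; move: lt; rewrite fb ltnS => le; split=> [//|fa]; split=> //.
- rewrite ga eb; move: lt; rewrite fa => lt; split=> [|e]; first by apply: ltnW; apply: ltnW.
  by move: lt; rewrite -e ltnNge leqnSn.
- by move: lt; rewrite fa fb ltnn.
Qed.

Lemma lcoef_tperm i g f a b : b = a.+1 :> nat -> (f a < f b)%N ->
  lcoef i g (f \o tperm a b) =
    if (g a < g b)%N then q * lcoef i (g \o tperm a b) f
    else if g a == g b then q * lcoef i g f
    else lcoef i (g \o tperm a b) f + (q - 1) * lcoef i g f.
Proof.
move=> e lt; set s := tperm a b.
have gK : (g \o s) \o s =1 g by move=> k /=; rewrite tpermK.
have -> : lcoef i g (f \o s) = lcoef i ((g \o s) \o s) (f \o s).
  by apply: eq_lcoef => // k; rewrite gK.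
rewrite {1}/lcoef lowers_tperm lstat_tperm //= /s tpermR -/s.
case: (ltngtP (g a) (g b)) => [ltg|gtg|eg].
- rewrite /lcoef; case: ifP => [/lowers_ord/(_ lt)[]|_]; last by rewrite mulr0.
  by rewrite /= tpermL tpermR leqNgt ltg.
- have -> : lcoef i g f = 0.
    by rewrite /lcoef; case: ifP => // /lowers_ord/(_ lt)[]; rewrite leqNgt gtg.
  rewrite mulr0 addr0 /lcoef; case: ifP => // hl; congr (q ^+ _).
  case: (g a =P i) => [ga|]; last by rewrite addn0.
  case: (f a =P i) => [fa|]; last by rewrite !andbF addn0.
  have /lowersP/(_ a) := hl; rewrite /= tpermL fa => -[gb|[/eqP]].
    by move: gtg; rewrite ga gb ltnn.
  by rewrite ltn_eqF.
- have e1 : (g \o s) =1 g by move=> k /=; rewrite /s; case: tpermP => // ->.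
  rewrite /lcoef (eq_lowers i e1 (frefl f)); case: ifP => [hl|_]; last by rewrite mulr0.
  have [_ /(_ eg)[-> -> gb]] := lowers_ord hl lt.
  rewrite eg gb !eqxx addn1 exprS; congr (_ * q ^+ _).
  by apply: eq_bigr => x _; rewrite e1.
Qed.

(** The analogue of a divided power of a generator of quantum gl: at [t^lam] it is
    the sum of all words obtained by lowering letters, with coefficient 1, and
    [lcoef_tperm] propagates the formula along the weak order. *)
Lemma lowering_ex i lam mu : exists E : homW H lam mu,
  forall d w, incr lam d ->
    cf (hval E (basisM H lam d)) w = lcoef i (word mu w) (word lam d).
Proof.
pose E0 : H := \sum_(w | lowers i (word mu w) (rowof lam)) T w.
have cfE w : cf E0 w = (lowers i (word mu w) (rowof lam))%:R by exact: cf_indicator.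
have hl : left_inv mu E0.
  by move=> w w' e; rewrite !cfE (eq_lowers i e (frefl _)).
have hr : right_inv lam E0.
  move=> w w' e; rewrite !cfE; congr (nat_of_bool _)%:R.
  have key v : lowers i (word mu v) (rowof lam) = lowers i (rowof mu) (word lam v^-1).
    apply/lowersP/lowersP => h k; last by have := h (v^-1%g k); rewrite /word invgK permKV.
    by have := h (v k); rewrite /word invgK permK.
  by rewrite !key (eq_lowers i (frefl _) e).
have [E1 eE1] := hom_ex hl hr.
have E1P : E1 \in in_submod (Defs.span [set g : homH H lam mu |
    exists2 d, d \in dist2w mu lam & g = phi H mu lam d]%classic).
  apply/asboolP/homW_in => w; rewrite eE1 cfE.
  by case: (boolP (lowers i (word mu w) (rowof lam))) => [/lowers_le//|_]; rewrite eqxx.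
exists (ModOf E1P) => d w hd; move: d hd w; apply: incr_ind => [w|d a b e hd lt IH w].
  rewrite basisM1 /hval /= eE1 cfE /lcoef.
  rewrite (eq_lowers i (frefl _) (word1 lam)); case: ifP => // _.
  rewrite /lstat big1 // => -[x y] _ /=; rewrite !word1.
  apply/eqP; rewrite eqb0; apply/negP => /and4P[lt _ /eqP ex /eqP ey].
  by have := rowof_mono lam (ltnW lt); rewrite ex ey ltnn.
rewrite basisM_tperm // hval_ract (cf_mulT_word _ e (hval_left_inv _ _)) !IH.
have -> : lcoef i (word mu w) (word lam (d *g tperm a b)) =
    lcoef i (word mu w) (word lam d \o tperm a b).
  by apply: eq_lcoef => // k; rewrite word_tperm.
rewrite (lcoef_tperm _ _ e lt).
by have -> : lcoef i (word mu (w *g tperm a b)) (word lam d) =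
    lcoef i (word mu w \o tperm a b) (word lam d)
  by apply: eq_lcoef => // k; rewrite word_tperm.
Qed.

End LoweringOperators.

(** * Exchange relations between functionals *)

Section Functionals.
Local Open Scope ring_scope.
Variables (R : idomainType) (q : R) (r : nat) (H : heckeAlg q r).
Hypotheses (hq : q \is a GRing.unit) (hr : (0 < r)%N).
Implicit Types (lam mu nu : composition r) (w u v d : 'S_r) (a b p k : 'I_r).
Implicit Types (h : H) (f g : 'I_r -> nat).

Local Notation T := (@hT R q r H).
Local Notation Mod := (Defs.permM H).
Local Notation ract := (@Defs.ract R q r H _).
Local Notation "u *g v" := (u * v)%g (at level 40, left associativity).

Lemma dual_linear (V : lmodType R) (e : dual V) : linear (mval e).
Proof. by case: e => e /= /asboolP. Qed.

Lemma dual_app_linear (V : lmodType R) (x : V) :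
  linear (fun e : dual V => mval e x : R^o).
Proof. by move=> c e e'; rewrite mval_linear fctE. Qed.

Lemma cfd_subproof lam w :
  (fun m : Mod lam => cf (mval m) w : R^o) \in in_submod (Submod (dual_closed (Mod lam))).
Proof. by apply/asboolP => c x y; rewrite -cf_linear. Qed.

Definition cfd lam w : dual (Mod lam) := ModOf (cfd_subproof lam w).

Lemma hact_subproof lam h (e : dual (Mod lam)) :
  (fun m : Mod lam => mval e (ract m h)) \in in_submod (Submod (dual_closed (Mod lam))).
Proof.
apply/asboolP => c x y; rewrite -(dual_linear e); congr (mval e _).
by apply: mval_inj; rewrite /= mulrDl scalerAl.
Qed.

Definition hact lam h (e : dual (Mod lam)) : dual (Mod lam) := ModOf (hact_subproof h e).

Lemma hact_linear lam h : linear (@hact lam h).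
Proof.
move=> c x y; apply: mval_inj; apply: functional_extensionality_dep => m.
exact: (dual_app_linear (ract m h) c x y).
Qed.

Lemma dual_ext lam (e e' : dual (Mod lam)) :
  (forall d, incr lam d -> mval e (basisM H lam d) = mval e' (basisM H lam d)) -> e = e'.
Proof.
move=> h; apply: mval_inj; apply: functional_extensionality_dep => m.
rewrite (permM_sum m) !(linear_combine (dual_linear _)).
by apply: eq_bigr => d /dist_incr hd; rewrite h.
Qed.

Lemma cfd_basisM lam d d' : incr lam d -> incr lam d' ->
  mval (cfd lam d) (basisM H lam d') = (d == d')%:R.
Proof.
move=> hd hd'; rewrite /= cf_basisM //; congr (nat_of_bool _)%:R.
by apply/sameP/eqP => [/(incr_uniq hd hd')|->].
Qed.

Lemma dual_app_sum lam (c : 'S_r -> R) (e : 'S_r -> dual (Mod lam)) (P : pred 'S_r) m :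
  (mval (\sum_(d | P d) c d *: e d) m : R) = \sum_(d | P d) c d * (mval (e d) m : R).
Proof. exact: (linear_combine (dual_app_linear m)). Qed.

Lemma dual_sum lam (e : dual (Mod lam)) :
  e = \sum_(d in dist lam) mval e (basisM H lam d) *: cfd lam d.
Proof.
apply: dual_ext => d hd; rewrite dual_app_sum (bigD1 d); last exact/dist_incr.
rewrite cfd_basisM // eqxx big1 ?addr0 => [|d' /andP[/dist_incr hd' /negPf ne]].
  by rewrite /= addr0 mulr1.
by rewrite cfd_basisM // ne mulr0.
Qed.

(** These functionals span the image of the differential in degree 1
    ([via_larger_Cdiff], [Cdiff_via_larger]). *)
Definition via_larger_gen lam : set (dual (Mod lam)) :=
  [set e | exists mu (f : homW H lam mu) e', sdom lam mu /\ e = dual_comp e' f]%classic.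

Arguments via_larger_gen lam _ : clear implicits.

Definition via_larger lam := span_set (via_larger_gen lam).

Lemma via_larger_hact lam h (e : dual (Mod lam)) : via_larger e -> via_larger (hact h e).
Proof.
move: e; apply: span_closed_ind => [|c x y hx hy|_ [mu [f [e' [hs ->]]]]].
- by rewrite (linear_fun0 (@hact_linear lam h)); apply: span_0.
- by rewrite (@hact_linear lam h); apply: span_lin.
apply: span_incl; exists mu, f, (hact h e'); split=> //.
apply: mval_inj; apply: functional_extensionality_dep => m /=.
by rewrite homH_equiv.
Qed.

(** Words compared lexicographically from the right, the first difference being
    at a position from [m] on; the head of a word can be permuted freely. *)
Definition tail_gt (m : nat) (f' f : 'I_r -> nat) : Prop :=
  exists k, [/\ (m <= k)%N, (f k < f' k)%N & forall k', (k < k')%N -> f' k' = f k'].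

Lemma tail_gt_irr m f : ~ tail_gt m f f.
Proof. by case=> k [_]; rewrite ltnn. Qed.

Lemma eq_tail_gt m f f' g g' : (forall k, (m <= k)%N -> f k = g k) ->
  (forall k, (m <= k)%N -> f' k = g' k) -> tail_gt m f' f -> tail_gt m g' g.
Proof.
move=> e e' [k [le lt eq]]; exists k; rewrite -e // -e' //; split=> // k' lk.
by rewrite -e' ?eq ?e // (leq_trans le) // ltnW.
Qed.

Section Exchange.
Variables (m i : nat) (f : 'I_r -> nat).
Hypothesis sorted_head : forall x y : 'I_r, (x < y)%N -> (y < m)%N -> (f x <= f y)%N.

Let B0 : {set 'I_r} := [set k : 'I_r | (k < m)%N && (f k == i.+1)].
Let ee p : nat := #|[set k : 'I_r | (m <= k)%N && (f k == i)]|
                + #|[set b in B0 | (p < b)%N]|.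
Let gg (C : {set 'I_r}) : R := \prod_(p in C) - q^-1 ^+ ee p.
Let uu (C : {set 'I_r}) k : nat := if k \in C then i else f k.

(** The weights [gg] are chosen so that adding to [C] the last position [p] of [B0]
    where [f'] still has the letter [i.+1] changes the sign only: the letters [i]
    of [f'] to the right of [p] are then those counted by [ee p]. *)
Lemma exchange_toggle (f' : 'I_r -> nat) p (C : {set 'I_r}) :
  (forall k, (m <= k)%N -> f' k = f k) ->
  (forall b, b \in B0 -> (p < b)%N -> f' b = i) ->
  p \in B0 -> f' p = i.+1 -> C \subset B0 -> p \notin C ->
  gg (p |: C) * lcoef q i (uu (p |: C)) f' = - (gg C * lcoef q i (uu C) f').
Proof.
move=> etail maxp pB fp CB pC.
have fpi : f p = i.+1 by move: pB; rewrite inE => /andP[_ /eqP].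
have pm : (p < m)%N by move: pB; rewrite inE => /andP[].
have uup : uu C p = i.+1 by rewrite /uu (negPf pC).
have uup' : uu (p |: C) p = i by rewrite /uu setU11.
have uuk k : k != p -> uu (p |: C) k = uu C k.
  by move=> ne; rewrite /uu in_setU1 (negPf ne).
rewrite /gg big_setU1 //= -/(gg C).
have lowE : lowers i (uu (p |: C)) f' = lowers i (uu C) f'.
  apply/lowersP/lowersP => h k; case: (eqVneq k p) => [->|ne].
  - by left; rewrite uup fp.
  - by rewrite -uuk.
  - by right; rewrite uup' fp.
  - by rewrite uuk.
rewrite /lcoef lowE; case: ifP => [hl|_]; last by rewrite !mulr0 oppr0.
have cnt : #|[set k : 'I_r | (p < k)%N && (f' k == i)]| = ee p.
  rewrite /ee -cardsUI [X in (_ + X)%N](_ : _ = 0%N); last first.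
    apply/eqP; rewrite cards_eq0; apply/eqP/setP => k; rewrite !inE.
    by case: ltnP; rewrite ?andbF.
  rewrite addn0; congr #|pred_of_set _|; apply/setP => k; rewrite !inE.
  case: (ltnP k m) => km /=.
    apply/andP/andP => [[pk /eqP fk]|[/eqP fk pk]]; last first.
      by rewrite pk maxp ?eqxx // inE km fk eqxx.
    split=> //; have := sorted_head pk km; rewrite fpi => le.
    have /lowersP/(_ k) := hl; rewrite fk /uu; case: (boolP (k \in C)) => [kC _|_].
      by have /fintype.subsetP/(_ k kC) := CB; rewrite inE => /andP[].
    case=> [fk'|[/eqP]]; first by move: le; rewrite fk' ltnn.
    by rewrite ltn_eqF.
  by rewrite etail // orbF (leq_trans pm km).
have statE : lstat i (uu (p |: C)) f' = (lstat i (uu C) f' + ee p)%N.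
  rewrite !lstatE (bigD1 p) /=; last by rewrite uup' fp !eqxx.
  rewrite cnt addnC; congr (_ + _)%N; apply: eq_bigl => k.
  case: (eqVneq k p) => [->|ne]; last by rewrite uuk // andbT.
  by rewrite uup (gtn_eqF (ltnSn i)) /= !andbF.
rewrite statE exprD !mulNr; congr (- _).
by rewrite [q ^+ _ * q ^+ _]mulrC mulrACA -exprMn mulVr // expr1n mul1r.
Qed.


(** If the tails agree, [f'] has fewer than [#|B0|] letters [i] in the head, so it
    keeps a letter [i.+1] in [B0], and the terms cancel in pairs. *)
Lemma exchange_sum0 (f' : 'I_r -> nat) :
  (#|[set k : 'I_r | (k < m)%N && (f k == i)]| <
   #|[set k : 'I_r | (k < m)%N && (f k == i.+1)]|)%N ->
  #|[set k : 'I_r | f' k == i]| = #|[set k : 'I_r | f k == i]| ->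
  ~ tail_gt m f' f ->
  \sum_(C in powerset B0) gg C * lcoef q i (uu C) f' = 0.
Proof.
move=> lt cnt ngt.
case: (pselect (exists2 C : {set 'I_r}, C \subset B0 & lowers i (uu C) f')) => [[C0 CB0 hl]|no]; last first.
  rewrite big1 // => C; rewrite powersetE => CB; rewrite /lcoef.
  case: ifP => [hl|_]; last by rewrite mulr0.
  by case: no; exists C.
have uT k : (m <= k)%N -> uu C0 k = f k.
  move=> mk; rewrite /uu; case: ifP => // kC.
  by have /fintype.subsetP/(_ k kC) := CB0; rewrite inE ltnNge mk.
have etail k : (m <= k)%N -> f' k = f k.
  move=> mk; apply/eqP; apply: contrapT => /negP ne; apply: ngt.
  have P0 : (m <= k)%N && (f' k != f k) by rewrite mk.
  have [k1 /andP[mk1 ne1] max1] := @arg_maxnP _ k (fun x : 'I_r => (m <= x)%N && (f' x != f x))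
    (fun x => x : nat) P0.
  exists k1; split=> //.
    have /lowersP/(_ k1) := hl; rewrite uT // => -[e|[-> ->]] //.
    by rewrite e eqxx in ne1.
  move=> k' lt'; apply/eqP; apply: contrapT => /negP ne'.
  have := max1 k'; rewrite (leq_trans mk1 (ltnW lt')) ne' => /(_ isT).
  by rewrite /= leqNgt lt'.
have [p pB fp] : exists2 p, p \in B0 & f' p = i.+1.
  apply: contrapT => nop; move: lt; rewrite ltnNge => /negP; apply.
  rewrite -(leq_add2r #|[set k : 'I_r | (m <= k)%N && (f k == i)]|).
  have split (F : 'I_r -> nat) : (#|[set k : 'I_r | (k < m)%N && (F k == i)]| +
      #|[set k : 'I_r | (m <= k)%N && (F k == i)]| = #|[set k : 'I_r | F k == i]|)%N.
    rewrite -cardsUI [X in (_ + X)%N](_ : _ = 0%N); last first.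
      apply/eqP; rewrite cards_eq0; apply/eqP/setP => k; rewrite !inE.
      by case: ltnP; rewrite ?andbF.
    rewrite addn0; congr #|pred_of_set _|; apply/setP => k; rewrite !inE.
    by case: ltnP => _; rewrite /= ?orbF.
  rewrite split -cnt -split.
  have -> : [set k : 'I_r | (m <= k)%N && (f k == i)]%SET = [set k : 'I_r | (m <= k)%N && (f' k == i)]%SET.
    by apply/setP => k; rewrite !inE; case: leqP => //= mk; rewrite etail.
  rewrite leq_add2r; apply/subset_leq_card/fintype.subsetP => k; rewrite !inE => /andP[km /eqP fk].
  rewrite km /=; have /lowersP/(_ k) := hl; case=> [e|[fk' _]]; last first.
    by case: nop; exists k; rewrite ?inE ?km ?fk ?eqxx.
  rewrite -e /uu; case: ifP => [//|kC]; case: nop.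
  by exists k; [rewrite inE km fk eqxx | rewrite -e /uu kC fk].
pose P1 p' := (p' \in B0) && (f' p' == i.+1).
have P1p : P1 p by rewrite /P1 pB fp eqxx.
have [p1 /andP[p1B /eqP fp1] max1] := @arg_maxnP _ p P1 (fun x => x : nat) P1p.
have maxp b : b \in B0 -> (p1 < b)%N -> f' b = i.
  move=> bB lt'; have /lowersP/(_ b) := hl; rewrite /uu.
  have fb : f b = i.+1 by move: bB; rewrite inE => /andP[_ /eqP].
  have nb : f' b != i.+1.
    apply/negP => fb'; have := max1 b; rewrite /P1 bB fb' => /(_ isT).
    by rewrite /= leqNgt lt'.
  case: ifP => _ [e|[e _]]; try by rewrite e eqxx in nb.
    by rewrite -e.
  by rewrite -e fb eqxx in nb.
rewrite (bigID (fun C : {set 'I_r} => p1 \in C)) /=.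
rewrite (reindex_onto (fun C => p1 |: C) (fun C => C :\ p1)) /=; last first.
  by move=> C /andP[_ h]; rewrite finset.setD1K.
rewrite (eq_bigl (fun C => (C \in powerset B0) && (p1 \notin C))); last first.
  move=> C; rewrite !powersetE setU11 andbT finset.subUset finset.sub1set p1B /=; congr (_ && _).
  apply/eqP/idP => [<-|h]; first by rewrite in_setD1 eqxx.
  by rewrite finset.setU1K.
rewrite -big_split big1 // => C /andP[]; rewrite powersetE => CB pC.
by rewrite exchange_toggle //; apply: addNr.
Qed.
End Exchange.

(** The term [C = set0] of the vanishing sum is the dual basis element of the
    word itself; all others factor through larger compositions. *)
Lemma straighten_sorted lam d (m i : nat) : incr lam d ->
  (forall x y : 'I_r, (x < y)%N -> (y < m)%N -> (word lam d x <= word lam d y)%N) ->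
  (#|[set k : 'I_r | (k < m)%N && (word lam d k == i)]| <
   #|[set k : 'I_r | (k < m)%N && (word lam d k == i.+1)]|)%N ->
  exists2 e : dual (Mod lam), via_larger e & mval e (basisM H lam d) = 1 /\
    forall d', incr lam d' -> (mval e (basisM H lam d') : R) != 0 -> d' = d \/
      tail_gt m (word lam d') (word lam d).
Proof.
move=> hd sorted lt; set f := word lam d.
pose B0 : {set 'I_r} := [set k : 'I_r | (k < m)%N && (f k == i.+1)].
pose ee p : nat := (#|[set k : 'I_r | (m <= k)%N && (f k == i)]|
                + #|[set b in B0 | (p < b)%N]|)%N.
pose gg (C : {set 'I_r}) : R := \prod_(p in C) - q^-1 ^+ ee p.
pose uu (C : {set 'I_r}) k : nat := if k \in C then i else f k.
have ex (C : {set 'I_r}) : exists e : dual (Mod lam),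
    (C \subset B0 -> C != finset.set0 -> via_larger e) /\
    forall d', incr lam d' -> mval e (basisM H lam d') = lcoef q i (uu C) (word lam d').
  have [mu hmu] := content_ex (uu C) hr; have [w hw] := word_ex hmu.
  have [E hE] := lowering_ex H i lam mu.
  exists (dual_comp (cfd mu w) E); split=> [CB C0|d' hd']; last first.
    by rewrite -[LHS]/(cf (hval E (basisM H lam d')) w) hE //; apply: eq_lcoef.
  apply: span_incl; exists mu, E, (cfd mu w); split=> //.
  have Cf k : k \in C -> f k = i.+1.
    by move=> /(fintype.subsetP CB); rewrite inE => /andP[_ /eqP].
  rewrite /sdom (@dom_word _ _ _ d w) /=; last first.
    by move=> k; rewrite hw /uu; case: ifP => // /Cf; rewrite /f => ->.
  have [c cC] := set0Pn _ C0; apply/eqP => e; rewrite -e in hw.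
  have le k : (word lam w k <= word lam d k)%N.
    by rewrite hw /uu; case: ifP => // /Cf; rewrite /f => ->.
  by have := word_le_eq le c; rewrite hw /uu cC -/f Cf // => /eqP; rewrite ltn_eqF.
have [e he] := choice ex.
exists (- \sum_(C in powerset B0 | C != finset.set0) gg C *: e C).
  rewrite -scaleN1r -[X in via_larger X]addr0; apply: span_lin; last exact: span_0.
  by apply: span_sum => C /andP[]; rewrite powersetE => CB C0; apply: (he C).1.
have val d' : incr lam d' -> (mval (- \sum_(C in powerset B0 | C != finset.set0) gg C *: e C)
    (basisM H lam d') : R) = (d' == d)%:R - \sum_(C in powerset B0) gg C * lcoef q i (uu C) (word lam d').
  move=> hd'; rewrite -scaleN1r (linear_scale (dual_app_linear _)).
  rewrite (linear_combine (dual_app_linear _)) [in RHS](bigD1 finset.set0) /=; last first.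
    by rewrite powersetE finset.sub0set.
  rewrite opprD addrA -[LHS]/(-1 * _) mulN1r.
  have -> : gg finset.set0 * lcoef q i (uu finset.set0) (word lam d') = (d' == d)%:R.
    have -> : lcoef q i (uu finset.set0) (word lam d') = lcoef q i f (word lam d').
      by apply: eq_lcoef => // k; rewrite /uu finset.in_set0.
    rewrite /gg big_set0 mul1r.
    case: eqVneq => [->|ne].
      have low : lowers i f (word lam d) by apply/lowersP; left.
      rewrite /lcoef low /lstat big1 // => -[x y] _ /=.
      apply/eqP; rewrite eqb0; apply/negP => /and4P[_ /eqP fx].
      by rewrite -/f fx ltn_eqF.
    rewrite /lcoef; case: ifP => // /lowers_le le.
    by case/eqP: ne; apply: incr_uniq hd' hd _ => k; rewrite (word_le_eq le).
  rewrite subrr add0r; congr (- _); apply: eq_bigr => C _.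
  by rewrite (he C).2.
have full d' : incr lam d' -> ~ tail_gt m (word lam d') f ->
    \sum_(C in powerset B0) gg C * lcoef q i (uu C) (word lam d') = 0.
  by move=> _ ng; apply: exchange_sum0 => //; rewrite !card_word.
split; first by rewrite val // full ?subr0 ?eqxx //; apply: tail_gt_irr.
move=> d' hd'; rewrite val //.
case: (eqVneq d' d) => [->|_] ne; [by left | right].
by apply: contrapT => ng; move: ne; rewrite full // subr0 eqxx.
Qed.

Lemma head_descent_ex f (m : nat) :
  ~ (forall x y : 'I_r, (x < y)%N -> (y < m)%N -> (f x <= f y)%N) ->
  exists a b, [/\ b = a.+1 :> nat, (b < m)%N & (f b < f a)%N].
Proof.
move=> ns; apply: contrapT => no; apply: ns => x y lt ym.
pose N := \max_k f k; pose f1 (k : 'I_r) := if (k < m)%N then f k else N.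
have := @mono_adj r f1 _ x y (ltnW lt); rewrite /f1 ym (ltn_trans lt ym); apply.
move=> a b e; case: ifP => am; case: ifP => bm //; last 1 first.
- by move: am; rewrite -ltnS -e ltnW.
- by rewrite leqNgt; apply/negP => h; apply: no; exists a, b.
- exact: leq_bigmax.
Qed.

(** The relation for a sorted head is transported to all words with the same tail
    by the [T_s] that permute the head, which leave the comparison of tails
    intact. *)
Lemma straighten lam d (m i : nat) : incr lam d ->
  (#|[set k : 'I_r | (k < m)%N && (word lam d k == i)]| <
   #|[set k : 'I_r | (k < m)%N && (word lam d k == i.+1)]|)%N ->
  exists2 e : dual (Mod lam), via_larger e & (mval e (basisM H lam d) : R) \is a GRing.unit /\
    forall d', incr lam d' -> (mval e (basisM H lam d') : R) != 0 -> d' = d \/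
      tail_gt m (word lam d') (word lam d).
Proof.
move En : (len d) => n; elim/ltn_ind: n d En => n IH d En hd lt.
case: (pselect (forall x y : 'I_r, (x < y)%N -> (y < m)%N -> (word lam d x <= word lam d y)%N)).
  move=> sorted; have [e Je [e1 e2]] := straighten_sorted hd sorted lt.
  by exists e => //; rewrite e1 unitr1.
move=> /head_descent_ex[a [b [e bm ltf]]].
have am : (a < m)%N by apply: ltn_trans bm; rewrite e.
set s := tperm a b; set d1 := d *g s.
have w1 k : word lam d1 k = word lam d (s k) by rewrite word_tperm.
have hd1 : incr lam d1 by apply: incr_tperm => //; rewrite neq_ltn ltf orbT.
have en : (len d1 < n)%N by rewrite -En (len_down e (word_asc ltf)).
have sm (k : 'I_r) : (s k < m)%N = (k < m)%N.
  by rewrite /s; case: tpermP => [->|->|//]; rewrite am bm.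
have cntE (j : nat) : #|[set k : 'I_r | (k < m)%N && (word lam d1 k == j)]| =
    #|[set k : 'I_r | (k < m)%N && (word lam d k == j)]|.
  rewrite -(card_imset _ (@perm_inj _ s)); congr #|pred_of_set _|; apply/setP => k.
  rewrite inE; apply/imsetP/idP => [[x + ->]|h]; first by rewrite inE w1 sm.
  by exists (s k); rewrite ?tpermK // inE sm w1 tpermK.
have [e1 Je1 [u1 t1]] : exists2 e : dual (Mod lam), via_larger e & (mval e (basisM H lam d1) : R) \is a GRing.unit /\
    forall d', incr lam d' -> (mval e (basisM H lam d') : R) != 0 -> d' = d1 \/
      tail_gt m (word lam d') (word lam d1).
  by apply: (IH _ en) => //; rewrite !cntE.
have lt1 : (word lam d1 a < word lam d1 b)%N by rewrite !w1 /s tpermL tpermR.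
have dE : d = d1 *g s by rewrite /d1 mulK_tperm.
have BT d' : incr lam d' -> ract (basisM H lam d') (T s) =
   if (word lam d' a < word lam d' b)%N then basisM H lam (d' *g s)
   else if word lam d' a == word lam d' b then q *: basisM H lam d'
   else q *: basisM H lam (d' *g s) + (q - 1) *: basisM H lam d'.
  move=> hd'; case: ltngtP => [l|l|l]; first by rewrite basisM_tperm.
    apply: mval_inj; rewrite /= -mulrA T_down //; last exact: word_asc l.
    by rewrite mulrDr -!scalerAr.
  by apply: mval_inj; rewrite [LHS]/= -/(mval (basisM H lam d')) basisM_eq.
exists (hact (T s) e1); first exact: via_larger_hact.
have tail1 d' k : (m <= k)%N -> word lam (d' *g s) k = word lam d' k.
  move=> mk; rewrite word_tperm; case: tpermP => // ek; move: mk; rewrite ek leqNgt ?am ?bm //.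
split.
  rewrite /= BT // ltnNge (ltnW ltf) /= eq_sym ltn_eqF // -/d1.
  rewrite (linear_add (dual_linear e1)) !(linear_scale (dual_linear e1)).
  have -> : (mval e1 (basisM H lam d) : R) = 0.
    apply/eqP; apply: contrapT => /negP/(t1 _ hd)[ed|].
      by move: ltf; rewrite ed ltnNge (ltnW lt1).
    move=> h; case: (@tail_gt_irr m (word lam d)).
    by apply: eq_tail_gt h => // k mk; apply: tail1.
  by rewrite scaler0 addr0 -[_ *: _]/(_ * _) unitrM hq.
move=> d' hd' ne.
have tl (d2 : 'S_r) : (forall k : 'I_r, (m <= k)%N -> word lam d2 k = word lam d' k) ->
    tail_gt m (word lam d2) (word lam d1) -> tail_gt m (word lam d') (word lam d).
  by move=> e2; apply: eq_tail_gt => // k mk; rewrite w1 -word_tperm tail1.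
have ds : word lam d' a != word lam d' b -> (mval e1 (basisM H lam (d' *g s)) : R) != 0 ->
    d' = d \/ tail_gt m (word lam d') (word lam d).
  move=> ne' /(t1 _ (incr_tperm e hd' ne'))[/mulIg ->|h]; [by left | right].
  by apply: tl h => k mk; apply: tail1.
have dd : d' != d1 -> (mval e1 (basisM H lam d') : R) != 0 ->
    d' = d \/ tail_gt m (word lam d') (word lam d).
  by move=> /eqP ne' /(t1 _ hd')[//|h]; right; apply: tl h.
move: ne; rewrite /= BT //; case: ltngtP => [l|l|l].
- by apply: ds => //; rewrite neq_ltn l.
- have n1 : d' != d1 by apply: contraTneq l => ->; rewrite ltnNge (ltnW lt1).
  rewrite (linear_add (dual_linear e1)) !(linear_scale (dual_linear e1)).
  case: (eqVneq (mval e1 (basisM H lam d') : R) 0) => [->|/(dd n1) //].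
  rewrite scaler0 addr0; case: (eqVneq (mval e1 (basisM H lam (d' *g s)) : R) 0) => [->|].
    by rewrite scaler0 eqxx.
  by move=> h _; apply: ds h => //; rewrite neq_ltn l orbT.
- have n1 : d' != d1 by apply/eqP => ed; move: lt1; rewrite -ed l ltnn.
  rewrite (linear_scale (dual_linear e1)).
  by case: (eqVneq (mval e1 (basisM H lam d') : R) 0) => [->|/(dd n1) //]; rewrite scaler0 eqxx.
Qed.

End Functionals.

(** * Standard tableaux and straightening *)

Section Standard.
Variable r : nat.
Implicit Types (lam mu nu : composition r) (w u v d : 'S_r) (a b p k x : 'I_r).
Local Open Scope nat_scope.

Lemma part_mono lam i j : is_part lam -> i <= j -> part lam j <= part lam i.
Proof.
move=> hp; elim: j => [|j IH]; first by rewrite leqn0 => /eqP ->.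
rewrite leq_eqVlt => /orP[/eqP ->//|]; rewrite ltnS => /IH; apply: leq_trans.
case: (ltnP j.+1 (size lam)) => [lt|le]; last by rewrite /part nth_default.
by have /(sortedP 0)/(_ j lt) := hp.
Qed.

Lemma not_part_ex lam : ~~ is_part lam -> exists i, part lam i < part lam i.+1.
Proof.
move=> hp; apply: contrapT => no; case/negP: hp; apply/(sortedP 0) => i _.
by rewrite /geq /= leqNgt; apply/negP => lt; apply: no; exists i.
Qed.

Definition stdp lam d : Prop :=
  [/\ is_part lam, incr lam d &
      forall p k, colof lam p = colof lam k -> rowof lam p < rowof lam k -> d p < d k].

Lemma row_segment lam i n : psum lam i <= n <= psum lam i.+1 ->
  #|[set x | (rowof lam x == i) && (x < n)]| = n - psum lam i.
Proof.
move=> /andP[le1 le2]; have ler := leq_trans le2 (psum_leq lam i.+1).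
rewrite -[X in X - _](card_ltn ler) -[X in _ - X](card_ltn (psum_leq lam i)).
have sub : [set x : 'I_r | x < psum lam i] \subset [set x : 'I_r | x < n].
  by apply/fintype.subsetP => x; rewrite !inE => h; apply: leq_trans h le1.
have := cardsD [set x : 'I_r | x < n] [set x : 'I_r | x < psum lam i].
rewrite (finset.setIidPr sub) => <-; congr #|pred_of_set _|; apply/setP => x.
rewrite !inE rowof_eq -leqNgt; case: (ltnP x n) => lt; rewrite ?andbF // !andbT.
by rewrite (leq_trans lt le2) andbT.
Qed.

Lemma card_word_lt lam d m j :
  #|[set k : 'I_r | (k < m) && (word lam d k == j)]| =
  #|[set x | (rowof lam x == j) && (d x < m)]|.
Proof.
rewrite -(card_imset [set x | _ && (d x < m)] (@perm_inj _ d)).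
congr #|pred_of_set _|; apply/setP => k; rewrite inE andbC.
apply/idP/imsetP => [h|[x + ->]]; last by rewrite inE /word permK.
by exists ((d^-1)%g k); rewrite ?permKV // inE permKV.
Qed.

(** For a partition, take two entries out of order in adjacent boxes of a column
    and cut before the upper one. If the shape is not a partition, the whole word
    has too many letters [i.+1] for some [i]. *)
Lemma nonstandard_cut lam d : incr lam d -> ~ stdp lam d -> exists m i,
  #|[set k : 'I_r | (k < m) && (word lam d k == i)]| <
  #|[set k : 'I_r | (k < m) && (word lam d k == i.+1)]|.
Proof.
move=> hd ns; case: (boolP (is_part lam)) => [hp|/not_part_ex[i lt]]; last first.
  exists r, i; rewrite !card_word_lt.
  have e j : #|[set x | (rowof lam x == j) && (d x < r)]| = part lam j.
    by rewrite -card_rowof; congr #|pred_of_set _|; apply/setP => x; rewrite !inE ltn_ord andbT.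
  by rewrite !e.
have [p [k [ec er lt]]] : exists p k, [/\ colof lam p = colof lam k,
    rowof lam k = (rowof lam p).+1 & d k < d p].
  apply: contrapT => no; apply: ns; split=> // p k.
  move En : (rowof lam k - rowof lam p) => n; elim: n k En => [|n IH] k En ec er.
    by move: er; rewrite -subn_gt0 En.
  have step p' : colof lam p' = colof lam k -> rowof lam k = (rowof lam p').+1 -> d p' < d k.
    move=> ec' er'; rewrite ltnNge leq_eqVlt val_eqE (inj_eq perm_inj).
    rewrite (_ : (k == p') = false); last by apply/eqP => e; move: er'; rewrite e => /n_Sn.
    by apply/negP => lt; apply: no; exists p', k.
  have k0 : 0 < rowof lam k by apply: leq_ltn_trans er.
  have hc : colof lam k < part lam (rowof lam k).-1.
    by apply: leq_trans (colof_lt lam k) (part_mono hp (leq_pred _)).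
  pose k' := Ordinal (box_lt hc).
  have rk' : rowof lam k = (rowof lam k').+1 by rewrite box_row prednK.
  have ck' : colof lam k' = colof lam k by rewrite box_col.
  apply: leq_ltn_trans (step k' ck' rk').
  have le : rowof lam p <= rowof lam k' by rewrite -ltnS -rk'.
  move: le; rewrite leq_eqVlt => /orP[/eqP e|lt'].
    by rewrite (@rowcol_inj _ lam p k') // ec ck'.
  apply/ltnW/IH => //; last by rewrite ec ck'.
  by move: En; rewrite rk' subSn ?(ltnW lt') // => -[].
exists (d p), (rowof lam p); rewrite !card_word_lt.
have /andP[b1 b2] := rowof_bounds lam p; have /andP[b3 b4] := rowof_bounds lam k.
have pE : p - psum lam (rowof lam p) = colof lam p by [].
have kE : k.+1 - psum lam (rowof lam p).+1 = (colof lam p).+1.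
  by rewrite -er subSn // ec.
apply: (@leq_ltn_trans (colof lam p)).
  rewrite -pE -row_segment ?b1 ?(ltnW b2) //.
  apply/subset_leq_card/fintype.subsetP => x; rewrite !inE => /andP[/eqP ex lt'].
  rewrite ex eqxx /= ltnNge; apply/negP; rewrite leq_eqVlt => /orP[/eqP/val_inj e|l].
    by move: lt'; rewrite e ltnn.
  by have := hd _ _ (esym ex) l; rewrite ltnNge (ltnW lt').
rewrite -kE -row_segment; last by rewrite -er (leq_trans b3 (leqnSn k)) b4.
apply/subset_leq_card/fintype.subsetP => x; rewrite !inE => /andP[/eqP ex le].
rewrite ex eqxx /=; move: le; rewrite ltnS leq_eqVlt => /orP[/eqP/val_inj -> //|l].
by apply: ltn_trans lt; apply: hd l; rewrite er.
Qed.

(** The words are read as numbers, the last letter being the most significant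
    digit. *)
Definition potential lam d : nat := \sum_k word lam d k * (size lam) ^ k.

Lemma potential_max lam d : potential lam d <= \sum_(k : 'I_r) size lam * (size lam) ^ k.
Proof.
by apply: leq_sum => k _; rewrite leq_mul2r (ltnW (rowof_size lam _)) orbT.
Qed.

Lemma geometric_lt N n : 0 < N -> \sum_(k < n) N.-1 * N ^ k < N ^ n.
Proof.
move=> N0; elim: n => [|n IH]; first by rewrite big_ord0 expn0.
rewrite big_ord_recr /= expnS; apply: (@leq_trans (N ^ n + N.-1 * N ^ n)).
  by rewrite ltn_add2r.
by rewrite -mulSn prednK.
Qed.

Lemma potential_gt lam d d' m : tail_gt m (word lam d') (word lam d) ->
  potential lam d < potential lam d'.
Proof.
case=> k [_ lt eq]; rewrite /potential.
set N := size lam; have N0 : 0 < N by apply: leq_ltn_trans (rowof_size lam k).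
rewrite (bigID (fun x : 'I_r => k < x)) [X in _ < X](bigID (fun x : 'I_r => k < x)) /=.
have -> : \sum_(x : 'I_r | k < x) word lam d x * N ^ x =
          \sum_(x : 'I_r | k < x) word lam d' x * N ^ x.
  by apply: eq_bigr => x lx; rewrite eq.
rewrite ltn_add2l (bigD1 k) ?ltnn //= [X in _ < X](bigD1 k) ?ltnn //=.
apply: (@leq_trans ((word lam d k).+1 * N ^ k)); last first.
  by apply: leq_trans (leq_addr _ _); rewrite leq_mul2r lt orbT.
rewrite mulSn addnC ltn_add2r; apply: leq_ltn_trans (geometric_lt k N0).
have kr : k <= r by apply: ltnW.
rewrite (big_ord_widen r (fun x : nat => N.-1 * N ^ x) kr).
rewrite (eq_bigl (fun x : 'I_r => x < k)); last first.
  by move=> x; rewrite -leqNgt ltn_neqAle andbC.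
by apply: leq_sum => x _; rewrite leq_mul2r -ltnS prednK // rowof_size orbT.
Qed.

Lemma ttop_row lam (b : box lam) : rowof lam (ttop lam b) = brow b.
Proof. by case: b => -[i j] lt; apply/eqP; rewrite rowof_eq /= leq_addr psumS ltn_add2l. Qed.

Lemma ttop_col lam (b : box lam) : colof lam (ttop lam b) = bcol b.
Proof. by rewrite /colof ttop_row /= addKn. Qed.

Definition box_at lam p : box lam := exist _ (rowof lam p, colof lam p) (colof_lt lam p).

Lemma ttopK lam : cancel (ttop lam) (box_at lam).
Proof.
move=> b; apply: val_inj; rewrite [LHS]/= ttop_row ttop_col.
by case: b => -[].
Qed.

Lemma box_atK lam : cancel (box_at lam) (ttop lam).
Proof. by move=> p; apply: val_inj; rewrite /= rowcol. Qed.

Lemma ttop_bij lam : bijective (ttop lam).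
Proof. by exists (box_at lam); [apply: ttopK | apply: box_atK]. Qed.

Lemma tact_ttop_inj lam d d' : tact (ttop lam) d = tact (ttop lam) d' -> d = d'.
Proof.
move=> e; apply/permP => p; rewrite -[p](box_atK lam).
exact: (congr1 (fun t => t (box_at lam p)) e).
Qed.

Lemma stdp_standard lam d : stdp lam d -> standard (tact (ttop lam) d).
Proof.
case=> hp hd hc; split=> // [|b c er lt|b c ec lt].
- by apply: (bij_comp (f := d)); [exists (d^-1)%g; [exact: permK | exact: permKV] | exact: ttop_bij].
- by apply: hd; rewrite ?ttop_row // -(@col_ltn _ lam) ?ttop_row ?ttop_col.
- by apply: hc; rewrite ?ttop_row ?ttop_col.
Qed.

Lemma standard_stdp lam (t : filling lam) : standard t ->
  exists2 d, stdp lam d & t = tact (ttop lam) d.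
Proof.
case=> hp tb hrow hcol.
have inj : injective (t \o box_at lam).
  by apply: inj_comp; [apply: bij_inj | apply: (can_inj (box_atK lam))].
have te : t = tact (ttop lam) (perm inj).
  by apply: functional_extensionality_dep => b; rewrite /tact permE /= ttopK.
exists (perm inj) => //; split=> // p k e lt; rewrite !permE /=.
  by apply: hrow => //; rewrite /bcol /= col_ltn.
exact: hcol.
Qed.

End Standard.

Section Spanning.
Local Open Scope ring_scope.
Variables (R : idomainType) (q : R) (r : nat) (H : heckeAlg q r).
Hypotheses (hq : q \is a GRing.unit) (hr : (0 < r)%N).
Implicit Types (lam mu nu : composition r) (d : 'S_r).

Local Notation T := (@hT R q r H).
Local Notation Mod := (Defs.permM H).

Lemma eps_cfd lam d : d \in dist lam -> eps H lam d = cfd H lam d.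
Proof.
move=> hd; have P0 : forall d', d' \in dist lam ->
    mval (cfd H lam d) (Defs.ract (gen H lam) (T d')) = (d' == d)%:R.
  by move=> d' /dist_incr hd'; rewrite eq_sym; apply: cfd_basisM => //; apply/dist_incr.
rewrite /eps; case: xgetP => [e _ he|/(_ _ P0)] //.
apply: dual_ext => d' hd'; rewrite [LHS]he ?P0 //; exact/dist_incr.
Qed.

Lemma eps_tab_cfd lam d : d \in dist lam ->
  eps_tab H (tact (ttop lam) d) = cfd H lam d.
Proof.
move=> hd; rewrite -eps_cfd // /eps_tab; case: xgetP => [e _ [d' [_ /tact_ttop_inj <- //]]|no].
by case: (no (eps H lam d)); exists d.
Qed.

Definition std_dual lam : set (dual (Mod lam)) :=
  [set e | exists2 d, stdp lam d & e = cfd H lam d]%classic.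
Arguments std_dual lam _ : clear implicits.
Definition std_span lam := span_set (std_dual lam).

Lemma Kgen_nil lam : Kgen (lam := lam) (s := [::]) = std_dual lam.
Proof.
apply/seteqP; split=> e /=.
  move=> [t /standard_stdp[d hd ->] ->]; exists d => //.
  by apply: eps_tab_cfd; apply/dist_incr; case: hd.
move=> [d hd ->]; exists (tact (ttop lam) d); first exact: stdp_standard.
by rewrite eps_tab_cfd //; apply/dist_incr; case: hd.
Qed.

(** Repeated use of [straighten] ends, since the potential grows and is bounded. *)
Lemma straightening lam (e : dual (Mod lam)) :
  exists2 j, via_larger j & exists2 k, std_span k & e = j + k.
Proof.
pose I (e : dual (Mod lam)) := exists2 j, via_larger j & exists2 k, std_span k & e = j + k.
have I0 : I 0 by exists 0; [exact: span_0 | exists 0; [exact: span_0 | rewrite addr0]].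
have IL c x y : I x -> I y -> I (c *: x + y).
  move=> [j1 J1 [k1 K1 ->]] [j2 J2 [k2 K2 ->]].
  exists (c *: j1 + j2); first exact: span_lin.
  exists (c *: k1 + k2); first exact: span_lin.
  by rewrite scalerDr addrACA.
have IJ j : via_larger j -> I j by move=> Jj; exists j => //; exists 0; [exact: span_0 | rewrite addr0].
have Isum (c : 'S_r -> R) (P : pred 'S_r) : (forall d, P d -> c d != 0 -> I (cfd H lam d)) ->
    I (\sum_(d | P d) c d *: cfd H lam d).
  move=> h; apply: (big_ind I) => // [x y Ix Iy|d Pd]; first by rewrite -[x]scale1r; apply: IL.
  case: (eqVneq (c d) 0) => [->|ne]; first by rewrite scale0r.
  by rewrite -[X in I X]addr0; apply: IL => //; apply: h.
suff main d : incr lam d -> I (cfd H lam d).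
  by rewrite -/(I e) (dual_sum e); apply: Isum => d /dist_incr hd _; apply: main.
pose B := (\sum_(k < r) size lam * size lam ^ k)%N.
move En : (B - potential lam d)%N => n; elim/ltn_ind: n d En => n IH d En hd.
case: (pselect (stdp lam d)) => [st|/(nonstandard_cut hd)[m [i lt]]].
  exists 0; first exact: span_0.
  by exists (cfd H lam d); [apply: span_incl; exists d | rewrite add0r].
have [j Jj [uj tj]] := straighten H hq hr hd lt.
have -> : cfd H lam d = (mval j (basisM H lam d) : R)^-1 *: (j - \sum_(d' | (d' \in dist lam) && (d' != d))
    (mval j (basisM H lam d') : R) *: cfd H lam d').
  rewrite {2}(dual_sum j) (bigD1 d) /=; last exact/dist_incr.
  by rewrite addrK scalerA mulVr // scale1r.
rewrite -[X in I X]addr0; apply: (IL) => //; rewrite addrC -scaleN1r; apply: (IL); last exact: IJ.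
apply: Isum => d' /andP[/dist_incr hd' ne] nz.
case: (tj _ hd' nz) => [e1|/potential_gt gt]; first by rewrite e1 eqxx in ne.
apply: (IH (B - potential lam d')%N) => //; rewrite -En ltn_sub2l //.
exact: leq_trans gt (potential_max lam d').
Qed.

End Spanning.

(** * Column readings and the Bruhat order on words *)

Section Conjugate.
Variable r : nat.
Implicit Types (lam mu nu kap : composition r) (w u v d : 'S_r) (a b p k x : 'I_r).
Local Open Scope nat_scope.

Lemma sorted_geq_le (x y : nat) (s : seq nat) : sorted geq (x :: s) -> y \in s -> y <= x.
Proof.
move=> hs; have /allP : all (geq x) s.
  by apply: order_path_min hs => a b c; rewrite /geq /= => h1 h2; apply: leq_trans h2 h1.
by apply.
Qed.

Lemma count_sorted (s : seq nat) i j : sorted geq s ->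
  (i < count (ltn j) s) = (j < nth 0 s i).
Proof.
elim: s i => [|x s IH] i /=; first by rewrite nth_nil.
move=> hs; case: (ltnP j x) => [jx|xj] /=.
  case: i => [|i] /=; first by rewrite add1n.
  by rewrite add1n ltnS IH // (path_sorted hs).
rewrite (@eq_in_count _ _ pred0) ?count_pred0; last first.
  by move=> y /(sorted_geq_le hs) yx; apply/negbTE; rewrite -leqNgt (leq_trans yx).
rewrite ltn0; apply/esym/negbTE; rewrite -leqNgt; case: i => [|i] //=.
case: (ltnP i (size s)) => [lt|?]; last by rewrite nth_default.
by have /(sorted_geq_le hs)/leq_trans := mem_nth 0 lt; apply.
Qed.

Lemma part_conj lam j : part (conj_comp lam) j = count (ltn j) lam.
Proof.
rewrite /part /=; case: (ltnP j (foldr maxn 0 lam)) => [lt|le]; first by rewrite nth_mkseq.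
rewrite nth_default ?size_mkseq //; apply/esym/eqP; rewrite -leqn0 leqNgt -has_count.
apply/negP => /hasP[x xs]; rewrite /= => jx.
have : x <= foldr maxn 0 lam.
  elim: (cseq lam) xs => //= y t IH; rewrite inE leq_max => /orP[/eqP->|/IH ->].
    by rewrite leqnn.
  by rewrite orbT.
by rewrite leqNgt (leq_ltn_trans le jx).
Qed.

Lemma conj_lt lam i j : is_part lam ->
  (i < part (conj_comp lam) j) = (j < part lam i).
Proof. by move=> hp; rewrite part_conj count_sorted. Qed.

Lemma wperm_spec lam p : is_part lam ->
  rowof (conj_comp lam) (wperm lam p) = colof lam p /\
  colof (conj_comp lam) (wperm lam p) = rowof lam p.
Proof.
move=> hp; have hc k : rowof lam k < part (conj_comp lam) (colof lam k).
  by rewrite conj_lt // colof_lt.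
pose f k : 'I_r := Ordinal (box_lt (hc k)).
have fr k : rowof (conj_comp lam) (f k) = colof lam k by rewrite box_row.
have fc k : colof (conj_comp lam) (f k) = rowof lam k by rewrite box_col.
have inj : injective f.
  move=> x y e; apply: (rowcol_inj (lam := lam)); first by rewrite -!fc e.
  by rewrite -!fr e.
suff e : wperm lam p = f p by rewrite e.
rewrite /wperm; case: xgetP => [w _ hw|/(_ (perm inj))].
  pose c : box (conj_comp lam) := exist _ (colof lam p, rowof lam p) (hc p).
  have := hw (box_at lam p) c erefl erefl; rewrite /tact box_atK => e1.
  rewrite e1; apply: (@rowcol_inj _ (conj_comp lam)).
    by rewrite ttop_row fr.
  by rewrite ttop_col fc.
case=> b c e1 e2; rewrite /tact permE.
by apply: (rowcol_inj (lam := conj_comp lam)); rewrite ?fr ?fc ?ttop_row ?ttop_col ?e1 ?e2.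
Qed.

(** The word of [t^lam w_lam] lists [0, 1, 2, ...] along each column, from the left
    column to the right one. *)
Lemma word_wperm lam k : is_part lam ->
  word lam (wperm lam) k = colof (conj_comp lam) k.
Proof.
move=> hp; rewrite /word; have [_ <-] := wperm_spec ((wperm lam)^-1%g k) hp.
by rewrite permKV.
Qed.

Lemma wperm_incr lam : is_part lam -> incr lam (wperm lam).
Proof.
move=> hp p k e lt; rewrite ltnNge; apply/negP => /(rowof_mono (conj_comp lam)).
have [-> _] := wperm_spec p hp; have [-> _] := wperm_spec k hp.
by rewrite leqNgt col_ltn ?lt.
Qed.

(** By induction along the row, the letters before [k] are forced to be
    [0, 1, 2, ...], and the letter at [k] must avoid them. *)
Lemma column_bound kap (g : 'I_r -> nat) :
  (forall p k, rowof kap p = rowof kap k -> g p = g k -> p = k) ->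
  (forall p k, rowof kap p = rowof kap k -> p < k -> g p <= colof kap p) ->
  forall k, colof kap k <= g k.
Proof.
move=> inj le k; move En : (k : nat) => n; elim/ltn_ind: n k En => n IH k En.
rewrite leqNgt; apply/negP => lt.
have lt' : g k < part kap (rowof kap k) by apply: ltn_trans lt (colof_lt kap k).
pose p := Ordinal (box_lt lt').
have rp : rowof kap p = rowof kap k by rewrite box_row.
have cp : colof kap p = g k by rewrite box_col.
have pk : p < k by rewrite -(col_ltn rp) cp.
have gp : g p = g k.
  by apply/eqP; rewrite -cp eqn_leq (le p k) // (IH p) // -En.
by move: pk; rewrite (inj _ _ rp gp) ltnn.
Qed.

Definition ncount (f : 'I_r -> nat) (k i : nat) : nat := #|[set p : 'I_r | (p < k) && (f p <= i)]|.

(** The Bruhat order on words, the sorted word being the largest. *)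
Definition below (f g : 'I_r -> nat) : Prop := forall k i : nat, ncount f k i <= ncount g k i.

Lemma eq_ncount f g (k i : nat) : f =1 g -> ncount f k i = ncount g k i.
Proof. by move=> e; congr #|pred_of_set _|; apply/setP => p; rewrite !inE e. Qed.

Lemma ncountS f (a : 'I_r) i : ncount f a.+1 i = ncount f a i + (f a <= i).
Proof.
rewrite /ncount; case: (boolP (f a <= i)) => fa.
  rewrite (cardsD1 a) inE ltnSn fa addnC; congr (_ + _).
  congr #|pred_of_set _|; apply/setP => p; rewrite !inE ltnS [p <= a]leq_eqVlt val_eqE.
  by case: (eqVneq p a) => [->|] //=; rewrite ltnn.
rewrite addn0; congr #|pred_of_set _|; apply/setP => p; rewrite !inE ltnS leq_eqVlt val_eqE.
by case: (eqVneq p a) => [->|] //=; rewrite (negPf fa) andbF.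
Qed.

Lemma ncount_tperm f a b (k i : nat) : b = a.+1 :> nat -> k != b ->
  ncount (f \o tperm a b) k i = ncount f k i.
Proof.
move=> e kb; rewrite /ncount -(card_imset [set p : 'I_r | (p < k) && (f p <= i)] (@perm_inj _ (tperm a b))).
congr #|pred_of_set _|; apply/setP => p; rewrite inE.
have seg (x : 'I_r) : (tperm a b x < k) = (x < k).
  have ab : (a < k) = (b < k) by rewrite e [RHS]ltn_neqAle eq_sym -e kb.
  by case: tpermP => [->|->|//]; rewrite ab.
apply/idP/imsetP => [h|[x + ->]]; last by rewrite inE /= seg tpermK.
by exists (tperm a b p); rewrite ?tpermK // inE seg.
Qed.

(** The lifting property: only the count at [k = b] changes, and sorting two letters
    gives it the largest value allowed by the neighbouring counts. *)
Lemma below_tperm f g a b : b = a.+1 :> nat -> g b < g a -> below f g ->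
  below f (g \o tperm a b) /\ below (f \o tperm a b) (g \o tperm a b).
Proof.
move=> e lt h.
have main f' : (forall k i : nat, k != b -> ncount f' k i <= ncount g k i) -> below f' (g \o tperm a b).
  move=> h' k i; case: (eqVneq k b) => [kb|ne]; last by rewrite ncount_tperm ?h'.
  have ha := h' a i (adj_neq e).
  have hb := h' b.+1 i (negbT (gtn_eqF (ltnSn b))).
  rewrite kb e !ncountS ncount_tperm ?(adj_neq e) //= tpermL.
  case: (leqP (g b) i) => gb; first by rewrite leq_add // leq_b1.
  have gi : (g a <= i) = false by apply/negbTE; rewrite -ltnNge (ltn_trans gb lt).
  move: hb; rewrite ncountS [X in _ <= X]ncountS e !ncountS gi [g b <= i]leqNgt gb !addn0.
  by apply: leq_trans; rewrite leq_addr.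
split; first by apply: main => k i _; apply: (h k i).
by apply: main => k i ne; rewrite ncount_tperm //; apply: (h k i).
Qed.

Definition ncount_sum (N : nat) f : nat := \sum_(k < r.+1) \sum_(i < N) ncount f k i.

Lemma below_ncount_sum N f g : (forall p, f p <= N) -> (forall p, g p <= N) ->
  below f g -> f =1 g \/ ncount_sum N f < ncount_sum N g.
Proof.
move=> hf hg h; case: (pselect (f =1 g)) => [|ne]; [by left | right].
have le : ncount_sum N f <= ncount_sum N g by apply: leq_sum => k _; apply: leq_sum => i _; apply: (h k i).
rewrite ltn_neqAle le andbT {le}.
apply/negP => /eqP e; apply: ne => p.
have eqn (k i : nat) : k < r.+1 -> i < N -> ncount f k i = ncount g k i.
  move=> hk hi; apply/eqP; rewrite eqn_leq h /= leqNgt; apply/negP => lt.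
  move/eqP: e; rewrite eqn_leq => /andP[_]; rewrite leqNgt => /negP; apply.
  rewrite /ncount_sum (bigD1 (Ordinal hk)) //= [X in _ < X](bigD1 (Ordinal hk)) //=.
  rewrite -addSn leq_add //; last by apply: leq_sum => x _; apply: leq_sum.
  rewrite (bigD1 (Ordinal hi)) //= [X in _ < X](bigD1 (Ordinal hi)) //=.
  by rewrite -addSn leq_add //; apply: leq_sum.
have le i : i < N -> (f p <= i) = (g p <= i).
  move=> hi; have := eqn p.+1 i _ hi; rewrite ltnS => /(_ (ltn_ord p)).
  rewrite !ncountS (eqn p i) // ?ltnS ?(ltnW (ltn_ord p)) // => /addnI.
  by case: (f p <= i); case: (g p <= i).
apply/eqP; rewrite eqn_leq; apply/andP; split.
  by case: (ltnP (g p) N) => [/le ->|/(leq_trans (hf p))].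
by case: (ltnP (f p) N) => [/le <-|/(leq_trans (hg p))].
Qed.

(** In each row of [kap] the positions are sorted, so they have as many small values
    in any initial segment as possible. *)
Lemma below_column kap v : v \in young kap ->
  below (fun k => colof kap (v^-1%g k)) (colof kap).
Proof.
move=> hv k i; have /youngP hV := youngV hv.
have split (f : 'I_r -> nat) : ncount f k i =
    \sum_(c < size kap) #|[set p : 'I_r | [&& rowof kap p == c, p < k & f p <= i]]|.
  rewrite /ncount -sum1_card (partition_big (fun p => Ordinal (rowof_size kap p)) predT) //=.
  apply: eq_bigr => c _; rewrite -sum1_card; apply: eq_bigl => p.
  by rewrite !inE -val_eqE /= andbC.
rewrite !split; apply: leq_sum => c _.
case: (pselect (exists p : 'I_r, [/\ rowof kap p = c, p < k & i < colof kap p])); last first.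
  move=> no; apply/subset_leq_card/fintype.subsetP => p; rewrite !inE => /and3P[h1 h2 _].
  by rewrite h1 h2 /= leqNgt; apply/negP => h3; apply: no; exists p; split=> //; apply/eqP.
case=> p1 [r1 k1 i1]; apply: (@leq_trans #|[set p : 'I_r | (rowof kap p == c) && (colof kap p <= i)]|).
  rewrite -(card_imset [set p | _ && (colof kap p <= i)] (@perm_inj _ v)).
  apply/subset_leq_card/fintype.subsetP => p; rewrite inE => /and3P[h1 h2 h3].
  by apply/imsetP; exists (v^-1%g p); rewrite ?permKV // inE hV h1.
apply/subset_leq_card/fintype.subsetP => p; rewrite !inE => /andP[/eqP h1 h2].
rewrite h1 eqxx h2 andbT /=; apply: ltn_trans k1; rewrite -(@col_ltn _ kap) ?r1 //.
exact: leq_ltn_trans i1.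
Qed.

(** Two consecutive entries that are out of order for the column reading lie in
    different rows and columns, so exchanging them preserves standardness. *)
Lemma stdp_step lam d : stdp lam d -> d != wperm lam ->
  exists a b, [/\ b = a.+1 :> nat, word lam d a < word lam d b & stdp lam (d * tperm a b)%g].
Proof.
move=> [hp hd hc] ne.
have [a [b [e lt]]] : exists a b, b = a.+1 :> nat /\
    wperm lam (d^-1%g b) < wperm lam (d^-1%g a).
  have n1 : ((wperm lam)^-1 * d != 1)%g by rewrite -eq_mulVg1 eq_sym.
  have [a [b [e lt]]] := descent_ex n1; exists a, b; split=> //.
  by move: lt; rewrite invMg invgK !permM.
set p := d^-1%g a in lt *; set k := d^-1%g b in lt *.
have dp : d p = a by rewrite permKV. have dk : d k = b by rewrite permKV.
have lab : a < b by rewrite e.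
have le : colof lam k <= colof lam p.
  have [<- _] := wperm_spec k hp; have [<- _] := wperm_spec p hp.
  exact/rowof_mono/ltnW.
have rlt : rowof lam p < rowof lam k.
  rewrite ltnNge; apply/negP => rle.
  move: le; rewrite leq_eqVlt => /orP[/eqP ec|clt].
    move: rle; rewrite leq_eqVlt => /orP[/eqP er|rlt].
      by move: lab; rewrite -dp -dk (rowcol_inj er ec) ltnn.
    by have := hc _ _ ec rlt; rewrite dp dk ltnNge (ltnW lab).
  have hb : colof lam k < part lam (rowof lam p).
    by apply: ltn_trans clt (colof_lt lam p).
  pose x := Ordinal (box_lt hb).
  have xp : d x < d p by apply: hd; rewrite ?box_row // -(@col_ltn _ lam) ?box_row ?box_col.
  have kx : d k <= d x.
    move: rle; rewrite leq_eqVlt => /orP[/eqP er|rlt].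
      by rewrite (@rowcol_inj _ lam k x) ?box_row ?box_col.
    by apply/ltnW/hc; rewrite ?box_row ?box_col.
  by have := leq_ltn_trans kx xp; rewrite dp dk ltnNge (ltnW lab).
have clt : colof lam k < colof lam p.
  rewrite ltn_neqAle le andbT; apply/negP => /eqP ec.
  have := col_ltn (lam := conj_comp lam) (p := wperm lam k) (p' := wperm lam p).
  have [-> ->] := wperm_spec k hp; have [-> ->] := wperm_spec p hp.
  by move=> /(_ ec); rewrite lt ltnNge (ltnW rlt).
exists a, b; split=> //; split=> //.
  by apply: incr_tperm => //; rewrite ltn_eqF.
move=> x y ec er; rewrite !permM tperm_ltn ?hc // xpair_eqE; apply/negP => /andP[/eqP h1 /eqP h2].
  have xp : x = p by apply: (@perm_inj _ d); rewrite h1 dp.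
  have yk : y = k by apply: (@perm_inj _ d); rewrite h2 dk.
  by move: clt; rewrite -xp -yk ec ltnn.
have xp : x = k by apply: (@perm_inj _ d); rewrite h1 dk.
have yk : y = p by apply: (@perm_inj _ d); rewrite h2 dp.
by move: clt; rewrite -xp -yk ec ltnn.
Qed.

End Conjugate.

(** * Specht modules *)

Section Triangular.
Local Open Scope ring_scope.
Variables (R : comUnitRingType) (I : finType) (P : pred I) (M : I -> nat) (A : I -> I -> R).
Hypotheses (Aunit : forall i, P i -> A i i \is a GRing.unit)
  (Atri : forall i j, P i -> P j -> A i j != 0 -> i = j \/ (M i < M j)%N).

(** Back substitution along the measure [M]. *)
Lemma triangular_solve (t : I -> R) :
  exists c : I -> R, forall j, P j -> \sum_(i | P i) c i * A i j = t j.
Proof.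
suff [c [_ h]] : exists c : I -> R, (forall i, (\max_j (M j).+1 <= M i)%N -> c i = 0) /\
    forall j, P j -> (M j < \max_j (M j).+1)%N -> \sum_(i | P i) c i * A i j = t j.
  by exists c => j Pj; apply: h => //; apply: (leq_bigmax (F := fun j => (M j).+1)).
elim: (\max_j (M j).+1)%N => [|n [c [c0 hc]]].
  by exists (fun=> 0); split.
pose c' i := if (P i) && (M i == n) then (A i i)^-1 * (t i - \sum_(k | P k) c k * A k i) else c i.
exists c'; split=> [i le|j Pj].
  by rewrite /c' gtn_eqF // andbF c0 // ltnW.
have lowE j' : P j' -> (M j' < n)%N -> \sum_(i | P i) c' i * A i j' = \sum_(i | P i) c i * A i j'.
  move=> Pj' lt; apply: eq_bigr => i Pi; rewrite /c' Pi /=; case: eqP => // Mi.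
  case: (eqVneq (A i j') 0) => [->|/(Atri Pi Pj')]; first by rewrite !mulr0.
  case=> [e|lt']; first by move: lt; rewrite -e Mi ltnn.
  by move: lt'; rewrite Mi ltnNge (ltnW lt).
rewrite ltnS leq_eqVlt => /orP[/eqP Mj|lt]; last by rewrite lowE // hc.
rewrite (bigD1 j) //= {1}/c' Pj Mj eqxx /= mulrAC mulVr ?Aunit // mul1r.
have cj : c j = 0 by apply: c0; rewrite Mj.
rewrite [X in t j - X](bigD1 j) //= cj mul0r add0r.
rewrite [X in _ - _ + X](_ : _ = \sum_(i | P i && (i != j)) c i * A i j) ?subrK //.
apply: eq_bigr => i /andP[Pi ne]; rewrite /c' Pi /=; case: eqP => // Mi.
case: (eqVneq (A i j) 0) => [->|/(Atri Pi Pj)]; first by rewrite !mulr0.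
by case=> [e|]; [rewrite e eqxx in ne | rewrite Mi Mj ltnn].
Qed.

Lemma triangular_inj (V : lmodType R) (x : I -> V) :
  (forall j, P j -> \sum_(i | P i) A i j *: x i = 0) -> forall i, P i -> x i = 0.
Proof.
move=> h i; move En : (M i) => n; elim/ltn_ind: n i En => n IH i En Pi.
have := h i Pi; rewrite (bigD1 i) //= big1 ?addr0 => [/(congr1 (fun y => (A i i)^-1 *: y))|k /andP[Pk ne]].
  by rewrite scalerA mulVr ?Aunit // scale1r scaler0.
case: (eqVneq (A k i) 0) => [->|/(Atri Pk Pi)]; first by rewrite scale0r.
case=> [e|lt]; first by rewrite e eqxx in ne.
by rewrite (IH (M k)) ?scaler0 // -En.
Qed.

End Triangular.

Section Specht.
Local Open Scope ring_scope.
Variables (R : idomainType) (q : R) (r : nat) (H : heckeAlg q r).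
Hypotheses (hq : q \is a GRing.unit) (hr : (0 < r)%N).
Implicit Types (lam mu nu kap : composition r) (w u v d : 'S_r) (a b p k : 'I_r).
Implicit Types h : H.

Local Notation T := (@hT R q r H).
Local Notation Mod := (Defs.permM H).
Local Notation ract := (@Defs.ract R q r H _).
Local Notation "u *g v" := (u * v)%g (at level 40, left associativity).

(** The Young subgroup is the union of the pairs [{v, s v}]. *)
Lemma yelt_factor kap a b : b = a.+1 :> nat -> rowof kap a = rowof kap b ->
  exists y, yelt H kap = (1 - q^-1 *: T (tperm a b)) * y.
Proof.
move=> e er; set s := tperm a b; have hs : s \in young kap by apply: young_tperm.
exists (\sum_(v in young kap | (v a < v b)%N) (- q) ^- len v *: T v).
rewrite /yelt (bigID (fun v : 'S_r => (v a < v b)%N)) /= mulrBl mul1r; congr (_ + _).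
rewrite (reindex_inj (mulgI s)) /= -scalerAl -scaleNr mulr_sumr scaler_sumr.
apply: eq_big => [v|v /andP[hv lt]].
  rewrite !permM tpermL tpermR -leqNgt [(v a < v b)%N]ltn_neqAle val_eqE (inj_eq perm_inj) (adj_neq e) /=.
  congr (_ && _); apply/idP/idP => h; last exact: youngM.
  by rewrite -(mulKg s v) youngM ?youngV.
have lt' : (v a < v b)%N.
  move: lt; rewrite !permM tpermL tpermR -leqNgt leq_eqVlt val_eqE (inj_eq perm_inj).
  by rewrite (negPf (adj_neq e)).
have ls := len_left_up e lt'.
have l1 : len s = 1%N by rewrite -[s]mulg1 (len_left_up e) ?len1 // !perm1 e.
rewrite -(T_mul H (u := s)) ?ls ?l1 // -scalerAr scalerA; congr (_ *: _).
by rewrite exprS invrM ?unitrX ?unitrN // mulrC invrN.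
Qed.

Lemma T_yelt kap a b : b = a.+1 :> nat -> rowof kap a = rowof kap b ->
  T (tperm a b) * yelt H kap = - yelt H kap.
Proof.
move=> e er; have [y ->] := yelt_factor e er; rewrite mulrA -mulNr; congr (_ * _).
rewrite mulrBr mulr1 -scalerAr T_down //; last by rewrite tpermV tpermL tpermR e.
rewrite tperm2 hT1 scalerDr !scalerA mulVr // scale1r mulrBr mulVr // mulr1.
by rewrite scalerBl scale1r [in LHS]addrCA opprD addrA subrr add0r.
Qed.

(** Adjacent equal letters are killed by the factor [1 - q^-1 T_s] of [y_kap]; other
    equal letters are moved next to each other, each exchange changing the sign. *)
Lemma basisM_yelt0 lam kap d p k : incr lam d -> (p < k)%N -> rowof kap p = rowof kap k ->
  word lam d p = word lam d k -> mval (basisM H lam d) * yelt H kap = 0.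
Proof.
move En : (k - p)%N => n; elim: n d p En => [|n IH] d p En hd lt er ew.
  by move: lt; rewrite -subn_gt0 En.
have ltb : (p.+1 < r)%N by apply: leq_ltn_trans lt (ltn_ord k).
pose b := Ordinal ltb; have e : b = p.+1 :> nat by [].
have erb : rowof kap p = rowof kap b.
  apply/eqP; rewrite eqn_leq rowof_mono /=; last by rewrite leqnSn.
  by rewrite er rowof_mono.
case: (eqVneq (word lam d p) (word lam d b)) => [eq|ne].
  have [y ->] := yelt_factor e erb; rewrite mulrA mulrBr mulr1 -scalerAr basisM_eq //.
  by rewrite scalerA mulVr // scale1r subrr mul0r.
have nbk : b != k by apply: contra_neq ne => ->.
have ltbk : (b < k)%N by rewrite ltn_neqAle lt andbT val_eqE.
set s := tperm p b; have hd' : incr lam (d *g s) by apply: incr_tperm.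
have swap : mval (basisM H lam (d *g s)) * yelt H kap = - (mval (basisM H lam d) * yelt H kap).
  move: ne; rewrite neq_ltn => /orP[l|l].
    by rewrite basisM_tperm // [mval (ract _ _)]/= -mulrA T_yelt // mulrN.
  have -> : basisM H lam d = ract (basisM H lam (d *g s)) (T s).
    by rewrite -basisM_tperm ?mulK_tperm // !word_tperm tpermL tpermR.
  by rewrite [mval (ract _ _)]/= -mulrA T_yelt // mulrN opprK.
rewrite -[LHS]opprK -swap (IH (d *g s) b) ?oppr0 //.
- by rewrite e subnS En.
- by rewrite -erb.
rewrite !word_tperm tpermR tpermD //.
by rewrite neq_ltn lt.
Qed.

Lemma left_inv_mulr lam h kap : left_inv lam h ->
  h * yelt H kap = \sum_(d in dist lam) cf h d *: (mval (basisM H lam d) * yelt H kap).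
Proof.
move=> hh; rewrite {1}(left_inv_sum hh) mulr_suml.
by apply: eq_bigr => d _; rewrite -scalerAl.
Qed.

Definition zM lam : Mod lam := ract (basisM H lam (wperm lam)) (yelt H (conj_comp lam)).

Section Column.
Variables (lam mu : composition r) (d0 : 'S_r).
Hypotheses (hmu : is_part mu) (hd0 : incr lam d0).
Hypothesis hcol : forall p k, rowof (conj_comp mu) p = rowof (conj_comp mu) k -> (p < k)%N ->
  (word lam d0 p <= colof (conj_comp mu) p)%N.

(** The words with nonzero contribution have distinct letters in each column, and
    since [f] lowers letters, [hcol] bounds them as [column_bound] requires. *)
Lemma column_word_ge nu (f : homW H lam nu) d : incr nu d ->
  cf (hval f (basisM H lam d0)) d != 0 ->
  mval (basisM H nu d) * yelt H (conj_comp mu) != 0 ->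
  forall k, (word mu (wperm mu) k <= word nu d k)%N.
Proof.
move=> hd ne0 ney k; rewrite word_wperm //; move: k; apply: column_bound => p k er.
  move=> ew; case: (ltngtP p k) => [lt|lt|/val_inj //].
    by case/eqP: ney; apply: basisM_yelt0 lt er ew.
  by case/eqP: ney; apply: basisM_yelt0 lt (esym er) (esym ew).
move=> lt; apply: leq_trans (hcol er lt); exact: (hval_basisM_le hd0 ne0).
Qed.

Lemma hval_column_dom nu (f : homW H lam nu) :
  hval f (basisM H lam d0) * yelt H (conj_comp mu) != 0 -> Defs.dom nu mu.
Proof.
move=> ne; apply: contrapT => nd; case/eqP: ne.
rewrite (left_inv_mulr _ (hval_left_inv f _)) big1 // => d /dist_incr hd.
case: (eqVneq (cf (hval f (basisM H lam d0)) d) 0) => [->|n0]; first by rewrite scale0r.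
case: (eqVneq (mval (basisM H nu d) * yelt H (conj_comp mu)) 0) => [->|ny]; first by rewrite scaler0.
by case: nd; apply: dom_word (column_word_ge hd n0 ny).
Qed.

(** A word that is letterwise above the column reading and has the same content is
    the column reading. *)
Lemma hval_column (f : homW H lam mu) :
  hval f (basisM H lam d0) * yelt H (conj_comp mu) =
  cf (hval f (basisM H lam d0)) (wperm mu) *: mval (zM mu).
Proof.
rewrite (left_inv_mulr _ (hval_left_inv f _)) (bigD1 (wperm mu)) /=; last first.
  exact/dist_incr/wperm_incr.
rewrite big1 ?addr0 // => d /andP[/dist_incr hd ne].
case: (eqVneq (cf (hval f (basisM H lam d0)) d) 0) => [->|n0]; first by rewrite scale0r.
case: (eqVneq (mval (basisM H mu d) * yelt H (conj_comp mu)) 0) => [->|ny]; first by rewrite scaler0.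
have ew := word_le_eq (column_word_ge hd n0 ny).
by case/eqP: ne; apply: incr_uniq hd (wperm_incr hmu) _ => k; rewrite ew.
Qed.

End Column.

(** The word of [t^lam w_lam] satisfies the hypothesis of [hval_column_dom], which
    then contradicts [mu] being larger than [lam]. *)
Lemma via_larger_specht lam (e : dual (Mod lam)) h : is_part lam -> via_larger e ->
  mval e (ract (zM lam) h) = 0.
Proof.
move=> hp; move: e; apply: span_closed_ind => [//|c x y hx hy|_ [mu [f [e' [/andP[hs ne] ->]]]]].
  by rewrite (dual_app_linear (ract (zM lam) h) c x y) hx hy scaler0 addr0.
have -> : mval (dual_comp e' f) (ract (zM lam) h) = mval e' (mval (mval f) (ract (zM lam) h)) by [].
suff -> : mval (mval f) (ract (zM lam) h) = 0 by rewrite (linear_fun0 (dual_linear e')).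
apply: mval_inj; rewrite -[LHS]/(hval f _) hval_ract hval_ract.
case: (eqVneq (hval f (basisM H lam (wperm lam)) * yelt H (conj_comp lam)) 0) => [->|n0].
  by rewrite mul0r.
have := hval_column_dom hp (wperm_incr hp) _ n0.
move=> dm; case/eqP: ne; apply: dom_anti => //; apply: dm => p k er lt.
by rewrite word_wperm.
Qed.

(** The lengths add up: the letters of the column reading increase along each row
    of the conjugate, so [(u * wperm lam)^-1] is increasing on these rows. *)
Lemma zM_cf lam w : is_part lam ->
  cf (mval (zM lam)) w = \sum_(v in young (conj_comp lam))
     (- q) ^- len v * (same lam (w *g v^-1) (wperm lam))%:R.
Proof.
move=> hp; rewrite /zM /= mulr_sumr cf_bigsum; apply: eq_bigr => v hv.
rewrite -scalerAr cfZ; congr (_ * _).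
rewrite (xelt_incr H (wperm_incr hp)) mulr_suml cf_bigsum.
under eq_bigr => u hu.
  rewrite T_mul; first rewrite cfT; last first.
    rewrite -lenV invMg (@len_young_incr _ (conj_comp lam)) ?youngV ?lenV 1?addnC //.
    move=> p k er lt; apply: (word_asc (lam := lam)); rewrite !(word_young _ hu) !word_wperm //.
    by rewrite col_ltn.
  over.
rewrite -(cf_basisM H (w *g v^-1%g) (wperm_incr hp)) /basisM [mval _]/= (xelt_incr H (wperm_incr hp)) cf_bigsum.
apply: eq_bigr => u _; rewrite cfT; congr (nat_of_bool _)%:R.
by rewrite -(inj_eq (mulIg v^-1%g)) mulgK.
Qed.

Lemma zM_below lam w : is_part lam -> cf (mval (zM lam)) w != 0 ->
  below (word lam w) (word lam (wperm lam)).
Proof.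
move=> hp; rewrite zM_cf // => ne.
have [v hv /sameP e] : exists2 v, v \in young (conj_comp lam) & same lam (w *g v^-1) (wperm lam).
  apply: contrapT => no; case/eqP: ne; rewrite big1 // => v hv.
  by case: (boolP (same _ _ _)) => [h|_]; [case: no; exists v | rewrite mulr0].
move=> k i; have := below_column hv k i.
rewrite (@eq_ncount _ (word lam (wperm lam)) (colof (conj_comp lam))); last by move=> x; rewrite word_wperm.
rewrite (@eq_ncount _ (word lam w) (fun k => colof (conj_comp lam) (v^-1%g k))) // => x.
by rewrite -word_wperm // -e wordM invgK permKV.
Qed.

Lemma zM_cf_wperm lam : is_part lam -> cf (mval (zM lam)) (wperm lam) = 1.
Proof.
move=> hp; rewrite zM_cf // (bigD1 1%g) ?young1 //= len1 expr0 invr1 mul1r invg1 mulg1.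
rewrite same_refl big1 ?addr0 // => v /andP[/youngP hv n1].
case: sameP => [e|_]; last by rewrite mulr0.
case/eqP: n1; apply/permP => k; rewrite perm1.
apply: (rowcol_inj (lam := conj_comp lam)) => //.
by have := e k; rewrite wordM invgK !word_wperm.
Qed.

(** Start from [z_lam] for the column reading and apply [T_s] along the path of
    [stdp_step]: the support stays below the target by the lifting property, and
    the coefficient at the target is multiplied by [q]. *)
Lemma specht_elt lam d : stdp lam d -> exists h,
  cf (mval (ract (zM lam) h)) d \is a GRing.unit /\
  forall w, cf (mval (ract (zM lam) h)) w != 0 -> below (word lam w) (word lam d).
Proof.
pose B := (r * r)%N.
move En : (B - len d)%N => n; elim/ltn_ind: n d En => n IH d En hd.
have hp : is_part lam by case: hd.
case: (eqVneq d (wperm lam)) => [->|ne].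
  exists 1; rewrite [mval _]/= mulr1 -[_ * _ * _]/(mval (zM lam)) zM_cf_wperm // unitr1.
  by split=> // w; apply: zM_below.
have [a [b [e lt hd']]] := stdp_step hd ne.
have lenB w : (len w <= B)%N.
  by rewrite len_ninv; apply: leq_trans (max_card _) _; rewrite card_prod card_ord.
have [|h [hu hb]] := IH (B - len (d *g tperm a b))%N _ (d *g tperm a b) erefl hd'.
  rewrite -En ltn_sub2l //; last by rewrite (len_up e (word_asc lt)).
  by rewrite -(len_up e (word_asc lt)).
exists (h * T (tperm a b)); rewrite [mval _]/= mulrA -[_ * _ * _ * h]/(mval (ract (zM lam) h)).
set x := mval (ract (zM lam) h) in hu hb *.
have hx : left_inv lam x by apply: permM_left_inv.
split; first by rewrite (cf_mulT_word _ e hx) lt unitrM hq.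
have ltd : (word lam (d *g tperm a b) b < word lam (d *g tperm a b) a)%N.
  by rewrite !word_tperm tpermL tpermR.
have dE (k i : nat) : ncount (word lam (d *g tperm a b) \o tperm a b) k i = ncount (word lam d) k i.
  by apply: eq_ncount => p /=; rewrite word_tperm tpermK.
have case1 w : cf x w != 0 -> below (word lam w) (word lam d).
  by move=> /hb/(below_tperm e ltd)[h1 _] k i; rewrite -dE.
have case2 w : cf x (w *g tperm a b) != 0 -> below (word lam w) (word lam d).
  move=> /hb/(below_tperm e ltd)[_ h2] k i; rewrite -dE.
  by have := h2 k i; rewrite (@eq_ncount _ _ (word lam w)) // => p /=; rewrite word_tperm tpermK.
move=> w; rewrite (cf_mulT_word _ e hx); case: ifP => _.
  by case: (eqVneq (cf x (w *g tperm a b)) 0) => [->|/case2 //]; rewrite mulr0 eqxx.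
case: (eqVneq (cf x w) 0) => [->|/case1 //]; rewrite !mulr0 addr0.
by case: ifP => _; [rewrite eqxx | apply: case2].
Qed.

End Specht.

(** * The dual of a Specht module *)

Section SpechtDual.
Local Open Scope ring_scope.
Variables (R : idomainType) (q : R) (r : nat) (H : heckeAlg q r).
Hypotheses (hq : q \is a GRing.unit) (hr : (0 < r)%N).
Implicit Types (lam mu nu kap : composition r) (w u v d s : 'S_r).
Implicit Types h : H.

Local Notation Mod := (Defs.permM H).
Local Notation ract := (@Defs.ract R q r H _).

Lemma std_span_sum lam (e : dual (Mod lam)) : std_span e ->
  exists c : 'S_r -> R, e = \sum_(d | `[< stdp lam d >]) c d *: cfd H lam d.
Proof.
move: e; apply: span_closed_ind => [|a x y [c ->] [c' ->]|_ [d hd ->]].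
- by exists (fun=> 0); rewrite big1 // => d _; rewrite scale0r.
- exists (fun d => a * c d + c' d); rewrite scaler_sumr -big_split /=.
  by apply: eq_bigr => d _; rewrite scalerA -scalerDl.
- exists (fun d' => (d' == d)%:R); rewrite (bigD1 d) /=; last exact/asboolP.
  by rewrite eqxx scale1r big1 ?addr0 // => d' /andP[_ /negPf ->]; rewrite scale0r.
Qed.

Lemma specht_family lam : exists h : 'S_r -> H,
  (forall d, `[< stdp lam d >] -> cf (mval (ract (zM H lam) (h d))) d \is a GRing.unit) /\
  forall d s, `[< stdp lam d >] -> `[< stdp lam s >] ->
    cf (mval (ract (zM H lam) (h s))) d != 0 ->
    d = s \/ (ncount_sum (size lam) (word lam d) < ncount_sum (size lam) (word lam s))%N.
Proof.
have ex s : exists h, stdp lam s -> cf (mval (ract (zM H lam) h)) s \is a GRing.unit /\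
    forall w, cf (mval (ract (zM H lam) h)) w != 0 -> below (word lam w) (word lam s).
  case: (pselect (stdp lam s)) => [hs|ns]; last by exists 0.
  by have [h hh] := specht_elt H hq hs; exists h.
have [h hh] := choice ex; exists h; split=> [d /asboolP /hh[]//|d s /asboolP hd /asboolP hs].
move=> /((hh s hs).2 d) hb.
have le x p : (word lam x p <= size lam)%N by apply/ltnW/rowof_size.
case: (below_ncount_sum (le d) (le s) hb) => [e|]; [left | by right].
by apply: incr_uniq e; [case: hd | case: hs].
Qed.

Lemma std_span_specht_inj lam (e : dual (Mod lam)) : std_span e ->
  (forall h, mval e (ract (zM H lam) h) = 0) -> e = 0.
Proof.
move=> /std_span_sum[c ->] h0; have [h [hu ht]] := specht_family lam.
have c0 := @triangular_inj R _ _ (fun s => ncount_sum (size lam) (word lam s))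
  (fun d s => cf (mval (ract (zM H lam) (h s))) d) hu ht R^o c.
rewrite big1 // => d hd; rewrite [c d]c0 ?scale0r // => s _.
rewrite -[RHS](h0 (h s)) [RHS]dual_app_sum; apply: eq_bigr => d' _.
exact: mulrC.
Qed.

Lemma specht_setP lam (x : Mod lam) : specht_set x ->
  if is_part lam then exists h, x = ract (zM H lam) h else x = 0.
Proof.
rewrite /specht_set; case: ifP => _ // -[h e].
by exists h; apply: mval_inj; rewrite e.
Qed.

Lemma specht_ract lam (m : specht H lam) : is_part lam ->
  exists h, mval m = ract (zM H lam) h.
Proof.
by move=> hp; have /asboolP/specht_setP := mvalP m; rewrite hp.
Qed.

Lemma specht_mem lam h : is_part lam ->
  ract (zM H lam) h \in in_submod (Submod (@specht_closed R q r H lam)).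
Proof. by move=> hp; apply/asboolP; rewrite /= /specht_set hp; exists h. Qed.

(** By [straightening] a functional is, on the Specht module, a combination of
    standard ones. *)
Lemma specht_sep lam h : is_part lam ->
  (forall d, stdp lam d -> cf (mval (ract (zM H lam) h)) d = 0) ->
  ract (zM H lam) h = 0.
Proof.
move=> hp h0; apply: mval_inj; apply: cf_ext => w.
rewrite -[LHS]/(mval (cfd H lam w) (ract (zM H lam) h)).
have [j Jj [k Kk ->]] := straightening hq hr (cfd H lam w).
rewrite (linear_add (V := R^o) (dual_app_linear _)) via_larger_specht // add0r cf0.
have [c ->] := std_span_sum Kk; rewrite dual_app_sum big1 // => d /asboolP hd.
by rewrite -[mval (cfd H lam d) _]/(cf _ d) h0 // mulr0.
Qed.

(** By [specht_sep] and triangularity the elements of [specht_family] span the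
    Specht module, so it is enough to find a combination of standard functionals
    with prescribed values on them. *)
Lemma specht_dual_surj lam (eta : dual (specht H lam)) :
  exists e : dual (Mod lam), dual_restr e = eta.
Proof.
case: (boolP (is_part lam)) => hp; last first.
  exists 0; apply: mval_inj; apply: functional_extensionality_dep => m.
  have -> : m = 0.
    by apply: mval_inj; have /asboolP/specht_setP := mvalP m; rewrite (negPf hp).
  by rewrite (linear_fun0 (dual_linear eta)) (linear_fun0 (dual_linear (dual_restr 0))).
have [h [hu ht]] := specht_family lam.
pose b s : specht H lam := ModOf (specht_mem (h s) hp).
pose P s := `[< stdp lam s >]; pose M s := ncount_sum (size lam) (word lam s).
pose A d s := cf (mval (ract (zM H lam) (h s))) d.
have [c hc] := @triangular_solve R _ P M A hu ht (fun s => mval eta (b s)).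
pose B := (\max_s M s)%N.
have htT s d : P s -> P d -> A d s != 0 -> s = d \/ (B - M s < B - M d)%N.
  move=> Ps Pd /(ht d s Pd Ps)[->|lt]; [by left | right].
  apply: ltn_sub2l => //; apply: leq_trans lt _; exact: (leq_bigmax (F := M)).
exists (\sum_(d | P d) c d *: cfd H lam d).
apply: mval_inj; apply: functional_extensionality_dep => m.
have [h1 em] := specht_ract m hp.
have [a ha] := @triangular_solve R _ P (fun s => (B - M s)%N) (fun s d => A d s) hu htT
  (fun d => cf (mval (mval m)) d).
have -> : m = \sum_(s | P s) a s *: b s.
  apply: mval_inj; rewrite (linear_combine (@mval_linear _ _ _)).
  pose h2 := h1 - \sum_(s | P s) a s *: h s.
  have e2 : ract (zM H lam) h2 = mval m - \sum_(s | P s) a s *: mval (b s).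
    apply: mval_inj; rewrite [LHS]/= /h2 mulrBr em.
    rewrite mvalB; congr (_ - _).
    rewrite (linear_combine (@mval_linear _ _ _)) mulr_sumr.
    by apply: eq_bigr => s _; rewrite -scalerAr.
  apply/eqP; rewrite -subr_eq0 -e2; apply/eqP/specht_sep => // d hd.
  have Pd : P d by apply/asboolP.
  rewrite e2 mvalB -scaleN1r cfD cfZ mulN1r.
  rewrite (linear_combine (@mval_linear _ _ _)) cf_bigsum.
  under eq_bigr do rewrite cfZ.
  by rewrite (ha d Pd) subrr.
rewrite !(linear_combine (dual_linear _)); apply: eq_bigr => s Ps.
congr (_ *: _); rewrite -hc // -[LHS]/(mval (\sum_(d | P d) c d *: cfd H lam d) (mval (b s))).
by rewrite dual_app_sum.
Qed.

End SpechtDual.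

(** * Tame compositions *)

Section Tame.
Variable r : nat.
Implicit Types (lam mu nu : composition r) (d : 'S_r) (p x : 'I_r).
Local Open Scope nat_scope.

(** Partial sums of partitions are recovered from this convex function of the
    parts, which does not depend on their order. *)
Definition excess (c : nat) (s : seq nat) : nat := \sum_(x <- s) (x - c).

Lemma take_excess c e s : sumn (take e s) <= e * c + excess c s.
Proof.
rewrite /excess; elim: s e => [|x s IH] [|e] //=.
rewrite big_cons mulSn addnACA leq_add ?IH //.
by rewrite -leq_subLR.
Qed.

Lemma take_count_excess c s : sorted geq s ->
  sumn (take (count (ltn c) s) s) = count (ltn c) s * c + excess c s.
Proof.
rewrite /excess; elim: s => [|x s IH] //= hs; first by rewrite big_nil.
rewrite big_cons; case: (ltnP c x) => cx /=.
  rewrite add1n /= IH ?(path_sorted hs) // mulSn addnACA; congr (_ + _).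
  by rewrite subnKC // ltnW.
rewrite (@eq_in_count _ _ pred0) ?count_pred0; last first.
  by move=> y /(sorted_geq_le hs) yx; apply/negbTE; rewrite -leqNgt (leq_trans yx).
rewrite take0 /= mul0n (eqP cx) !add0n big_seq big1 // => y /(sorted_geq_le hs) yx.
by apply/eqP; rewrite subn_eq0 (leq_trans yx).
Qed.

Lemma take_nth_excess e s : sorted geq s ->
  sumn (take e s) = e * nth 0 s e + excess (nth 0 s e) s.
Proof.
rewrite /excess; elim: s e => [|x s IH] e hs; first by rewrite nth_nil muln0 big_nil; case: e.
case: e => [|e] /=.
  rewrite mul0n big_cons subnn big_seq big1 // => y /(sorted_geq_le hs) yx.
  by apply/eqP; rewrite subn_eq0.
rewrite big_cons mulSn addnACA (IH e (path_sorted hs)); congr (_ + _).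
rewrite subnKC //; case: (ltnP e (size s)) => [lt|?]; last by rewrite nth_default.
exact: sorted_geq_le hs (mem_nth 0 lt).
Qed.

Lemma star_part nu : is_part (star nu).
Proof. by apply: sort_sorted => x y; rewrite /geq /= leq_total. Qed.

Lemma excess_star c nu : excess c (star nu) = excess c nu.
Proof.
rewrite /excess /= (perm_big (filter (ltn 0) nu)) ?perm_sort //= big_filter big_mkcond.
by apply: eq_bigr => -[|x] _.
Qed.

Lemma excess_part c nu N : size nu <= N -> excess c nu = \sum_(i < N) (part nu i - c).
Proof.
move=> le; rewrite /excess (big_nth 0) big_mkord.
rewrite (big_ord_widen _ (fun i => nth 0 nu i - c) le) big_mkcond; apply: eq_bigr => i _.
by case: ltnP => // sz; rewrite /part nth_default.
Qed.

Lemma dom_excess lam mu c : is_part lam -> Defs.dom lam mu -> excess c lam <= excess c mu.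
Proof.
move=> hp /asboolP/(_ (count (ltn c) lam)); rewrite !psumE take_count_excess // => le.
by rewrite -(leq_add2l (count (ltn c) lam * c)) (leq_trans le) // take_excess.
Qed.

Lemma dom_star nu : Defs.dom nu (star nu).
Proof.
apply/asboolP => e; rewrite !psumE (take_nth_excess e (star_part nu)) excess_star.
exact: take_excess.
Qed.

(** The new composition lies above the old one, hence so does its rearrangement;
    but the excess over the smaller of the two parts drops, so that the
    rearrangement does not dominate the old one. *)
Lemma not_quasi nu nu' k b : k < b ->
  part nu' k = (part nu k).+1 -> part nu b = (part nu' b).+1 ->
  (forall i, i != k -> i != b -> part nu' i = part nu i) ->
  part nu k + 2 <= part nu b -> Defs.dom nu nu' -> ~ quasi_partition nu.
Proof.
move=> kb ek eb eo gap dn [_ _ /(_ (star nu') (star_part nu') (dom_trans dn (dom_star nu')))].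
move/(dom_excess (part nu' b) (star_part nu)); rewrite !excess_star leqNgt => /negP; apply.
pose N := maxn b.+1 (maxn (size nu) (size nu')).
have hb : b < N by rewrite leq_maxl.
have hk : k < N by apply: ltn_trans hb.
rewrite (@excess_part _ nu N) ?leq_max ?leqnn ?orbT // (@excess_part _ nu' N) ?leq_max ?leqnn ?orbT //.
rewrite (bigD1 (Ordinal hb)) // [X in _ < X](bigD1 (Ordinal hb)) //=.
rewrite subnn eb subSn // subnn add0n add1n ltnS; apply: leq_sum => i ib.
case: (eqVneq (i : nat) k) => [->|ik]; last by rewrite eo.
rewrite ek; have -> : (part nu k).+1 - part nu' b = 0; last by [].
by apply/eqP; rewrite subn_eq0; move: gap; rewrite eb addn2 ltnS.
Qed.

(** Otherwise all entries of row [i] from that place on exceed [i]. Lowering them to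
    [i.+1] and all other entries to their row index gives a composition above
    [lam], in which part [i.+1] exceeds part [i] by at least 2, contrary to
    [not_quasi]. *)
Lemma tame_wedge lam mu d p : 0 < r -> tame lam -> is_part mu -> d \in dist2w mu lam ->
  colof mu p < part mu (rowof mu p).+1 -> rowof lam (d p) = rowof mu p.
Proof.
move=> hr ht hp /dist2wP[/dist2P[hd _] wd] hcol; set i := rowof mu p.
have wd' x : rowof mu x <= rowof lam (d x) by have := wd (d x); rewrite /word permK.
apply/eqP; rewrite eqn_leq wd' andbT leqNgt; apply/negP => lt.
pose G x := if (rowof mu x == i) && (p <= x) then i.+1 else rowof mu x.
pose G' x := if x == p then i else G x.
have Gle x : G x <= rowof lam (d x).
  rewrite /G; case: ifP => [/andP[/eqP ex px]|_]; last exact: wd'.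
  apply: leq_trans lt _; apply: rowof_mono; move: px; rewrite leq_eqVlt.
  by case/orP => [/eqP/val_inj -> //|l]; apply/ltnW/hd.
have [nu hnu] := content_ex G hr; have [nu' hnu'] := content_ex G' hr.
have dl : Defs.dom lam nu.
  apply/asboolP => e; rewrite (psum_content hnu) -card_rowof_lt.
  rewrite -(card_imset [set x | G x < e] (@perm_inj _ d)).
  apply/subset_leq_card/fintype.subsetP => y; rewrite inE => hy.
  apply/imsetP; exists (d^-1%g y); last by rewrite permKV.
  by rewrite inE (leq_ltn_trans (Gle _)) // permKV.
have Gp : G p = i.+1 by rewrite /G eqxx leqnn.
have G'le x : G' x <= G x by rewrite /G'; case: eqP => [->|//]; rewrite Gp.
have dn : Defs.dom nu nu'.
  apply/asboolP => e; rewrite (psum_content hnu) (psum_content hnu').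
  apply/subset_leq_card/fintype.subsetP => x; rewrite !inE; exact: leq_ltn_trans.
have /andP[b1 b2] := rowof_bounds mu p.
have nui : part nu i = colof mu p.
  rewrite hnu -[RHS]/(p - psum mu i) -row_segment ?b1 ?(ltnW b2) //.
  congr #|pred_of_set _|; apply/setP => x; rewrite !inE /G ltnNge.
  case: (eqVneq (rowof mu x) i) => [ex|/negPf ne] /=; last by rewrite ne.
  by case: leqP => _; rewrite ?ex ?eqxx // gtn_eqF.
have gap : part nu i + 2 <= part nu i.+1.
  rewrite nui addn2 hnu.
  apply: leq_ltn_trans hcol _; rewrite -card_rowof.
  apply: proper_card; apply/properP; split.
    apply/fintype.subsetP => x; rewrite !inE /G => /eqP ex.
    by rewrite ex (gtn_eqF (ltnSn i)) /=.
  by exists p; rewrite !inE ?Gp ?eqxx // ltn_eqF.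
have cardG' e : part nu' e + (i.+1 == e) = part nu e + (i == e).
  rewrite hnu hnu' (cardsD1 p) [in RHS](cardsD1 p) !inE Gp /G' eqxx.
  rewrite [LHS]addnC -[RHS]addnA; congr (_ + _); rewrite addnC; congr (_ + _).
  by congr #|pred_of_set _|; apply/setP => x; rewrite !inE; case: (x == p).
apply: (@not_quasi nu nu' i i.+1) => //; last exact: ht.
- by have := cardG' i; rewrite eqxx gtn_eqF // addn0 addn1.
- by have := cardG' i.+1; rewrite eqxx ltn_eqF // addn0 addn1 => ->.
- move=> e n1 n2; have := cardG' e.
  by rewrite ![_ == e]eq_sym (negPf n1) (negPf n2) !addn0.
Qed.

End Tame.

(** * Independence of the composites with standard functionals *)

Section DominanceWeight.
Variable r : nat.
Implicit Types (lam mu nu : composition r).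
Local Open Scope nat_scope.

(** A measure that is strictly monotone for dominance above [lam]. *)
Definition dweight lam mu : nat := \sum_(e < size lam) psum mu e.

Lemma dweight_lt lam mu nu : Defs.dom lam mu -> sdom mu nu ->
  dweight lam mu < dweight lam nu.
Proof.
move=> lm /andP[mn ne]; have ln := dom_trans lm mn; have /asboolP h := mn.
rewrite ltn_neqAle leq_sum ?andbT //.
apply: contra_neqN ne => /eqP e; apply: dom_anti => //; apply/asboolP => j.
case: (ltnP j (size lam)) => [lt|le]; last first.
  by rewrite !psum_size // (leq_trans _ le) // dom_size.
rewrite leqNgt; apply/negP => l; move/eqP: e; rewrite eqn_leq => /andP[_].
rewrite leqNgt => /negP; apply; rewrite /dweight (bigD1 (Ordinal lt)) //=.
by rewrite [X in _ < X](bigD1 (Ordinal lt)) //= -addSn leq_add // leq_sum.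
Qed.

End DominanceWeight.

Section JointStatistic.
Local Open Scope ring_scope.
Variables (R : idomainType) (q : R) (r : nat) (H : heckeAlg q r).
Hypotheses (hq : q \is a GRing.unit) (hr : (0 < r)%N).
Implicit Types (lam mu nu kap : composition r) (w u v d e s : 'S_r) (a b p k : 'I_r).
Implicit Types (h : H) (f g : 'I_r -> nat).

Local Notation Mod := (Defs.permM H).
Local Notation ract := (@Defs.ract R q r H _).
Local Notation "u *g v" := (u * v)%g (at level 40, left associativity).

Section FixedD.
Variables (lam mu : composition r) (d : 'S_r).

(** In terms of generalized tableaux: [(g, f)] has the same joint content as the pair
    of words that defines the double coset of [d]. *)
Definition joint g f : Prop :=
  exists s : 'S_r, forall k, g k = word mu d (s k) /\ f k = rowof lam (s k).

Definition jsum g f : nat := \sum_k g k * f k.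

Definition jsum0 : nat := \sum_k word mu d k * rowof lam k.

Lemma eq_joint g g' f f' : g =1 g' -> f =1 f' -> joint g f -> joint g' f'.
Proof. by move=> eg ef [s h]; exists s => k; rewrite -eg -ef. Qed.

Lemma eq_jsum g g' f f' : g =1 g' -> f =1 f' -> jsum g f = jsum g' f'.
Proof. by move=> eg ef; apply: eq_bigr => k _; rewrite eg ef. Qed.

Lemma joint_jsum g f : joint g f -> jsum g f = jsum0.
Proof.
case=> s h; rewrite /jsum0 (reindex_inj (@perm_inj _ s)).
by apply: eq_bigr => k _; have [-> ->] := h k.
Qed.

Lemma joint_tperm g f a b : joint g f -> joint (g \o tperm a b) (f \o tperm a b).
Proof. by case=> s h; exists (tperm a b *g s) => k; rewrite permM /=; apply: h. Qed.

Lemma jsum_tperm g f a b : jsum (g \o tperm a b) (f \o tperm a b) = jsum g f.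
Proof. by rewrite [RHS](reindex_inj (@perm_inj _ (tperm a b))). Qed.

Lemma jsum_exchange g f a b : (g b < g a)%N -> (f a < f b)%N ->
  (jsum g f < jsum g (f \o tperm a b))%N.
Proof.
move=> lg lf; have ab : a != b by apply: contraTneq lf => ->; rewrite ltnn.
rewrite /jsum (bigD1 a) // (bigD1 b) 1?eq_sym //= [X in (_ < X)%N](bigD1 a) //.
rewrite [X in (_ < _ + X)%N](bigD1 b) 1?eq_sym //= tpermL tpermR !addnA.
rewrite [X in (_ < _ + X)%N](eq_bigr (fun k => g k * f k)%N); last first.
  by move=> k /andP[ka kb]; rewrite tpermD // eq_sym.
by rewrite ltn_add2r; nia.
Qed.


(** When [T_s] keeps a term without exchanging its letters, larger letters of [f]
    get paired with larger letters of [g], which increases the statistic. *)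
Lemma phi_joint e w : d \in dist2w mu lam -> incr lam e ->
  let c := cf (hval (phiW H mu lam d) (basisM H lam e)) w in
  (joint (word mu w) (word lam e) -> c \is a GRing.unit) /\
  (c != 0 -> joint (word mu w) (word lam e) \/ (jsum0 < jsum (word mu w) (word lam e))%N).
Proof.
move=> hd he; move: e he w; apply: incr_ind => [w|e a b ab he lt IH w] c.
  rewrite /c basisM1 /hval phiWE // phi_gen cf_dcosetT; split=> [[s hs]|].
    suff -> : w \in (young mu :* d * young lam)%g by apply: unitr1.
    have ys : s \in young lam by apply/youngP => p; rewrite -(hs p).2 word1.
    have : word mu w =1 word mu (d *g s^-1) by move=> k; rewrite (hs k).1 wordM invgK.
    move/mem_rcoset_word => /rcosetP[u hu ->]; apply/mem_dcosetP.
    by exists u, (s^-1)%g; rewrite youngV // mulgA.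
  case: (boolP (w \in _)) => [/mem_dcosetP[u [v [hu hv ->]]] _|]; last by rewrite eqxx.
  left; exists (v^-1)%g => k; rewrite -mulgA word_young // wordM word1.
  by have /youngP -> := youngV hv.
set s := tperm a b in c *; set g := word mu w; set f := word lam e.
have ef : word lam (e *g s) =1 f \o s by move=> k; rewrite word_tperm.
have eg : word mu (w *g s) =1 g \o s by move=> k; rewrite word_tperm.
have sK (x : 'I_r -> nat) : (x \o s) \o s =1 x by move=> k /=; rewrite tpermK.
have jE : joint (word mu w) (word lam (e *g s)) <-> joint (word mu (w *g s)) f.
  split=> j; apply: eq_joint (joint_tperm a b j) => k /=.
  - by rewrite eg.
  - by rewrite ef /= tpermK.
  - by rewrite eg /= tpermK.
  - by rewrite ef.
have sE : jsum (word mu w) (word lam (e *g s)) = jsum (word mu (w *g s)) f.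
  by rewrite -(jsum_tperm _ _ a b); apply: eq_jsum => k; rewrite ?eg //= ef /= tpermK.
have [u1 n1] := IH (w *g s); have [u2 n2] := IH w.
set h := hval _ (basisM H lam e) in u1 n1 u2 n2.
have cE : c = if (g a < g b)%N then q * cf h (w *g s)
    else if g a == g b then q * cf h w else cf h (w *g s) + (q - 1) * cf h w.
  by rewrite /c basisM_tperm // hval_ract (cf_mulT_word _ ab (hval_left_inv _ _)).
have eqw : g a = g b -> cf h (w *g s) = cf h w.
  move=> egab; apply: (hval_left_inv (phiW H mu lam d) (basisM H lam e)) => k.
  by rewrite word_tperm; case: tpermP => // ->.
(* When the letters of w decrease, the term of w itself has a smaller statistic. *)
have big : (g b < g a)%N -> cf h w != 0 -> (jsum0 < jsum (word mu w) (word lam (e *g s)))%N.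
  move=> gt /n2 lo; have := jsum_exchange gt lt.
  rewrite (eq_jsum (frefl g) (fun k => esym (ef k))); apply: leq_ltn_trans.
  by case: lo => [/joint_jsum ->|/ltnW].
rewrite jE sE in big *; rewrite cE; case: (ltngtP (g a) (g b)) => [ga|ga|ga].
- split=> [/u1 hu|]; first by rewrite unitrM hq.
  by case: (eqVneq (cf h (w *g s)) 0) => [->|/n1 //]; rewrite mulr0 eqxx.
- split=> [j|].
    case: (eqVneq (cf h w) 0) => [->|/(big ga)]; first by rewrite mulr0 addr0; apply: u1.
    by rewrite (joint_jsum j) ltnn.
  case: (eqVneq (cf h w) 0) => [->|/(big ga)]; last by right.
  by rewrite mulr0 addr0.
- rewrite -eqw //; split=> [/u1 hu|]; first by rewrite unitrM hq.
  by case: (eqVneq (cf h (w *g s)) 0) => [->|/n1 //]; rewrite mulr0 eqxx.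
Qed.

End FixedD.

Section ColumnReading.
Variables (lam mu : composition r).
Hypotheses (ht : tame lam) (hp : is_part mu).

Lemma reading_ex d : exists2 e, incr lam e &
  word lam e =1 (fun k => rowof lam (d ((wperm mu)^-1%g k))).
Proof.
have [e he hw] := incr_ex lam (d^-1 *g wperm mu); exists e => // k.
by rewrite hw wordM /word invgK.
Qed.

(** The word [f_d], given by the entries of the tableau of [d] read along the columns. *)
Definition reading d : 'S_r := s2val (cid2 (reading_ex d)).

Lemma reading_incr d : incr lam (reading d).
Proof. exact: (s2valP (cid2 (reading_ex d))). Qed.

Lemma word_reading d : word lam (reading d) =1 (fun k => rowof lam (d ((wperm mu)^-1%g k))).
Proof. exact: (s2valP' (cid2 (reading_ex d))). Qed.

Definition reading_coef d d0 : R :=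
  cf (hval (phiW H mu lam d) (basisM H lam (reading d0))) (wperm mu).

Lemma reading_joint d d0 : d \in dist2w mu lam -> d0 \in dist2w mu lam ->
  joint lam mu d (word mu (wperm mu)) (word lam (reading d0)) <-> d = d0.
Proof.
move=> /dist2wP[hd _] /dist2wP[hd0 _]; split=> [[s hs]|->]; last first.
  exists ((wperm mu)^-1 *g d0) => k; rewrite word_reading permM; split=> //.
  by rewrite /word permK.
apply: (dist2_uniq hd hd0); apply/mem_dcosetP.
pose u := (wperm mu *g s *g d^-1)%g.
have hu : u \in young mu.
  apply/youngP => x; rewrite !permM; have [+ _] := hs (wperm mu x).
  by rewrite /word permK => ->.
have hv : ((d0^-1 *g u) *g d)%g \in young lam.
  apply/youngP => y; rewrite !permM permKV; have [_ +] := hs (wperm mu (d0^-1%g y)).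
  by rewrite word_reading permK permKV => ->.
exists u, ((d0^-1 *g u) *g d)^-1%g; rewrite youngV //; split=> //.
by apply: (mulIg ((d0^-1 *g u) *g d)%g); rewrite mulgKV -!mulgA mulKVg.
Qed.

Lemma reading_jsum d0 :
  jsum (word mu (wperm mu)) (word lam (reading d0)) = jsum0 lam mu d0.
Proof.
rewrite /jsum0 (reindex_inj (@perm_inj _ ((wperm mu)^-1 *g d0)))%g.
by apply: eq_bigr => k _; rewrite word_reading permM /word permK.
Qed.

Lemma reading_unit d : d \in dist2w mu lam -> reading_coef d d \is a GRing.unit.
Proof.
by move=> hd; apply: (phi_joint _ hd (reading_incr d)).1; apply/reading_joint.
Qed.

Lemma reading_tri d d0 : d \in dist2w mu lam -> d0 \in dist2w mu lam ->
  reading_coef d d0 != 0 -> d = d0 \/ (jsum0 lam mu d < jsum0 lam mu d0)%N.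
Proof.
move=> hd hd0 /((phi_joint _ hd (reading_incr d0)).2)[/(reading_joint hd hd0)|]; first by left.
by rewrite reading_jsum; right.
Qed.

(** Within a column all boxes but the last have a box below, so [tame_wedge]
    determines their entries. *)
Lemma reading_column d : d \in dist2w mu lam -> forall p k,
  rowof (conj_comp mu) p = rowof (conj_comp mu) k -> (p < k)%N ->
  (word lam (reading d) p <= colof (conj_comp mu) p)%N.
Proof.
move=> hd p k er lt; rewrite word_reading.
have [ep1 ep2] := wperm_spec ((wperm mu)^-1%g p) hp.
have [ek1 ek2] := wperm_spec ((wperm mu)^-1%g k) hp.
rewrite !permKV in ep1 ep2 ek1 ek2.
rewrite (tame_wedge hr ht hp hd) ?ep2 // -ep1 er ek1.
apply: leq_trans (colof_lt _ _) (part_mono hp _).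
by rewrite -ek2 -ep2 col_ltn.
Qed.

End ColumnReading.

(** A minimal [mu] in a relation is tested on [f_d y_(mu') h]: larger targets vanish
    by [hval_column_dom], and for [mu] itself the value is that of a combination of
    standard functionals on [z_mu h], with coefficients triangular by
    [reading_tri]. *)
Lemma standard_phi_inj lam (I : finType) (c : I -> composition r)
    (y : forall i, 'S_r -> dual (Mod (c i))) :
  tame lam -> injective c -> (forall i, sdom lam (c i)) ->
  (forall i d, d \in dist2w (c i) lam -> std_span (y i d)) ->
  (forall m : Mod lam, \sum_i \sum_(d in dist2w (c i) lam)
     (mval (y i d) (mval (mval (phiW H (c i) lam d)) m) : R) = 0) ->
  forall i d, d \in dist2w (c i) lam -> y i d = 0.
Proof.
move=> ht cI hc hK hsum i.
move En : (dweight lam (c i)) => n; elim/ltn_ind: n i En => n IH i En.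
have IHi j d : sdom (c j) (c i) -> d \in dist2w (c j) lam -> y j d = 0.
  move=> ji; apply: (IH (dweight lam (c j))) => //; rewrite -En.
  by apply: dweight_lt ji; case/andP: (hc j).
case: (boolP (is_part (c i))) => hp; last first.
  move=> d /(hK i d)/std_span_sum[x ->]; rewrite big1 // => d' /asboolP[hp'].
  by rewrite hp' in hp.
apply: (@triangular_inj _ _ (fun d => d \in dist2w (c i) lam) (jsum0 lam (c i))
  (reading_coef lam (c i))); [exact: reading_unit | exact: reading_tri|].
move=> d0 hd0; apply: (std_span_specht_inj hq).
  by apply: span_sum => d hd; apply: hK.
move=> h; rewrite dual_app_sum.
have hcol := reading_column ht hp hd0.
pose m := ract (ract (basisM H lam (reading lam (c i) d0)) (yelt H (conj_comp (c i)))) h.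
have appE j d : mval (mval (mval (phiW H (c j) lam d)) m) =
    hval (phiW H (c j) lam d) (basisM H lam (reading lam (c i) d0)) * yelt H (conj_comp (c i)) * h.
  by rewrite -[LHS]/(hval _ m) /m hval_ract hval_ract.
rewrite -[RHS](hsum m) (bigD1 i) //= [X in _ + X]big1 ?addr0; last first.
  move=> j ji; rewrite big1 // => d hd.
  case: (eqVneq (hval (phiW H (c j) lam d) (basisM H lam (reading lam (c i) d0)) *
      yelt H (conj_comp (c i))) 0) => [e0|n0].
    have -> : mval (mval (phiW H (c j) lam d)) m = 0.
      by apply: mval_inj; rewrite appE e0 mul0r.
    exact: linear_fun0 (dual_linear _).
  have dj := hval_column_dom hq hp (@reading_incr lam (c i) d0) hcol n0.
  by rewrite IHi // /sdom dj /=; apply: contra_neq ji => /cI.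
apply: eq_bigr => d hd.
have -> : mval (mval (phiW H (c i) lam d)) m =
    reading_coef lam (c i) d d0 *: ract (zM H (c i)) h.
  apply: mval_inj; rewrite appE (hval_column hq hp (@reading_incr lam (c i) d0) hcol).
  by rewrite -scalerAl.
by rewrite (linear_scale (dual_linear _)).
Qed.

End JointStatistic.

(** * The chain complex by first steps *)

Section TensorFacts.
Local Open Scope ring_scope.
Variables (R : comNzRingType).

Lemma tensor_ind (U V : lmodType R) (P : tensor U V -> Prop) :
  P 0 -> (forall x y, P x -> P y -> P (x + y)) -> (forall u v, P (pure u v)) ->
  forall x, P x.
Proof.
move=> P0 PD Pp x; rewrite -[x]tclassK tclassE.
by apply: (big_ind P) => // p _; apply: Pp.
Qed.

Lemma pure_linear_r (U V : lmodType R) (u : U) : linear (fun v : V => pure u v).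
Proof. exact: (pure_bilinear U V).1. Qed.

Lemma pure_linear_l (U V : lmodType R) (v : V) : linear (fun u : U => pure u v).
Proof. exact: (pure_bilinear U V).2. Qed.

Lemma tlift_lin_fun (U V Z : lmodType R) (F F1 F2 : U -> V -> Z) (c : R) x :
  (forall u v, F u v = c *: F1 u v + F2 u v) ->
  tlift F x = c *: tlift F1 x + tlift F2 x.
Proof.
move=> h; rewrite /tlift scaler_sumr -big_split /=.
by apply: eq_bigr => p _.
Qed.

End TensorFacts.

Section DirectSumFacts.
Local Open Scope ring_scope.
Variables (R : comNzRingType) (I : finType) (V : I -> lmodType R).

Lemma dsum_ext (x y : dsum V) : (forall i, x i = y i) -> x = y.
Proof. exact: functional_extensionality_dep. Qed.

Lemma dsumL (c : R) (x y : dsum V) i : (c *: x + y) i = c *: x i + y i.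
Proof. by []. Qed.

Lemma dsum_app_linear i : linear (fun x : dsum V => x i).
Proof. by []. Qed.

Lemma dinj_in i (v : V i) : dinj v i = v.
Proof. by rewrite /dinj dfwith_in. Qed.

Lemma dinj_out i (v : V i) j : i != j -> dinj v j = 0.
Proof. by move=> ne; rewrite /dinj dfwith_out. Qed.

Lemma dinj_linear i : linear (@dinj R I V i).
Proof.
move=> c x y; apply: dsum_ext => j; rewrite dsumL.
case: (eqVneq i j) => [e|ne]; last by rewrite !dinj_out // scaler0 addr0.
by case: _ / e; rewrite !dinj_in.
Qed.

Lemma dsum_dinj (x : dsum V) : x = \sum_i dinj (x i).
Proof.
apply: dsum_ext => j; rewrite (linear_sum_fun (@dsum_app_linear j)).
rewrite (bigD1 j) //= dinj_in big1 ?addr0 // => i ne.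
by rewrite dinj_out.
Qed.

End DirectSumFacts.

Section Complex.
Local Open Scope ring_scope.
Local Open Scope classical_set_scope.
Variables (R : idomainType) (q : R) (r : nat) (H : heckeAlg q r).
Implicit Types (lam mu nu : composition r) (d : 'S_r) (n : nat).

Local Notation Mod := (Defs.permM H).
Local Notation C := (@Cmod R q r H).
Local Notation Mc := (@Mchain R q r H).

Lemma chain_cons_subproof lam mu n (h : chain mu n) : sdom lam mu ->
  (size (mu :: cseqs h) == n.+1)%N && path (@sdom r) lam (mu :: cseqs h).
Proof. by case: h => s /= /andP[/eqP -> ->] ->; rewrite eqxx. Qed.

Definition chain_cons lam mu n (hs : sdom lam mu) (h : chain mu n) : chain lam n.+1 :=
  Chain (chain_cons_subproof h hs).

Lemma rebase_subproof lam mu n (h : chain mu n) : sdom lam mu ->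
  (size (cseqs h) == n)%N && path (@sdom r) lam (cseqs h).
Proof.
case: h => -[|nu s] /= /andP[-> p] hs //=; move: p => /andP[h ->].
by rewrite (sdom_trans hs h).
Qed.

Definition rebase lam mu n (hs : sdom lam mu) (h : chain mu n) : chain lam n :=
  Chain (rebase_subproof h hs).

Lemma chain_cons_ind lam n (P : chain lam n.+1 -> Prop) :
  (forall mu (hs : sdom lam mu) h, P (chain_cons hs h)) -> forall g, P g.
Proof.
move=> h [[|mu s] p] //; have := p => /=; rewrite eqSS => /and3P[sz hs pa].
have p' : (size s == n)%N && path (@sdom r) mu s by rewrite sz.
have -> : Chain p = chain_cons hs (Chain p') by apply: val_inj.
exact: h.
Qed.

Lemma chain_cons_inj lam mu n (hs hs' : sdom lam mu) (h h' : chain mu n) :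
  chain_cons hs h = chain_cons hs' h' -> h = h'.
Proof. by move=> e; apply: val_inj; have [] := congr1 val e. Qed.

(** Proof irrelevance for the indices of the summands: two ways of building a chain
    give convertible lists but different proofs that these are chains. *)
Lemma dinj_irr lam n s (p p' : (size s == n)%N && path (@sdom r) lam s) (v : Mc lam s) :
  dinj (V := fun h : chain lam n => Mc lam h) (i := Chain p) v =
  dinj (V := fun h : chain lam n => Mc lam h) (i := Chain p') v.
Proof. by rewrite (bool_irrelevance p p'). Qed.

Notation inj g v := (dinj (V := fun h : chain _ _ => Mc _ h) (i := g) v).

(** The face map merging the first two factors, as a function of both
    ([face0_pure]). *)
Definition compM lam mu (f : homW H lam mu) (s : seq (composition r)) : Mc mu s -> Mc lam s :=
  match s return Mc mu s -> Mc lam s with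
  | [::] => fun e => dual_comp (e : dual (Mod mu)) f
  | nu :: s' => tlift (fun (g : homW H mu nu) (z : Mc nu s') =>
                         pure (homW_comp g f) z : Mc lam (nu :: s'))
  end.

Lemma compM_cons_bilinear lam mu nu (f : homW H lam mu) s' :
  bilinear_map (fun (g : homW H mu nu) (z : Mc nu s') =>
    pure (homW_comp g f) z : Mc lam (nu :: s')).
Proof.
split=> [g|z] c x y; first by rewrite pure_linear_r.
by rewrite (homW_comp_bilinear H lam mu nu).1 pure_linear_l.
Qed.

Lemma compM_pure lam mu nu (f : homW H lam mu) s' (g : homW H mu nu) (z : Mc nu s') :
  compM f (s := nu :: s') (pure g z) = pure (homW_comp g f) z.
Proof. by rewrite /compM tlift_pure //; apply: compM_cons_bilinear. Qed.

Lemma dual_comp_app lam mu (f : homW H lam mu) (e : dual (Mod mu)) m :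
  mval (dual_comp e f) m = mval e (mval (mval f) m).
Proof. by []. Qed.

Lemma dual_comp_bilinear lam mu :
  bilinear_map (fun (f : homW H lam mu) (e : dual (Mod mu)) => dual_comp e f).
Proof.
split=> [f|e] c x y; apply: mval_inj; apply: functional_extensionality_dep => m.
  exact: (dual_app_linear (mval (mval f) m) c x y).
apply: etrans (esym (dual_app_linear m c (dual_comp e x) (dual_comp e y))).
by rewrite !dual_comp_app homW_app_linear (dual_linear e).
Qed.

Lemma compM_bilinear lam mu s :
  bilinear_map (fun (f : homW H lam mu) (x : Mc mu s) => compM f x).
Proof.
case: s => [|nu s']; first exact: dual_comp_bilinear.
split=> [f|x] c y z.
  exact: (tlift_linear (@compM_cons_bilinear lam mu nu f s') c y z).
rewrite /compM; apply: tlift_lin_fun => g v.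
by rewrite (homW_comp_bilinear H lam mu nu).2 pure_linear_l.
Qed.

Lemma face0E lam mu s (x : Mc lam (mu :: s)) :
  face (s := mu :: s) 0 x = tlift (fun (f : homW H lam mu) (y : Mc mu s) => compM f y) x.
Proof. by case: s x. Qed.

Lemma face0_pure lam mu s (f : homW H lam mu) (y : Mc mu s) :
  face (s := mu :: s) 0 (pure f y : Mc lam (mu :: s)) = compM f y.
Proof. by rewrite face0E tlift_pure //; apply: compM_bilinear. Qed.

Lemma face_linear lam s i : linear (@face R q r H lam s i).
Proof.
elim: s lam i => [|mu s IH] lam [|i] //.
  move=> c x y; rewrite !face0E; exact: (tlift_linear (@compM_bilinear lam mu s)).
move=> c x y; rewrite /= ; apply: tlift_linear; split=> [f|z] a u v.
  by rewrite IH pure_linear_r.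
by rewrite pure_linear_l.
Qed.

Lemma faceS_pure lam mu s i (f : homW H lam mu) (y : Mc mu s) :
  face (s := mu :: s) i.+1 (pure f y : Mc lam (mu :: s)) = pure f (face i y).
Proof.
rewrite /= tlift_pure //; split=> [g|z] a u v.
  by rewrite face_linear pure_linear_r.
by rewrite pure_linear_l.
Qed.

Lemma Cdiff_linear lam n : linear (@Cdiff R q r H lam n).
Proof.
move=> c x y; rewrite /Cdiff scaler_sumr -big_split; apply: eq_bigr => g _.
rewrite scaler_sumr -big_split; apply: eq_bigr => i _.
rewrite dsumL face_linear dinj_linear scalerDr !scalerA.
by rewrite [c * _]mulrC.
Qed.

Lemma Cdiff_inj lam n (g : chain lam n.+1) (v : Mc lam g) :
  Cdiff (inj g v) = \sum_(i < n.+1) (-1) ^+ i *: inj (chain_del g i) (face i v).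
Proof.
rewrite /Cdiff (bigD1 g) //= [X in _ + X]big1 ?addr0 => [|g' ne].
  by apply: eq_bigr => i _; rewrite dinj_in.
rewrite big1 // => i _; rewrite dinj_out 1?eq_sym //.
by rewrite (linear_fun0 (@face_linear _ _ _)) (linear_fun0 (@dinj_linear _ _ _ _)) scaler0.
Qed.

(** The embedding of [Hom^wedge (x) C_n^mu] as the chains through [mu] first. *)
Definition prep lam mu n (hs : sdom lam mu) (f : homW H lam mu) (y : C mu n) : C lam n.+1 :=
  \sum_(h : chain mu n) inj (chain_cons hs h) (pure f (y h)).

Definition compC lam mu n (hs : sdom lam mu) (f : homW H lam mu) (y : C mu n) : C lam n :=
  \sum_(h : chain mu n) inj (rebase hs h) (compM f (y h)).


Lemma prep_linear lam mu n hs f : linear (@prep lam mu n hs f).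
Proof.
move=> c x y; rewrite /prep scaler_sumr -big_split; apply: eq_bigr => h _.
by rewrite dsumL pure_linear_r dinj_linear.
Qed.

Lemma prep_linear_hom lam mu n (hs : sdom lam mu) (y : C mu n) :
  linear (fun f : homW H lam mu => prep hs f y).
Proof.
move=> c f g; rewrite /prep scaler_sumr -big_split; apply: eq_bigr => h _.
by rewrite pure_linear_l dinj_linear.
Qed.

Lemma compC_linear lam mu n hs f : linear (@compC lam mu n hs f).
Proof.
move=> c x y; rewrite /compC scaler_sumr -big_split; apply: eq_bigr => h _.
by rewrite dsumL (compM_bilinear lam mu h).1 dinj_linear.
Qed.

Lemma prep_inj lam mu n (hs : sdom lam mu) f (h : chain mu n) (v : Mc mu h) :
  prep hs f (inj h v) = inj (chain_cons hs h) (pure f v).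
Proof.
rewrite /prep (bigD1 h) //= dinj_in big1 ?addr0 // => h' ne.
rewrite dinj_out 1?eq_sym // (linear_fun0 (pure_linear_r f)).
exact: (linear_fun0 (@dinj_linear _ _ _ _)).
Qed.

Lemma compC_inj lam mu n (hs : sdom lam mu) f (h : chain mu n) (v : Mc mu h) :
  compC hs f (inj h v) = inj (rebase hs h) (compM f v).
Proof.
rewrite /compC (bigD1 h) //= dinj_in big1 ?addr0 // => h' ne.
rewrite dinj_out 1?eq_sym // (linear_fun0 ((compM_bilinear lam mu h').1 f)).
exact: (linear_fun0 (@dinj_linear _ _ _ _)).
Qed.

Lemma Cmod_inj_ind mu n (P : C mu n -> Prop) :
  P 0 -> (forall x y, P x -> P y -> P (x + y)) ->
  (forall h v, P (inj h v)) -> forall x, P x.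
Proof.
by move=> P0 PD Pi x; rewrite (dsum_dinj x); apply: (big_ind P) => // h _.
Qed.

Lemma Cmod_ind lam n (P : C lam n.+1 -> Prop) :
  P 0 -> (forall x y, P x -> P y -> P (x + y)) ->
  (forall mu (hs : sdom lam mu) f (y : C mu n), P (prep hs f y)) -> forall x, P x.
Proof.
move=> P0 PD Pp; apply: Cmod_inj_ind => //; apply: chain_cons_ind => mu hs h v.
move: v; apply: tensor_ind => [|x y Px Py|f z].
- by rewrite (linear_fun0 (@dinj_linear _ _ _ _)).
- by rewrite (linear_add (@dinj_linear _ _ _ _)); apply: PD.
- by rewrite -prep_inj.
Qed.

Lemma linear_agree lam mu n m (F G : C mu n -> C lam m) : linear F -> linear G ->
  (forall h v, F (inj h v) = G (inj h v)) -> forall x, F x = G x.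
Proof.
move=> lF lG e; apply: Cmod_inj_ind => [|x y ex ey|h v]; last exact: e.
  by rewrite (linear_fun0 lF) (linear_fun0 lG).
by rewrite (linear_add lF) (linear_add lG) ex ey.
Qed.

Lemma linear_comp (U V W : lmodType R) (G : V -> W) (F : U -> V) :
  linear F -> linear G -> linear (fun x => G (F x)).
Proof. by move=> lF lG c x y; rewrite lF lG. Qed.

Lemma linear_sub (U V : lmodType R) (F G : U -> V) :
  linear F -> linear G -> linear (fun x => F x - G x).
Proof. by move=> lF lG c x y; rewrite lF lG scalerBr opprD addrACA. Qed.

Lemma Cdiff_prep0 lam mu (hs : sdom lam mu) f (y : C mu 0) :
  Cdiff (prep hs f y) = compC hs f y.
Proof.
move: y; apply: linear_agree => [| |h v].
- exact: linear_comp (@prep_linear _ _ _ hs f) (@Cdiff_linear _ _).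
- exact: compC_linear.
rewrite prep_inj Cdiff_inj big_ord1 expr0 scale1r compC_inj.
rewrite face0_pure; exact: dinj_irr.
Qed.

(** The face merging the first two factors gives [compC]; the remaining faces are
    those of [y], with one sign shift. *)
Lemma Cdiff_prep lam mu n (hs : sdom lam mu) f (y : C mu n.+1) :
  Cdiff (prep hs f y) = compC hs f y - prep hs f (Cdiff y).
Proof.
move: y; apply: linear_agree => [| |h v].
- exact: linear_comp (@prep_linear _ _ _ hs f) (@Cdiff_linear _ _).
- apply: linear_sub; first exact: compC_linear.
  exact: linear_comp (@Cdiff_linear _ _) (@prep_linear _ _ _ hs f).
rewrite prep_inj Cdiff_inj big_ord_recl expr0 scale1r compC_inj face0_pure.
congr (_ + _); first exact: dinj_irr.
rewrite Cdiff_inj (linear_combine (@prep_linear _ _ _ hs f)) -sumrN.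
apply: eq_bigr => i _; rewrite prep_inj faceS_pure exprS -scaleNr mulN1r.
congr (_ *: _); exact: dinj_irr.
Qed.

Lemma compM_comp lam mu nu (g : homW H mu nu) (f : homW H lam mu) s (x : Mc nu s) :
  compM f (compM g x) = compM (homW_comp g f) x.
Proof.
case: s x => [|rho s] x.
  apply: mval_inj; apply: functional_extensionality_dep => m.
  by rewrite /= homW_compE.
move: x; apply: tensor_ind => [|x y ex ey|k z].
- rewrite (linear_fun0 ((compM_bilinear mu nu (rho :: s)).1 g)).
  rewrite (linear_fun0 ((compM_bilinear lam mu (rho :: s)).1 f)).
  by rewrite (linear_fun0 ((compM_bilinear lam nu (rho :: s)).1 _)).
- rewrite (linear_add ((compM_bilinear mu nu (rho :: s)).1 g)).
  rewrite (linear_add ((compM_bilinear lam mu (rho :: s)).1 f)).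
  by rewrite (linear_add ((compM_bilinear lam nu (rho :: s)).1 _)) ex ey.
by rewrite !compM_pure homW_comp_assoc.
Qed.

Lemma compC_comp lam mu nu n (hs : sdom lam mu) (hs' : sdom mu nu)
    (g : homW H mu nu) (f : homW H lam mu) (x : C nu n) :
  compC hs f (compC hs' g x) = compC (sdom_trans hs hs') (homW_comp g f) x.
Proof.
move: x; apply: linear_agree => [| |h v].
- exact: linear_comp (@compC_linear _ _ _ hs' g) (@compC_linear _ _ _ hs f).
- exact: compC_linear.
rewrite !compC_inj -compM_comp; exact: dinj_irr.
Qed.

Lemma compC_prep lam mu nu n (hs : sdom lam mu) (hs' : sdom mu nu)
    (g : homW H mu nu) (f : homW H lam mu) (x : C nu n) :
  compC hs f (prep hs' g x) = prep (sdom_trans hs hs') (homW_comp g f) x.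
Proof.
move: x; apply: linear_agree => [| |h v].
- exact: linear_comp (@prep_linear _ _ _ hs' g) (@compC_linear _ _ _ hs f).
- exact: prep_linear.
rewrite !prep_inj compC_inj compM_pure; exact: dinj_irr.
Qed.

(** Composition is a chain map: both sides reduce to composites by [Cdiff_prep]. *)
Lemma Cdiff_compC lam mu n (hs : sdom lam mu) (f : homW H lam mu) (y : C mu n.+1) :
  Cdiff (compC hs f y) = compC hs f (Cdiff y).
Proof.
move: y; apply: Cmod_ind => [|x y ex ey|nu hs' g z].
- by rewrite !(linear_fun0 (@Cdiff_linear _ _), linear_fun0 (@compC_linear _ _ _ hs f)).
- rewrite (linear_add (@compC_linear _ _ _ hs f)) !(linear_add (@Cdiff_linear _ _)).
  by rewrite (linear_add (@compC_linear _ _ _ hs f)) ex ey.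
rewrite compC_prep; case: n z => [|n] z.
  by rewrite !Cdiff_prep0 compC_comp.
rewrite !Cdiff_prep (linear_add (@compC_linear _ _ _ hs f)).
by rewrite (linear_oppf (@compC_linear _ _ _ hs f)) compC_comp compC_prep.
Qed.

(** By induction on the degree, from the formula for [Cdiff (prep hs f y)] and the
    chain map property, which replaces the simplicial identities. *)
Lemma CdiffK lam n (x : C lam n.+2) : Cdiff (Cdiff x) = 0.
Proof.
elim: n lam x => [|n IH] lam; apply: Cmod_ind.
- by rewrite !(linear_fun0 (@Cdiff_linear _ _)).
- by move=> x y ex ey; rewrite !(linear_add (@Cdiff_linear _ _)) ex ey addr0.
- move=> mu hs f y; rewrite Cdiff_prep (linear_add (@Cdiff_linear _ _)).
  by rewrite (linear_oppf (@Cdiff_linear _ _)) Cdiff_compC Cdiff_prep0 subrr.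
- by rewrite !(linear_fun0 (@Cdiff_linear _ _)).
- by move=> x y ex ey; rewrite !(linear_add (@Cdiff_linear _ _)) ex ey addr0.
- move=> mu hs f y; rewrite Cdiff_prep (linear_add (@Cdiff_linear _ _)).
  rewrite (linear_oppf (@Cdiff_linear _ _)) Cdiff_compC Cdiff_prep IH.
  by rewrite (linear_fun0 (@prep_linear _ _ _ hs f)) subr0 subrr.
Qed.


Definition tcoord lam mu (V : lmodType R) d : tensor (homW H lam mu) V -> V :=
  tlift (fun f v => coord d f *: v).

Lemma tcoord_bilinear lam mu (V : lmodType R) d :
  bilinear_map (fun (f : homW H lam mu) (v : V) => coord d f *: v).
Proof.
split=> [f|v] c x y; first by rewrite scalerDr !scalerA mulrC.
by rewrite coord_linear scalerDl scalerA.
Qed.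

Lemma tcoord_pure lam mu (V : lmodType R) d (f : homW H lam mu) (v : V) :
  tcoord d (pure f v) = coord d f *: v.
Proof. by rewrite /tcoord tlift_pure //; apply: tcoord_bilinear. Qed.

Lemma tcoord_linear lam mu (V : lmodType R) d : linear (@tcoord lam mu V d).
Proof. exact: (tlift_linear (tcoord_bilinear lam mu V d)). Qed.

(** Hom^wedge is free on the [phi_d], so tensors have unique coordinates. *)
Lemma tcoord_sum lam mu (V : lmodType R) (x : tensor (homW H lam mu) V) :
  x = \sum_(d in dist2w mu lam) pure (phiW H mu lam d) (tcoord d x).
Proof.
move: x; apply: tensor_ind => [|x y ex ey|f v].
- rewrite big1 // => d _; rewrite (linear_fun0 (@tcoord_linear lam mu V d)).
  exact: (linear_fun0 (pure_linear_r _)).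
- rewrite {1}ex {1}ey -big_split; apply: eq_bigr => d _ /=.
  by rewrite (linear_add (@tcoord_linear lam mu V d)) (linear_add (pure_linear_r _)).
rewrite {1}(homW_sum f) (linear_combine (pure_linear_l v)).
apply: eq_bigr => d _; rewrite tcoord_pure.
by rewrite (linear_scale (pure_linear_r _)).
Qed.

(** The coordinate of a chain at first step [mu] and basis element [phi_d]. *)
Definition coordC lam mu n (hs : sdom lam mu) d (x : C lam n.+1) : C mu n :=
  fun h => tcoord d (x (chain_cons hs h)).

Lemma coordC_linear lam mu n hs d : linear (@coordC lam mu n hs d).
Proof.
move=> c x y; apply: dsum_ext => h.
exact: (@tcoord_linear lam mu (Mc mu h) d c (x (chain_cons hs h)) (y (chain_cons hs h))).
Qed.

Lemma prep_same lam mu n (hs hs' : sdom lam mu) f (y : C mu n) h :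
  prep hs f y (chain_cons hs' h) = pure f (y h).
Proof.
rewrite (bool_irrelevance hs' hs) /prep (linear_sum_fun (@dsum_app_linear _ _ _ _)).
rewrite (bigD1 h) //= dinj_in big1 ?addr0 // => h' ne.
by rewrite dinj_out //; apply: contra_neq ne => /chain_cons_inj.
Qed.

Lemma prep_other lam mu nu n (hs : sdom lam mu) (hs' : sdom lam nu) f (y : C mu n) h :
  mu != nu -> prep hs f y (chain_cons hs' h) = 0.
Proof.
move=> ne; rewrite /prep (linear_sum_fun (@dsum_app_linear _ _ _ _)).
rewrite big1 // => h' _; rewrite dinj_out //.
by apply: contra_neq ne => /(congr1 val) [].
Qed.

Lemma coordC_prep lam mu n (hs hs' : sdom lam mu) d f (y : C mu n) :
  coordC hs' d (prep hs f y) = coord d f *: y.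
Proof. by apply: dsum_ext => h; rewrite /coordC prep_same tcoord_pure. Qed.

Lemma coordC_prep_other lam mu nu n (hs : sdom lam mu) (hs' : sdom lam nu) d f (y : C mu n) :
  mu != nu -> coordC hs' d (prep hs f y) = 0.
Proof.
move=> ne; apply: dsum_ext => h; rewrite /coordC prep_other //.
exact: (linear_fun0 (@tcoord_linear _ _ _ d)).
Qed.

Lemma coordC_eq0 lam n (x : C lam n.+1) :
  (forall mu (hs : sdom lam mu) d, d \in dist2w mu lam -> coordC hs d x = 0) -> x = 0.
Proof.
move=> h; apply: dsum_ext; apply: chain_cons_ind => mu hs g.
apply: etrans (tcoord_sum _) _; apply: big1 => d hd.
have /(congr1 (fun z : C mu n => z g)) := h mu hs d hd; rewrite /coordC => ->.
exact: (linear_fun0 (pure_linear_r _)).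
Qed.

Lemma coordC_compC lam mu nu n (hs : sdom lam mu) (hs' : sdom lam nu) d f (y : C mu n.+1) :
  ~~ sdom mu nu -> coordC hs' d (compC hs f y) = 0.
Proof.
move=> ns; move: y; apply: Cmod_ind => [|x y ex ey|rho hr g z].
- rewrite (linear_fun0 (@compC_linear _ _ _ hs f)).
  exact: (linear_fun0 (@coordC_linear _ _ _ hs' d)).
- rewrite (linear_add (@compC_linear _ _ _ hs f)).
  by rewrite (linear_add (@coordC_linear _ _ _ hs' d)) ex ey addr0.
rewrite compC_prep coordC_prep_other //; apply: contraNneq ns => <-.
exact: hr.
Qed.

(** The composites [compC] have first steps strictly above that of the original
    chain, so only the summand through [mu] itself contributes. *)
Lemma coordC_Cdiff lam mu n (hs : sdom lam mu) d (x : C lam n.+2) :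
  (forall nu (hs' : sdom lam nu) h, sdom nu mu -> x (chain_cons hs' h) = 0) ->
  coordC hs d (Cdiff x) = - Cdiff (coordC hs d x).
Proof.
move=> h0; have lin1 := linear_comp (@Cdiff_linear lam n.+1) (@coordC_linear _ _ _ hs d).
have lin2 := linear_comp (@coordC_linear _ _ _ hs d) (@Cdiff_linear mu n).
rewrite [in LHS](dsum_dinj x) [in RHS](dsum_dinj x).
rewrite (linear_sum_fun lin1) (linear_sum_fun lin2) -sumrN.
apply: eq_bigr => g _; move: g; apply: chain_cons_ind => nu hs' h.
case: (boolP (sdom nu mu)) => [lt|ns].
  rewrite (h0 _ _ _ lt) (linear_fun0 (@dinj_linear _ _ _ _)).
  by rewrite (linear_fun0 lin1) (linear_fun0 lin2) oppr0.
move: (x _); apply: tensor_ind => [|u v eu ev|f z].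
- rewrite (linear_fun0 (@dinj_linear _ _ _ _)).
  by rewrite (linear_fun0 lin1) (linear_fun0 lin2) oppr0.
- rewrite (linear_add (@dinj_linear _ _ _ _)).
  by rewrite (linear_add lin1) (linear_add lin2) eu ev opprD.
rewrite -prep_inj Cdiff_prep (linear_add (@coordC_linear _ _ _ hs d)) coordC_compC // add0r.
rewrite (linear_oppf (@coordC_linear _ _ _ hs d)); congr (- _).
case: (eqVneq nu mu) => [e|ne].
  move: hs' h z f ns; rewrite e => hs' h z f ns.
  by rewrite !coordC_prep (linear_scale (@Cdiff_linear _ _)).
by rewrite !coordC_prep_other // (linear_fun0 (@Cdiff_linear _ _)).
Qed.

Lemma Kmod_lin lam n c (x y : C lam n) : Kmod x -> Kmod y -> Kmod (c *: x + y).
Proof. exact: span_lin. Qed.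

Lemma Kmod_add lam n (x y : C lam n) : Kmod x -> Kmod y -> Kmod (x + y).
Proof. by move=> hx hy; rewrite -[x]scale1r; apply: Kmod_lin. Qed.

Lemma Kmod_prep lam mu n (hs : sdom lam mu) d (y : C mu n) :
  d \in dist2w mu lam -> Kmod y -> Kmod (prep hs (phiW H mu lam d) y).
Proof.
move=> hd; move: y; apply: span_closed_ind => [|c x y hx hy|_ [h [z [hz ->]]]].
- by rewrite (linear_fun0 (@prep_linear _ _ _ hs _)); apply: span_0.
- by rewrite prep_linear; apply: Kmod_lin.
apply: span_incl; exists (chain_cons hs h), (pure (phiW H mu lam d) z).
by split; [exists d, (phiW H mu lam d), z; rewrite phiWE | rewrite prep_inj].
Qed.

Lemma Kmod_prep_all lam mu n (hs : sdom lam mu) f (y : C mu n) :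
  Kmod y -> Kmod (prep hs f y).
Proof.
move=> hy; rewrite (homW_sum f) (linear_combine (prep_linear_hom hs y)).
by apply: span_sum => d hd; apply: Kmod_prep.
Qed.

Lemma coordC_Kmod lam mu n (hs : sdom lam mu) d (x : C lam n.+1) :
  d \in dist2w mu lam -> Kmod x -> Kmod (coordC hs d x).
Proof.
move=> hd; move: x; apply: span_closed_ind => [|c x y hx hy|_ [g [z [+ ->]]]].
- by rewrite (linear_fun0 (@coordC_linear _ _ _ hs d)); apply: span_0.
- by rewrite coordC_linear; apply: Kmod_lin.
move: g z; apply: chain_cons_ind => nu hs' h z [d' [f [z' [hd' ef hz' ->]]]].
rewrite -prep_inj; case: (eqVneq nu mu) => [e|ne]; last first.
  by rewrite coordC_prep_other //; apply: span_0.
clear z; move: hs' h d' f z' hd' ef hz'; rewrite e => hs' h d' f z' hd' ef hz'.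
rewrite coordC_prep; have -> : f = phiW H mu lam d' by apply: mval_inj; rewrite ef phiWE.
rewrite -[X in Kmod X]addr0; apply: Kmod_lin; last exact: span_0.
by apply: span_incl; exists h, z'.
Qed.

Lemma chain0P lam (g : chain lam 0) : g = chain0 lam.
Proof. by apply: val_inj; case: g => -[|]. Qed.

Definition at0 lam (x : C lam 0) : dual (Mod lam) := x (chain0 lam).

Definition of0 lam (e : dual (Mod lam)) : C lam 0 := inj (chain0 lam) (e : Mc lam [::]).

Lemma at0_inj lam (x y : C lam 0) : at0 x = at0 y -> x = y.
Proof. by move=> e; apply: dsum_ext => g; rewrite (chain0P g). Qed.

Lemma of0K lam (e : dual (Mod lam)) : at0 (of0 e) = e.
Proof. exact: dinj_in. Qed.

Lemma at0_linear lam : linear (@at0 lam).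
Proof. by []. Qed.

Lemma at0_Kmod lam (x : C lam 0) : Kmod x -> std_span (at0 x).
Proof.
move: x; apply: span_closed_ind => [|c x y hx hy|_ [g [z [+ ->]]]].
- exact: span_0.
- by rewrite at0_linear; apply: span_lin.
rewrite (chain0P g) in z *; move=> hz; rewrite /at0 dinj_in.
by apply: span_incl; rewrite -Kgen_nil.
Qed.

Lemma of0_Kmod lam (e : dual (Mod lam)) : std_span e -> Kmod (of0 e).
Proof.
move: e; apply: span_closed_ind => [|c x y hx hy|e].
- by rewrite /of0 (linear_fun0 (@dinj_linear _ _ _ _)); apply: span_0.
- by rewrite /of0 dinj_linear; apply: Kmod_lin.
rewrite -Kgen_nil => he; apply: span_incl.
by exists (chain0 lam), e.
Qed.

Lemma at0_compC lam mu (hs : sdom lam mu) (f : homW H lam mu) (y : C mu 0) :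
  at0 (compC hs f y) = dual_comp (at0 y) f.
Proof.
have -> : y = of0 (at0 y) by apply: at0_inj; rewrite of0K.
rewrite of0K /of0 compC_inj.
have e := @dinj_irr lam 0 [::] (rebase_subproof (chain0 mu) hs) (chain0_subproof lam)
  (compM f (s := [::]) (at0 y)).
exact: etrans (congr1 (fun x : C lam 0 => x (chain0 lam)) e) (dinj_in _).
Qed.

End Complex.

(** * Exactness *)

Section Exactness.
Local Open Scope ring_scope.
Local Open Scope classical_set_scope.
Variables (R : idomainType) (q : R) (r : nat) (H : heckeAlg q r).
Hypotheses (hq : q \is a GRing.unit) (hr : (0 < r)%N).
Implicit Types (lam mu nu : composition r) (d : 'S_r) (n : nat).

Local Notation Mod := (Defs.permM H).
Local Notation C := (@Cmod R q r H).
Local Notation Mc := (@Mchain R q r H).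
Notation inj g v := (dinj (V := fun h : chain _ _ => Mc _ h) (i := g) v).

Lemma at0_add lam (x y : C lam 0) : at0 (x + y) = at0 x + at0 y.
Proof. by []. Qed.

Lemma via_larger_Cdiff lam (e : dual (Mod lam)) : via_larger e -> exists y : C lam 1, at0 (Cdiff y) = e.
Proof.
move: e; apply: span_closed_ind => [|c x y [x' <-] [y' <-]|_ [mu [f [e' [hs ->]]]]].
- by exists 0; rewrite (linear_fun0 (@Cdiff_linear _ _ _ H lam 0)).
- exists (c *: x' + y'); by rewrite Cdiff_linear at0_linear.
exists (prep hs f (of0 e')).
by rewrite Cdiff_prep0 at0_compC of0K.
Qed.

Lemma Cdiff_via_larger lam (y : C lam 1) : via_larger (at0 (Cdiff y)).
Proof.
move: y; apply: Cmod_ind => [|x y hx hy|mu hs f y].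
- by rewrite (linear_fun0 (@Cdiff_linear _ _ _ H lam 0)); apply: span_0.
- rewrite (linear_add (@Cdiff_linear _ _ _ H lam 0)) at0_add -[at0 (Cdiff x)]scale1r.
  exact: span_lin.
rewrite Cdiff_prep0 at0_compC; apply: span_incl.
by exists mu, f, (at0 y).
Qed.

Lemma Caug_linear lam : linear (@Caug R q r H lam).
Proof.
move=> c x y; apply: mval_inj; apply: functional_extensionality_dep => m.
exact: (dual_app_linear (mval m) c (at0 x) (at0 y)).
Qed.

Lemma Caug_app lam (x : C lam 0) m : mval (Caug x) m = mval (at0 x) (mval m).
Proof. by []. Qed.

Lemma Caug_Cdiff lam (y : C lam 1) : Caug (Cdiff y) = 0.
Proof.
apply: mval_inj; apply: functional_extensionality_dep => m.
rewrite Caug_app; case: (boolP (is_part lam)) => hp.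
  by have [h ->] := specht_ract m hp; rewrite via_larger_specht //; apply: Cdiff_via_larger.
have -> : mval m = 0.
  by have /asboolP/specht_setP := mvalP m; rewrite (negPf hp).
exact: linear_fun0 (dual_linear _).
Qed.

Lemma ker_Caug lam (x : C lam 0) : Kmod x -> Caug x = 0 -> x = 0.
Proof.
move=> /at0_Kmod hK h0; apply: at0_inj.
case: (boolP (is_part lam)) => hp; last first.
  have [c ->] := std_span_sum hK; rewrite big1 // => d /asboolP[hp'].
  by rewrite hp' in hp.
apply: (std_span_specht_inj hq) => // h.
have := congr1 (fun e : dual (specht H lam) => mval e (ModOf (specht_mem h hp))) h0.
by rewrite Caug_app.
Qed.

Lemma Cdiff_span0 lam (x : C lam 0) : exists y : C lam 1, exists2 k, Kmod k & x = Cdiff y + k.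
Proof.
have [j Jj [k Kk e]] := straightening hq hr (at0 x).
have [y hy] := via_larger_Cdiff Jj; exists y, (of0 k); first exact: of0_Kmod.
by apply: at0_inj; rewrite at0_add hy of0K.
Qed.

(** The coordinate [tcoord], with a return type that can be stated for all chains
    of length one at once. *)
Definition coef1 lam d (s : seq (composition r)) : Mc lam s -> dual (Mod (head lam s)) :=
  match s return Mc lam s -> dual (Mod (head lam s)) with
  | mu :: s' => match s' return Mc lam (mu :: s') -> dual (Mod mu) with
                | [::] => fun x => tcoord d x
                | _ => fun=> 0
                end
  | [::] => fun=> 0
  end.

Lemma chain1_ind lam (P : chain lam 1 -> Prop) :
  (forall mu (hs : sdom lam mu), P (chain_cons hs (chain0 mu))) -> forall g, P g.
Proof. by move=> h; apply: chain_cons_ind => mu hs g; rewrite (chain0P g). Qed.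

Lemma at0_Cdiff_sum lam (x : C lam 1) m :
  (mval (at0 (Cdiff x)) m : R) = \sum_(g : chain lam 1)
    \sum_(d in dist2w (head lam g) lam)
     (mval (coef1 d (x g)) (mval (mval (phiW H (head lam g) lam d)) m) : R).
Proof.
rewrite {1}(dsum_dinj x) (linear_sum_fun (@Cdiff_linear _ _ _ H lam 0)).
rewrite (linear_sum_fun (@at0_linear _ _ _ H lam)).
rewrite (linear_sum_fun (V := R^o) (dual_app_linear m)).
apply: eq_bigr => g _; move: g; apply: chain1_ind => mu hs.
rewrite {1}(tcoord_sum (x (chain_cons hs (chain0 mu)))).
rewrite (linear_sum_fun (@dinj_linear _ _ _ _)).
rewrite (linear_sum_fun (@Cdiff_linear _ _ _ H lam 0)).
rewrite (linear_sum_fun (@at0_linear _ _ _ H lam)).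
rewrite (linear_sum_fun (V := R^o) (dual_app_linear m)).
apply: eq_bigr => d _; rewrite -prep_inj Cdiff_prep0 at0_compC.
by rewrite -/(of0 _) of0K.
Qed.

Lemma ker_Cdiff1 lam (x : C lam 1) : tame lam -> Kmod x -> Cdiff x = 0 -> x = 0.
Proof.
move=> ht hK h0.
have cI : injective (fun g : chain lam 1 => head lam g).
  apply: chain1_ind => mu hs; apply: chain1_ind => nu hs' /= e.
  by apply: val_inj; rewrite /= e.
have hc (g : chain lam 1) : sdom lam (head lam g).
  by move: g; apply: chain1_ind.
have y0 := @standard_phi_inj R q r H hq hr lam _ (fun g : chain lam 1 => head lam g)
  (fun g d => coef1 d (x g)) ht cI hc.
apply: coordC_eq0 => mu hs d hd; apply: at0_inj.
apply: (y0 _ _ (chain_cons hs (chain0 mu)) d hd).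
  apply: chain1_ind => nu hs' d' hd'.
  exact: at0_Kmod (coordC_Kmod hs' hd' hK).
by move=> m; rewrite -at0_Cdiff_sum h0.
Qed.

(** Upward induction on the first step: once the coordinates at smaller first steps
    vanish, the coordinate at [mu] is a cycle in degree one less. *)
Lemma ker_CdiffS n lam (x : C lam n.+1) : tame lam -> Kmod x -> Cdiff x = 0 -> x = 0.
Proof.
elim: n lam x => [|n IH] lam x ht hK h0; first exact: ker_Cdiff1.
suff main mu (hs : sdom lam mu) d : d \in dist2w mu lam -> coordC hs d x = 0 by apply: coordC_eq0.
move En : (dweight lam mu) => w; elim/ltn_ind: w mu En hs d => w IHw mu En hs d hd.
have tmu : tame mu.
  by move=> nu mn; apply: ht; apply: dom_trans mn; case/andP: hs.
apply: (IH mu) => //; first exact: coordC_Kmod.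
apply/eqP; rewrite -oppr_eq0 -coordC_Cdiff ?h0 ?(linear_fun0 (@coordC_linear _ _ _ _ _ _ _ hs d)) //.
move=> nu hs' h lt; apply: etrans (tcoord_sum _) _; apply: big1 => d' hd'.
have z0 : coordC hs' d' x = 0.
  by apply: (IHw (dweight lam nu)) => //; rewrite -En; apply: dweight_lt lt; case/andP: hs'.
have /(congr1 (fun z : C nu n.+1 => z h)) := z0; rewrite /coordC => ->.
exact: (linear_fun0 (pure_linear_r _)).
Qed.

(** Downward induction on the first step: writing [y = d z + k], the element
    [prep f y] is a boundary plus [prep f k], up to a term with larger first steps. *)
Lemma Cdiff_span n lam (x : C lam n) : exists y : C lam n.+1, exists2 k, Kmod k & x = Cdiff y + k.
Proof.
elim: n lam x => [|n IH] lam x; first exact: Cdiff_span0.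
pose good (x : C lam n.+1) := exists y : C lam n.+2, exists2 k, Kmod k & x = Cdiff y + k.
have good0 : good 0.
  exists 0, 0; first exact: span_0.
  by rewrite (linear_fun0 (@Cdiff_linear _ _ _ H lam n.+1)) addr0.
have goodD u v : good u -> good v -> good (u + v).
  move=> [y1 [k1 K1 ->]] [y2 [k2 K2 ->]]; exists (y1 + y2), (k1 + k2).
    exact: Kmod_add.
  by rewrite (linear_add (@Cdiff_linear _ _ _ H lam n.+1)) addrACA.
suff main mu (hs : sdom lam mu) f (y : C mu n) : good (prep hs f y).
  by move: x; apply: Cmod_ind.
pose B := \sum_(e < size lam) r.
have wB nu : (dweight lam nu <= B)%N by apply: leq_sum => e _; apply: psum_leq.
move En : (B - dweight lam mu)%N => w; elim/ltn_ind: w mu En hs f y => w IHw mu En hs f y.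
have [z [k hk ->]] := IH mu y.
rewrite (linear_add (@prep_linear _ _ _ H _ _ _ hs f)).
apply: (goodD); last first.
  exists 0, (prep hs f k); first exact: Kmod_prep_all.
  by rewrite (linear_fun0 (@Cdiff_linear _ _ _ H lam n.+1)) add0r.
have -> : prep hs f (Cdiff z) = compC hs f z + Cdiff (- prep hs f z).
  by rewrite (linear_oppf (@Cdiff_linear _ _ _ H lam n.+1)) Cdiff_prep opprB addrC subrK.
apply: (goodD); last by exists (- prep hs f z), 0; [exact: span_0 | rewrite addr0].
move: z; apply: Cmod_ind => [|u v gu gv|nu hs' g z].
- by rewrite (linear_fun0 (@compC_linear _ _ _ H _ _ _ hs f)).
- by rewrite (linear_add (@compC_linear _ _ _ H _ _ _ hs f)); apply: (goodD).
rewrite compC_prep; apply: (IHw (B - dweight lam nu)%N) => //.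
rewrite -En ltn_sub2l //.
  apply: leq_trans (wB nu); apply: dweight_lt hs'; by case/andP: hs.
apply: dweight_lt hs'; by case/andP: hs.
Qed.

End Exactness.

Local Open Scope ring_scope.
Local Open Scope classical_set_scope.

Theorem theorem4p5 (R : idomainType) (q : R) (hq : q \is a GRing.unit)
    (r : nat) (hr : (0 < r)%N) (H : heckeAlg q r)
    (lam : composition r) (hlam : tame lam) :
  (forall k : nat,
     [set x + y | x in range (dt H lam k.+1) & y in Kt H lam k] = setT /\
     [set x | dt H lam k x = 0] `&` Kt H lam k = [set 0]) /\
  (forall k : nat, range (dt H lam k.+1) = [set x | dt H lam k x = 0]).
Proof.
have dlin k : linear (dt H lam k).
  case: k => [|[|n]]; [by move=> c x y; rewrite scaler0 addr0 | exact: Caug_linear | exact: Cdiff_linear].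
have K_0 k : Kt H lam k 0 by case: k => [|n] //; apply: span_0.
have span k x : exists y, exists2 z, Kt H lam k z & x = dt H lam k.+1 y + z.
  case: k x => [|n] x; last exact: (Cdiff_span hq hr).
  have [e he] := specht_dual_surj hq hr x.
  exists (of0 e), 0 => //; rewrite addr0 -he.
  by rewrite -[RHS]/(dual_restr (at0 (of0 e))) of0K.
have ker k x : Kt H lam k x -> dt H lam k x = 0 -> x = 0.
  case: k x => [|[|n]] x //=; [exact: (ker_Caug hq) | exact: (ker_CdiffS hq hr)].
have dd k x : dt H lam k (dt H lam k.+1 x) = 0.
  case: k x => [|[|n]] x //=; [exact: (Caug_Cdiff hq) | exact: CdiffK].
split=> k.
  split; apply/seteqP; split=> [x|x] //=.
  - move=> _; have [y [z hz ->]] := span k x.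
    by exists (dt H lam k.+1 y); [exists y | exists z].
  - by case=> h1 h2; apply: (ker k).
  - by move=> ->; split; rewrite ?(linear_fun0 (dlin k)).
apply/seteqP; split=> [x [y _ <-]|x] /=; first exact: dd.
move=> hx; have [y [z hz e]] := span k x; exists y => //.
have z0 : z = 0.
  apply: (ker k) => //; move: hx; rewrite e (linear_add (dlin k)) dd add0r //.
by rewrite e z0 addr0.
Qed.
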